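(* The boundary value problem $L$ has a countable set of eigenvalues. They are real and can be numbered as $\{\lambda_{nk}\}_{n\in\mathbb N,\,k=1,\dots,m}$ (counting multiplicities) so that, with $\rho_{nk}=\sqrt{\lambda_{nk}}$, $$\rho_{n1}=n-1+\frac{\alpha}{\pi}+\varkappa_n,\quad \rho_{n2}=n-\frac{\alpha}{\pi}+\varkappa_n,\quad \rho_{nk}=n-\tfrac12+\varkappa_n\ (k\in\mathcal I_3),\quad \rho_{nk}=n+\varkappa_n\ (k\in\mathcal I_4),$$ where $\mathcal I_3,\mathcal I_4$ are fixed index sets with $\mathcal I_3\cup\mathcal I_4=\{3,\dots,m\}$, $\mathcal I_3\cap\mathcal I_4=\varnothing$, $|\mathcal I_3|=p-1$, $|\mathcal I_4|=m-p-1$.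
   Context: Let $m\ge 4$ and $2\le p\le m-2$ be integers. Let $G$ be a star-shaped graph with $m$ edges $e_1,\dots,e_m$ of length $\pi$; edge $e_j$ is parametrized by $x_j\in[0,\pi]$, where $x_j=0$ is the boundary vertex of $e_j$ and $x_j=\pi$ is the common internal vertex. For $j=1,\dots,m$ let $\sigma_j\in L_2(0,\pi)$ be real-valued (the potentials; formally $q_j=\sigma_j'\in W_2^{-1}(0,\pi)$). For a function $y_j$ on $[0,\pi]$ set $y_j^{[1]}=y_j'-\sigma_j y_j$ (quasi-derivative) and $\ell_j y_j=-(y_j^{[1]})'-\sigma_j y_j^{[1]}-\sigma_j^2 y_j$, with domain $\{y_j\in W_2^1[0,\pi]: y_j^{[1]}\in W_1^1[0,\pi],\ \ell_j y_j\in L_2(0,\pi)\}$. Consider the system $\ell_j y_j=\lambda y_j$, $j=1,\dots,m$. The problem $L$ is this system with the matching conditions $y_1(\pi)=y_j(\pi)$ ($j=2,\dots,m$), $\sum_{j=1}^m y_j^{[1]}(\pi)=0$, and boundary conditions $y_j^{[1]}(0)=0$ for $j=1,\dots,p$, $y_j(0)=0$ for $j=p+1,\dots,m$. Here $\rho=\sqrt\lambda$ with $\operatorname{Re}\rho\ge0$, $\alpha=\arccos\sqrt{p/m}$, and the symbol $\{\varkappa_n\}$ denotes (possibly different in each occurrence) sequences belonging to $\ell_2$. *)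

(* Defs.v *)
From HB Require Import structures.
From mathcomp Require Import all_boot all_order all_algebra.
From mathcomp Require Import all_classical all_reals all_analysis.
Set Implicit Arguments.
Unset Strict Implicit.
Unset Printing Implicit Defensive.
Import Order.TTheory GRing.Theory Num.Theory.
Import numFieldNormedType.Exports.
Local Open Scope classical_set_scope.
Local Open Scope ring_scope.

Section QGraph.
Variable R : realType.

Definition Rint0 (x : R) (f : R -> R) : R :=
  \int[@lebesgue_measure R]_(t in `[0, x]) f t.

Definition I0pi : set R := `[0, pi].

Definition L2_0pi (s : R -> R) : Prop :=
  measurable_fun `[0, pi] s /\
  (\int[@lebesgue_measure R]_(x in I0pi) ((s x) ^+ 2)%:E < +oo)%E.

(* Carathéodory (absolutely continuous) solution on one edge of the system
     y' = sigma y + z   (z = y^[1], the quasi-derivative),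
     z' = - sigma z - sigma^2 y - lambda y,
   written with complex values split into real/imaginary parts:
   lambda = a + i b, y = u + i v, z = w + i s. *)
Definition edge_sol (sg : R -> R) (a b : R) (u v w s : R -> R) : Prop :=
  {within `[0, pi], continuous u} /\ {within `[0, pi], continuous v} /\
  {within `[0, pi], continuous w} /\ {within `[0, pi], continuous s} /\
  forall x, 0 <= x <= pi ->
    [/\ u x = u 0 + Rint0 x (fun t => sg t * u t + w t),
        v x = v 0 + Rint0 x (fun t => sg t * v t + s t),
        w x = w 0 + Rint0 x (fun t => - sg t * w t - sg t ^+ 2 * u t
                                      - (a * u t - b * v t)) &
        s x = s 0 + Rint0 x (fun t => - sg t * s t - sg t ^+ 2 * v t
                                      - (a * v t + b * u t))].

(* A (complex) function on the star graph: y_j = qu j + i qv j,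
   y_j^[1] = qw j + i qs j. *)
Record qstate (m : nat) := QS {
  qu : 'I_m -> R -> R; qv : 'I_m -> R -> R;
  qw : 'I_m -> R -> R; qs : 'I_m -> R -> R }.

(* Y solves problem L with spectral parameter lambda = a + i b.
   Edges are 0-indexed: edge j (0 <= j < m) is e_{j+1} of the paper. *)
Definition is_solL (m p : nat) (sigma : 'I_m -> R -> R) (a b : R)
    (Y : qstate m) : Prop :=
  [/\ forall j, edge_sol (sigma j) a b (qu Y j) (qv Y j) (qw Y j) (qs Y j),
      forall j j', qu Y j pi = qu Y j' pi /\ qv Y j pi = qv Y j' pi,
      \sum_(j < m) qw Y j pi = 0 /\ \sum_(j < m) qs Y j pi = 0,
      forall j : 'I_m, (j < p)%N -> qw Y j 0 = 0 /\ qs Y j 0 = 0 &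
      forall j : 'I_m, (p <= j)%N -> qu Y j 0 = 0 /\ qv Y j 0 = 0].

Definition qzero (m : nat) (Y : qstate m) : Prop :=
  forall j x, 0 <= x <= pi -> qu Y j x = 0 /\ qv Y j x = 0.

(* Complex linear combination  sum_{n < N, k, lam n k = a} (c1 + i c2) * phi n k
   (only the y-components are compared; they determine the quasi-derivatives). *)
Definition comb_u m (N : nat) (lam : nat -> 'I_m -> R) (a : R)
    (phi : nat -> 'I_m -> qstate m) (c1 c2 : nat -> 'I_m -> R) j x : R :=
  \sum_(n < N) \sum_(k < m | lam n k == a)
     (c1 n k * qu (phi n k) j x - c2 n k * qv (phi n k) j x).
Definition comb_v m (N : nat) (lam : nat -> 'I_m -> R) (a : R)
    (phi : nat -> 'I_m -> qstate m) (c1 c2 : nat -> 'I_m -> R) j x : R :=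
  \sum_(n < N) \sum_(k < m | lam n k == a)
     (c1 n k * qv (phi n k) j x + c2 n k * qu (phi n k) j x).

(* |rho - c|^2 where rho = sqrt(l) with Re rho >= 0, l real:
   rho = Num.sqrt l if l >= 0, rho = i * Num.sqrt (-l) if l < 0. *)
Definition rho_dist2 (l c : R) : R :=
  (Num.sqrt l - c) ^+ 2 + (Num.sqrt (- l)) ^+ 2.

(* A nonnegative sequence with bounded partial sums, i.e. (sqrt of it) in l_2. *)
Definition summable_nonneg (f : nat -> R) : Prop :=
  exists M : R, forall N, \sum_(n < N) f n <= M.

End QGraph.

(* Main.v *)
Require Import Defs.
From HB Require Import structures.
From mathcomp Require Import all_boot all_order all_algebra.
From mathcomp Require Import all_classical all_reals all_analysis.
From mathcomp Require Import measurable_realfun ring lra zify.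
Import Order.TTheory GRing.Theory Num.Theory.
Import numFieldNormedType.Exports.
Local Open Scope classical_set_scope.
Local Open Scope ring_scope.

Set Implicit Arguments.
Unset Strict Implicit.
Unset Printing Implicit Defensive.

(* The solutions on an edge are written y = r sin theta, y^[1] = r cos theta. The angle
   theta solves a scalar equation, and comparison for it shows that theta(pi, lambda) is
   continuous, strictly increasing in lambda and positive. A real lambda is an eigenvalue iff
   either at least two of the functions y_j(pi, lambda) vanish (d zeros give multiplicity
   d - 1), or none vanishes and the sum of the cot theta_j(pi, lambda) is zero. This sum is
   strictly decreasing between its poles, so the eigenvalues interlace with the poles, and the
   number of eigenvalues <= lambda is sum_j floor(theta_j / pi), plus one if lambda is not a
   pole and the sum of cotangents is <= 0.
   For lambda = rho^2 the angle is replaced by the one with tangent rho tan theta, which stays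
   in the same interval [k pi, (k + 1) pi). It equals theta(0) + rho pi + O(d_n) for
   |rho - n| <= 1, where sum d_n^2 < oo by Gronwall's and Bessel's inequalities. Evaluating
   the counting function at (c - d_n)^2 and (c + d_n)^2, for each expected position c, locates
   the eigenvalues. Non-real eigenvalues are excluded by the Lagrange identity. *)

(** * Integration and absolutely continuous functions on [0, pi] *)

(** Each sigma_j is merely square integrable, so it can never be differentiated. The angle is
    therefore built from y^[1]: the right-hand side of its equation is integrable in x and Lipschitz
    in theta with an integrable constant, and absolute continuity is always used as an integral
    representation. The angle with tangent rho tan theta is the natural one because for sigma = 0 it
    rotates with constant speed rho, which theta does not. At the inner vertex it is close to pi/2 +
    rho pi on the p edges with y^[1](0) = 0 (Neumann) and to rho pi on the others (Dirichlet). The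
    limiting equation for the cotangents is (m - p) cot(rho pi) = p tan(rho pi), that is cos^2(rho
    pi) = p / m; this is the origin of alpha. Near half-integers p poles merge and near integers m -
    p poles do, trapping p - 1 and m - p - 1 eigenvalues between them. There the sign of the sum of
    cotangents is out of control, but it alters the count by at most one, which the trapped
    eigenvalues can afford. *)

Section Integrals.
Variable R : realType.
Notation mu := (@lebesgue_measure R).
Implicit Types (f g : R -> R) (x y c : R).

Definition Itg f := mu.-integrable `[0, pi] (EFin \o f).
(** Bounded measurable functions: the multipliers that preserve [Itg]. *)
Definition Bm f := measurable_fun `[0, pi] f /\
  exists M, forall x, 0 <= x <= pi -> `|f x| <= M.
Definition Cont f := {within `[0, pi], continuous f}.

Lemma in0pi x : `[0, pi]%classic x = (0 <= x <= pi) :> Prop.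
Proof. by rewrite /= in_itv. Qed.

Lemma Itg_eq f g : (forall x, 0 <= x <= pi -> f x = g x) -> Itg f -> Itg g.
Proof.
move=> fg; apply: eq_integrable => // x.
by rewrite inE /= in_itv /= => /fg ->.
Qed.

Lemma ItgD f g : Itg f -> Itg g -> Itg (fun t => f t + g t).
Proof. by move=> If Ig; exact: integrableD If Ig. Qed.

Lemma ItgZ c f : Itg f -> Itg (fun t => c * f t).
Proof. by move=> If; exact: integrableZl c _ If. Qed.

Lemma ItgN f : Itg f -> Itg (fun t => - f t).
Proof. by move=> If; exact: integrableN If. Qed.

Lemma ItgB f g : Itg f -> Itg g -> Itg (fun t => f t - g t).
Proof. by move=> If Ig; exact: ItgD If (ItgN Ig). Qed.

Lemma Itg_abs f : Itg f -> Itg (fun t => `|f t|).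
Proof. by move=> If; apply: integrable_norm. Qed.

Lemma ItgM f g : Itg f -> Bm g -> Itg (fun t => f t * g t).
Proof.
move=> If [mg [M gM]].
apply: (integrableMl _ If mg) => //.
exists M; split; first exact: num_real.
by move=> N MN x /=; rewrite in_itv /= => /gM /le_trans; apply; exact: ltW.
Qed.

Lemma ItgMr f g : Bm g -> Itg f -> Itg (fun t => g t * f t).
Proof.
move=> Bg If; apply: Itg_eq (ItgM If Bg) => x _; exact: mulrC.
Qed.

Lemma Itg_le f g : measurable_fun `[0, pi] f -> Itg g ->
  (forall x, 0 <= x <= pi -> `|f x| <= g x) -> Itg f.
Proof.
move=> mf Ig fg; apply: le_integrable Ig => //.
  exact/measurable_EFinP.
move=> x /=; rewrite in_itv /= => /fg fgx.
by rewrite lee_fin (le_trans fgx)// ler_norm.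
Qed.

Lemma BmD f g : Bm f -> Bm g -> Bm (fun t => f t + g t).
Proof.
move=> [mf [M fM]] [mg [N gN]]; split; first exact: measurable_funD.
exists (M + N) => x x0; rewrite (le_trans (ler_normD _ _))// lerD ?fM ?gN//.
Qed.

Lemma BmM f g : Bm f -> Bm g -> Bm (fun t => f t * g t).
Proof.
move=> [mf [M fM]] [mg [N gN]]; split; first exact: measurable_funM.
by exists (M * N) => x x0; rewrite normrM ler_pM ?fM ?gN.
Qed.

Lemma Bm_cst c : Bm (fun=> c).
Proof. by split; [exact: measurable_cst | exists `|c|]. Qed.

Lemma BmN f : Bm f -> Bm (fun t => - f t).
Proof.
by move=> [mf [M fM]]; split; [exact: measurable_funN | exists M => x /fM; rewrite normrN].
Qed.

Lemma Bm_abs f : Bm f -> Bm (fun t => `|f t|).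
Proof.
move=> [mf [M fM]]; split; first exact: measurableT_comp.
by exists M => x /fM; rewrite normr_id.
Qed.

Lemma BmX f n : Bm f -> Bm (fun t => f t ^+ n).
Proof.
move=> [mf [M fM]]; split; first exact: measurable_funX.
by exists (M ^+ n) => x x0; rewrite normrX lerXn2r ?nnegrE ?fM// (le_trans _ (fM _ x0)).
Qed.

Lemma Cont_Bm f : Cont f -> Bm f.
Proof.
move=> cf; split; first exact: subspace_continuous_measurable_fun.
have /compact_bounded[M [_ fM]] := continuous_compact cf (@segment_compact _ 0 pi).
exists (M + 1) => x x0; apply: (fM (M + 1)); first by rewrite ltrDl.
by exists x => //=; rewrite in_itv.
Qed.

Lemma Bm_Itg f : Bm f -> Itg f.
Proof.
move=> [mf [M fM]]; apply: (@Itg_le _ (fun=> M)) => //.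
apply: continuous_compact_integrable; first exact: segment_compact.
by apply: continuous_subspaceT => x; exact: cvg_cst.
Qed.

Lemma Cont_comp f g : Cont f -> continuous g -> Cont (fun t => g (f t)).
Proof.
move=> cf cg x; apply: (@continuous_comp _ _ _ (f : subspace _ -> R) g); first exact: cf.
exact: cg.
Qed.

Lemma continuous_Cont f : continuous f -> Cont f.
Proof. by move=> cf; apply: continuous_subspaceT. Qed.

Lemma ContD f g : Cont f -> Cont g -> Cont (fun t => f t + g t).
Proof. by move=> cf cg x; apply: cvgD; [exact: cf | exact: cg]. Qed.

Lemma ContM f g : Cont f -> Cont g -> Cont (fun t => f t * g t).
Proof. by move=> cf cg x; apply: cvgM; [exact: cf | exact: cg]. Qed.

Lemma ContN f : Cont f -> Cont (fun t => - f t).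
Proof. by move=> cf x; apply: cvgN; exact: cf. Qed.

Lemma Cont_cst c : Cont (fun=> c).
Proof. by apply: continuous_Cont => x; exact: cvg_cst. Qed.

Lemma ContP f : Cont f <-> forall x, 0 <= x <= pi -> forall e, 0 < e ->
  exists2 d, 0 < d & forall y, 0 <= y <= pi -> `|y - x| < d -> `|f y - f x| < e.
Proof.
rewrite /Cont; split.
  move=> /subspace_continuousP cf x x0 e e0.
  have xI : `[0, pi]%classic x by rewrite in0pi.
  have /cvgrPdist_lt /(_ e e0) [d /= d0 H] := cf x xI.
  exists d => // y y0 xy; rewrite distrC; apply: H => /=.
    by rewrite distrC.
  by rewrite in_itv.
move=> H; apply/subspace_continuousP => x /=; rewrite in_itv /= => x0.
apply/cvgrPdist_lt => e e0.
have [d d0 Hd] := H x x0 e e0.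
exists d => //= y /= xy; rewrite in_itv /= => y0; rewrite distrC; apply: Hd => //.
by rewrite distrC.
Qed.

End Integrals.

(** * Absolute continuity through integral representation; chain and product rules *)

Section AbsolutelyContinuous.
Variable R : realType.
Notation mu := (@lebesgue_measure R).
Implicit Types (f g : R -> R) (x y c : R).
Notation J := (@Defs.Rint0 R).

Lemma in0pi_0 : 0 <= (0 : R) <= pi.
Proof. by rewrite lexx pi_ge0. Qed.
Lemma in0pi_pi : 0 <= (pi : R) <= pi.
Proof. by rewrite lexx pi_ge0. Qed.
Hint Resolve in0pi_0 in0pi_pi : core.

Lemma Itg_sub x f : 0 <= x <= pi -> Itg f -> mu.-integrable `[0, x] (EFin \o f).
Proof.
move=> /andP[x0 xpi] If; apply: integrableS If => //.
by apply: subset_itvl; rewrite bnd_simp.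
Qed.

Lemma J_eq f g x : x <= pi -> (forall t, 0 <= t <= pi -> f t = g t) -> J x f = J x g.
Proof.
move=> xpi fg; apply: eq_Rintegral => t; rewrite inE /= in_itv /= => /andP[t0 tx].
by apply: fg; rewrite t0 (le_trans tx).
Qed.

Lemma JD f g x : 0 <= x <= pi -> Itg f -> Itg g ->
  J x (fun t => f t + g t) = J x f + J x g.
Proof. by move=> xI If Ig; rewrite /Defs.Rint0 RintegralD//; exact: Itg_sub. Qed.

Lemma JZ c f x : 0 <= x <= pi -> Itg f -> J x (fun t => c * f t) = c * J x f.
Proof. by move=> xI If; rewrite /Defs.Rint0 RintegralZl//; exact: Itg_sub. Qed.

Lemma JN f x : 0 <= x <= pi -> Itg f -> J x (fun t => - f t) = - J x f.
Proof.
move=> xI If; rewrite -mulN1r -JZ//; apply: J_eq => [|t _]; first by case/andP: xI.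
by rewrite mulN1r.
Qed.

Lemma JB f g x : 0 <= x <= pi -> Itg f -> Itg g ->
  J x (fun t => f t - g t) = J x f - J x g.
Proof. by move=> xI If Ig; rewrite JD ?JN//; exact: ItgN. Qed.

Lemma J0 f : J 0 f = 0.
Proof. by rewrite /Defs.Rint0 set_itv1 Rintegral_set1. Qed.

Lemma J_cst c x : 0 <= x -> J x (fun=> c) = c * x.
Proof.
move=> x0; rewrite /Defs.Rint0 Rintegral_cst//= lebesgue_measure_itv /=.
rewrite lte_fin; case: ltP => [_|x0']; first by rewrite -EFinB subr0.
by have -> : x = 0 by apply/eqP; rewrite eq_le x0 x0'.
Qed.

Lemma J_mono2 f g x y : 0 <= x -> x <= y -> y <= pi -> Itg f -> Itg g ->
  (forall t, x <= t <= y -> f t <= g t) -> J y f - J x f <= J y g - J x g.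
Proof.
move=> x0 xy ypi If Ig fg.
have y0 := le_trans x0 xy.
have yI : 0 <= y <= pi by rewrite y0.
have Ify := Itg_sub yI If.
have Igy := Itg_sub yI Ig.
rewrite /Defs.Rint0 !Rintegral_itvB ?bnd_simp//.
have xyy : [set` `]x, y]] `<=` [set` `[0, y]].
  by move=> t /=; rewrite !in_itv /= => /andP[/ltW xt ->]; rewrite (le_trans x0).
apply: le_Rintegral => //.
- exact: integrableS Ify.
- exact: integrableS Igy.
by move=> t /=; rewrite in_itv /= => /andP[/ltW xt ty]; rewrite fg ?xt.
Qed.

Lemma J_le f g x : 0 <= x <= pi -> Itg f -> Itg g ->
  (forall t, 0 <= t <= x -> f t <= g t) -> J x f <= J x g.
Proof.
move=> /andP[x0 xpi] If Ig fg; have := J_mono2 (lexx 0) x0 xpi If Ig fg.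
by rewrite !J0 !subr0.
Qed.

Lemma J_ge0 f x : 0 <= x <= pi -> (forall t, 0 <= t <= x -> 0 <= f t) -> 0 <= J x f.
Proof.
move=> xI f0; apply: Rintegral_ge0 => t /=; rewrite in_itv /= => tx; exact: f0.
Qed.

Lemma J_homo f x y : 0 <= x -> x <= y -> y <= pi -> Itg f ->
  (forall t, 0 <= t <= pi -> 0 <= f t) -> J x f <= J y f.
Proof.
move=> x0 xy ypi If f0; rewrite -subr_ge0.
have I0 : Itg (fun=> 0 : R) by apply: Bm_Itg; exact: Bm_cst.
have -> : 0 = J y (fun=> 0) - J x (fun=> 0).
  by rewrite (J_cst 0 x0) (J_cst 0 (le_trans x0 xy)) !mul0r subr0.
apply: J_mono2 => // t /andP[xt ty].
by rewrite f0// (le_trans x0 xt) (le_trans ty).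
Qed.

Lemma J_abs2 f g x y : 0 <= x -> x <= y -> y <= pi -> Itg f -> Itg g ->
  (forall t, x <= t <= y -> `|f t| <= g t) -> `|J y f - J x f| <= J y g - J x g.
Proof.
move=> x0 xy ypi If Ig fg; rewrite ler_norml; apply/andP; split; last first.
  by apply: J_mono2 => // t /fg; apply: le_trans; exact: ler_norm.
have y0 := le_trans x0 xy.
have h : J y (fun t => - g t) - J x (fun t => - g t) <= J y f - J x f.
  apply: J_mono2 => //; first exact: ItgN.
  by move=> t /fg; rewrite lerNl => h; rewrite (le_trans _ h)// -normrN ler_norm.
by move: h; rewrite !JN ?x0 ?y0 ?(le_trans xy)//; lra.
Qed.

Lemma J_abs f g x : 0 <= x <= pi -> Itg f -> Itg g ->
  (forall t, 0 <= t <= x -> `|f t| <= g t) -> `|J x f| <= J x g.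
Proof.
move=> /andP[x0 xpi] If Ig fg; have := J_abs2 (lexx 0) x0 xpi If Ig fg.
by rewrite !J0 !subr0.
Qed.

Lemma J_Cont f : Itg f -> Cont (fun x => J x f).
Proof.
move=> If; exact: (@parameterized_integral_continuous R 0 pi f (pi_ge0 R) If).
Qed.

(** The density f' is a function given at every point, not an almost everywhere derivative, so
    identities between densities can be checked pointwise by algebra. *)
Definition abs_cont f f' := Itg f' /\ forall x, 0 <= x <= pi -> f x = f 0 + J x f'.

Lemma Cont_eq f g : (forall x, 0 <= x <= pi -> f x = g x) -> Cont f -> Cont g.
Proof.
move=> fg /ContP cf; apply/ContP => x xI e /(cf x xI)[d d0 H].
by exists d => // y yI xy; rewrite -!fg// H.
Qed.

Lemma AC_Cont f f' : abs_cont f f' -> Cont f.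
Proof.
move=> [If fE]; apply: (@Cont_eq (fun x => f 0 + J x f')).
  by move=> x /fE ->.
by apply: ContD; [exact: Cont_cst | exact: J_Cont].
Qed.

Lemma AC_Bm f f' : abs_cont f f' -> Bm f.
Proof. by move=> /AC_Cont /Cont_Bm. Qed.

Lemma AC_eq f f' g g' : (forall x, 0 <= x <= pi -> f x = g x) ->
  (forall x, 0 <= x <= pi -> f' x = g' x) -> abs_cont f f' -> abs_cont g g'.
Proof.
move=> fg fg' [If fE]; split; first exact: Itg_eq If.
move=> x xI; rewrite -!fg// fE//; congr (_ + _); apply: J_eq => //.
by case/andP: xI.
Qed.

Lemma AC_J f : Itg f -> abs_cont (fun x => J x f) f.
Proof. by move=> If; split => // x _; rewrite J0 add0r. Qed.

Lemma AC_cst c : abs_cont (fun=> c) (fun=> 0).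
Proof.
split; first by apply: Bm_Itg; exact: Bm_cst.
by move=> x /andP[x0 _]; rewrite J_cst// mul0r addr0.
Qed.

Lemma AC_id : abs_cont (fun x => x) (fun=> 1).
Proof.
split; first by apply: Bm_Itg; exact: Bm_cst.
by move=> x /andP[x0 _]; rewrite J_cst// mul1r add0r.
Qed.

Lemma ACD f f' g g' : abs_cont f f' -> abs_cont g g' ->
  abs_cont (fun x => f x + g x) (fun x => f' x + g' x).
Proof.
move=> [If fE] [Ig gE]; split; first exact: ItgD.
by move=> x xI; rewrite fE// gE// JD//; ring.
Qed.

Lemma ACZ c f f' : abs_cont f f' -> abs_cont (fun x => c * f x) (fun x => c * f' x).
Proof.
move=> [If fE]; split; first exact: ItgZ.
by move=> x xI; rewrite fE// JZ//; ring.
Qed.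

Lemma ACB f f' g g' : abs_cont f f' -> abs_cont g g' ->
  abs_cont (fun x => f x - g x) (fun x => f' x - g' x).
Proof.
move=> Af Ag; apply: AC_eq (ACD Af (ACZ (-1) Ag)) => x _; by rewrite mulN1r.
Qed.

(** Continuous induction. Let c be the supremum of the points up to which the bound from 0 holds.
    The local estimate to the left of c gives the bound at c, and to the right of c it would carry
    the bound further if c < b. It replaces differentiation of the integral in the chain rule. *)
Lemma local_to_global (H A : R -> R) b : 0 <= b ->
  (forall x, 0 <= x <= b -> exists2 d, 0 < d & forall s t, 0 <= s -> s <= x ->
     x <= t -> t <= b -> x - d < s -> t < x + d -> `|H t - H s| <= A t - A s) ->
  `|H b - H 0| <= A b - A 0.
Proof.
move=> b0 loc.
pose S := [set x | 0 <= x <= b /\ `|H x - H 0| <= A x - A 0].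
have S0 : S 0 by split; rewrite ?lexx// !subrr normr0.
have Sub : ubound S b by move=> x [/andP[]].
have hS : has_sup S by split; [exists 0 | exists b].
pose c := sup S.
have cb : c <= b by apply: sup_le_ub => //; exists 0.
have c0 : 0 <= c by apply: ub_le_sup => //; exists b.
have cI : 0 <= c <= b by rewrite c0.
have [d d0 Hd] := loc c cI.
have Sc : S c.
  split => //.
  have [x [/andP[x0 xb] Hx] cx] := sup_adherent d0 hS.
  have xc : x <= c by apply: ub_le_sup; [exists b | split; rewrite ?x0].
  have := Hd x c x0 xc (lexx _) cb cx; rewrite ltrDl d0 => /(_ isT) h.
  have -> : H c - H 0 = (H c - H x) + (H x - H 0) by ring.
  by rewrite (le_trans (ler_normD _ _))//; lra.
have [cb'|cb'] := ltP c b; last first.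
  have -> : b = c by apply/eqP; rewrite eq_le cb cb'.
  by case: Sc.
pose t := Num.min b (c + d / 2).
have ct : c < t by rewrite lt_min cb' ltrDl divr_gt0.
have tb : t <= b by rewrite ge_min lexx.
have St : S t.
  split; first by rewrite (le_trans c0 (ltW ct)).
  have tcd : t < c + d by rewrite gt_min; apply/orP; right; lra.
  have := Hd c t c0 (lexx _) (ltW ct) tb; rewrite ltrBlDr ltrDl d0 => /(_ isT tcd) h.
  case: Sc => _ h'.
  have -> : H t - H 0 = (H t - H c) + (H c - H 0) by ring.
  by rewrite (le_trans (ler_normD _ _))//; lra.
have : t <= c by apply: ub_le_sup => //; exists b.
by rewrite leNgt ct.
Qed.

Lemma MVT_ball (g g' : R -> R) u d a b : (forall x, is_derive x 1 g (g' x)) ->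
  `|a - u| < d -> `|b - u| < d ->
  exists2 xi, g b - g a = g' xi * (b - a) & `|xi - u| < d.
Proof.
move=> dg.
have cgg : continuous g.
  move=> z; apply: differentiable_continuous.
  by apply/derivable1_diffP; case: (dg z).
wlog ab : a b / a <= b.
  move=> W au bu; have [ab|/ltW ba] := leP a b; first exact: W.
  have [xi E h] := W b a ba bu au.
  by exists xi => //; rewrite -opprB E -mulrN opprB.
rewrite !ltr_distl => /andP[a1 a2] /andP[b1 b2].
have [xi] := @MVT_segment R g g' _ _ ab (fun z _ => dg z)
  (@continuous_subspaceT _ _ _ _ cgg).
rewrite in_itv /= => /andP[h1 h2] E; exists xi => //.
by rewrite ltr_distl (lt_le_trans a1 h1) (le_lt_trans h2 b2).
Qed.

(* On a short interval around x both g(f(t)) - g(f(s)) (mean value theorem) and the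
   integral of g'(f) f' are g'(f(x)) (f(t) - f(s)) up to e * int_s^t |f'|. *)
Lemma AC_comp (g g' : R -> R) f f' : (forall x, is_derive x 1 g (g' x)) ->
  continuous g' -> abs_cont f f' -> abs_cont (fun x => g (f x)) (fun x => g' (f x) * f' x).
Proof.
move=> dg cg' Af; have cf := AC_Cont Af; have [If fE] := Af.
have Ih : Itg (fun x => g' (f x) * f' x).
  by apply: ItgMr => //; apply: Cont_Bm; exact: Cont_comp.
split => // x /andP[x0 xpi].
pose H x := g (f x) - J x (fun x => g' (f x) * f' x).
suff : `|H x - H 0| <= 0.
  by rewrite normr_le0 subr_eq0 /H J0 subr0 subr_eq => /eqP.
have Iaf := Itg_abs If.
apply/ler_addgt0Pl => e e0; rewrite addr0.
set V := J pi (fun t => `|f' t|).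
have V0 : 0 <= V by apply: J_ge0 => // t _.
(* The accumulated error 2 e' V is then at most e; the summand 1 keeps the denominator positive when
   V = 0. *)
pose e' := e / (2 * (V + 1)).
have e'0 : 0 < e' by rewrite divr_gt0// mulr_gt0// ltr_wpDl.
have main : `|H x - H 0| <= 2 * e' * J x (fun t => `|f' t|) - 2 * e' * J 0 (fun t => `|f' t|).
  apply: (@local_to_global H (fun x => 2 * e' * J x (fun t => `|f' t|))) => //.
  move=> u /andP[u0 ux].
  have uI : 0 <= u <= pi by rewrite u0 (le_trans ux).
  have /cvgrPdist_lt /(_ e' e'0) [d1 /= d10 Hd1] := cg' (f u).
  have [d d0 Hd] := (ContP f).1 cf u uI d1 d10.
  exists d => // s t s0 su ut tx uds tud.
  have st := le_trans su ut.
  have tpi := le_trans tx xpi.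
  have near r : s <= r <= t -> `|f r - f u| < d1.
    move=> /andP[sr rt]; apply: Hd.
      by rewrite (le_trans s0 sr) (le_trans rt).
    by rewrite ltr_distl; apply/andP; split; lra.
  have gnear z : `|z - f u| < d1 -> `|g' z - g' (f u)| < e'.
    by move=> h; rewrite distrC; apply: Hd1 => /=; rewrite distrC.
  have [xi xiE xin] := MVT_ball (g' := g') dg
    (near s ltac:(by rewrite lexx)) (near t ltac:(by rewrite lexx st)).
  have sI : 0 <= s <= pi by rewrite s0 (le_trans st).
  have tI : 0 <= t <= pi by rewrite (le_trans s0).
  have fts : f t - f s = J t f' - J s f' by rewrite (fE t)// (fE s)//; ring.
  have -> : H t - H s = (J t (fun r => g' xi * f' r - g' (f r) * f' r) -
      J s (fun r => g' xi * f' r - g' (f r) * f' r)).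
    by rewrite /H !JB ?JZ//; [|exact: ItgZ..]; move: xiE; rewrite fts; lra.
  rewrite -!JZ//; apply: J_abs2 => //.
  - by apply: ItgB => //; exact: ItgZ.
  - exact: ItgZ.
  move=> r rst; rewrite -mulrBl normrM ler_wpM2r//.
  have -> : g' xi - g' (f r) = (g' xi - g' (f u)) - (g' (f r) - g' (f u)) by ring.
  rewrite (le_trans (ler_normB _ _))// mulr_natl mulr2n lerD// ltW//; apply: gnear => //.
  exact: near.
apply: (le_trans main); rewrite J0 mulr0 subr0.
have JV : J x (fun t => `|f' t|) <= V by apply: J_homo.
apply: (@le_trans _ _ (2 * e' * V)); first by rewrite ler_wpM2l// mulr_ge0// ltW.
rewrite /e' (_ : _ * V = e * (V / (V + 1))); last by field; lra.
by rewrite ger_pMr// ler_pdivrMr ?mul1r; lra.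
Qed.

Lemma AC_sqr f f' : abs_cont f f' -> abs_cont (fun x => f x ^+ 2) (fun x => 2 * f x * f' x).
Proof.
move=> Af; apply: (@AC_comp (fun x => x ^+ 2) (fun x => 2 * x)) => //.
  move=> x; apply: is_derive_eq; rewrite /GRing.scale /=; ring.
by move=> x; apply: cvgM; [exact: cvg_cst | exact: cvg_id].
Qed.

(** Polarization, 4 f g = (f + g)^2 - (f - g)^2, reduces the product rule to the chain rule for the
    square. *)
Lemma ACM f f' g g' : abs_cont f f' -> abs_cont g g' ->
  abs_cont (fun x => f x * g x) (fun x => f' x * g x + f x * g' x).
Proof.
move=> Af Ag.
have := ACZ (4^-1) (ACB (AC_sqr (ACD Af Ag)) (AC_sqr (ACB Af Ag))).
by apply: AC_eq => x _; field.
Qed.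

End AbsolutelyContinuous.
#[global] Hint Resolve in0pi_0 in0pi_pi : core.

(** * Linear scalar equations, Gronwall's inequality and existence of solutions *)

Section LinearAndPicard.
Variable R : realType.
Implicit Types (f g : R -> R) (x y : R).
Notation J := (@Defs.Rint0 R).

Lemma AC_expR f f' : abs_cont f f' -> abs_cont (fun x => expR (f x)) (fun x => expR (f x) * f' x).
Proof.
move=> Af; apply: (@AC_comp _ expR expR) => //; exact: continuous_expR.
Qed.

Lemma AC_sin f f' : abs_cont f f' -> abs_cont (fun x => sin (f x)) (fun x => cos (f x) * f' x).
Proof.
move=> Af; apply: (@AC_comp _ sin cos) => //; exact: continuous_cos.
Qed.

Lemma AC_cos f f' : abs_cont f f' -> abs_cont (fun x => cos (f x)) (fun x => - sin (f x) * f' x).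
Proof.
move=> Af; apply: (@AC_comp _ cos (fun x => - sin x)) => //.
by move=> x; apply: cvgN; exact: continuous_sin.
Qed.

Lemma ACN f f' : abs_cont f f' -> abs_cont (fun x => - f x) (fun x => - f' x).
Proof.
by move=> Af; apply: AC_eq (ACZ (-1) Af) => x _; rewrite mulN1r.
Qed.

(** Variation of constants: the factor exp(- int c) leaves only the term with g. Gronwall's
    inequality, the comparison of angles and uniqueness for the linear system are all read off from
    this formula by looking at the sign or size of g. *)
Lemma linear_ode D D' c g : abs_cont D D' -> Itg c -> Itg g ->
  (forall t, 0 <= t <= pi -> D' t = c t * D t + g t) ->
  forall x, 0 <= x <= pi ->
    D x = expR (J x c) * (D 0 + J x (fun t => expR (- J t c) * g t)).
Proof.
move=> AD Ic Ig D'E x xI.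
have AE := AC_expR (ACN (AC_J Ic)).
have Ih : Itg (fun t => expR (- J t c) * g t) by apply: ItgMr Ig; exact: AC_Bm AE.
have [_ /(_ x xI)] : abs_cont (fun t => expR (- J t c) * D t) (fun t => expR (- J t c) * g t).
  by apply: AC_eq (ACM AE AD) => // t tI; rewrite D'E//; ring.
rewrite J0 oppr0 expR0 mul1r => <-.
by rewrite mulrA -expRD subrr expR0 mul1r.
Qed.

Lemma J_gt0 f x0 : Cont f -> (forall t, 0 <= t <= pi -> 0 <= f t) ->
  0 <= x0 <= pi -> 0 < f x0 -> 0 < J pi f.
Proof.
move=> cf f0 x0I fx0.
have If := Bm_Itg (Cont_Bm cf).
have fx2 : 0 < f x0 / 2 by rewrite divr_gt0.
have [d d0 Hd] := (ContP f).1 cf x0 x0I (f x0 / 2) fx2.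
have pi0 := pi_gt0 R.
move/andP : (x0I) => [x00 x0pi].
pose s := Num.max 0 (x0 - d / 2); pose t := Num.min pi (x0 + d / 2).
have s0 : 0 <= s by rewrite le_max lexx.
have tpi : t <= pi by rewrite ge_min lexx.
have d20 : 0 < d / 2 by rewrite divr_gt0.
have sx : s <= x0 by rewrite ge_max x00 gerBl ltW.
have xt : x0 <= t by rewrite le_min x0pi lerDl ltW.
have st : s < t.
  rewrite /s /t gt_max !lt_min pi0 /=; apply/andP; split; last by apply/andP; split; lra.
  lra.
have tI : 0 <= t <= pi by rewrite (le_trans s0 (ltW st)).
have sI : 0 <= s <= pi by rewrite s0 (le_trans (ltW st)).
have h1 : J t (fun=> f x0 / 2) - J s (fun=> f x0 / 2) <= J t f - J s f.
  apply: J_mono2 => //; [exact: ltW | by apply: Bm_Itg; exact: Bm_cst|].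
  move=> r /andP[sr rt].
  have rI : 0 <= r <= pi by rewrite (le_trans s0 sr) (le_trans rt).
  have : `|r - x0| < d.
    have : x0 - d / 2 <= s by rewrite le_max lexx orbT.
    have : t <= x0 + d / 2 by rewrite ge_min lexx orbT.
    by move=> *; rewrite ltr_distl; apply/andP; split; lra.
  by move=> /(Hd r rI); rewrite ltr_distl => /andP[+ _]; lra.
have h2 : J t f <= J pi f.
  by apply: J_homo; rewrite ?(andP tI).1.
have h3 : 0 <= J s f.
  apply: J_ge0 => // r /andP[r0 rs]; apply: f0.
  by rewrite r0 (le_trans rs)// (andP sI).2.
move: h1; rewrite !J_cst ?(andP tI).1//.
have : 0 < f x0 / 2 * t - f x0 / 2 * s by rewrite -mulrBr mulr_gt0 ?divr_gt0 ?subr_gt0.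
lra.
Qed.

Lemma J_eq0 f : Cont f -> (forall t, 0 <= t <= pi -> 0 <= f t) -> J pi f = 0 ->
  forall x, 0 <= x <= pi -> f x = 0.
Proof.
move=> cf f0 J0 x xI; apply/eqP; rewrite eq_le f0// andbT leNgt.
by apply/negP => /(J_gt0 cf f0 xI); rewrite J0 ltxx.
Qed.

(** With U the integral of k u one has U' = k U + k (u - U) and u - U <= f. The bound is stated for
    f that need not be monotone, because the forcing term of the angle equation is not. *)
Lemma gronwall u f k : Bm u -> Bm f -> Itg k ->
  (forall t, 0 <= t <= pi -> 0 <= k t) -> (forall t, 0 <= t <= pi -> 0 <= f t) ->
  (forall x, 0 <= x <= pi -> u x <= f x + J x (fun t => k t * u t)) ->
  forall x, 0 <= x <= pi ->
    u x <= f x + expR (J pi k) * J x (fun t => k t * f t).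
Proof.
move=> Bu Bf Ik k0 f0 uf x xI.
apply: (le_trans (uf x xI)); rewrite lerD2l.
have Iku : Itg (fun t => k t * u t) by exact: ItgM.
have Ikf : Itg (fun t => k t * f t) by exact: ItgM.
have AU := AC_J Iku.
have Ig : Itg (fun t => k t * (u t - J t (fun t => k t * u t))).
  by apply: ItgM => //; apply: BmD => //; apply: BmN; exact: AC_Bm AU.
have := linear_ode AU Ik Ig (fun t _ => _) xI => -> //; last by move=> t; ring.
rewrite J0 add0r.
have K0 : 0 <= J x (fun t => k t * f t).
  move/andP: xI => [x0 xpi].
  apply: J_ge0 => //; first by rewrite x0.
  move=> t /andP[t0 tx].
  by apply: mulr_ge0; [apply: k0|apply: f0]; rewrite t0 (le_trans tx).
have AE := AC_expR (ACN (AC_J Ik)).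
have step : J x (fun t => expR (- J t k) * (k t * (u t - J t (fun t => k t * u t)))) <=
    J x (fun t => k t * f t).
  apply: J_le => //; first by apply: ItgMr Ig; exact: AC_Bm AE.
  move=> t /andP[t0 tx].
  have tI : 0 <= t <= pi by rewrite t0 (le_trans tx)// (andP xI).2.
  apply: (@le_trans _ _ (expR (- J t k) * (k t * f t))).
    rewrite ler_wpM2l ?expR_ge0// ler_wpM2l ?k0// lerBlDr; exact: uf.
  rewrite ler_piMl ?mulr_ge0 ?k0 ?f0// -expR0 ler_expR oppr_le0.
  by apply: J_ge0 => // r /andP[r0 rt]; apply: k0; rewrite r0 (le_trans rt)// (andP tI).2.
apply: (le_trans (ler_wpM2l (expR_ge0 _) step)).
move/andP: xI => [x0 xpi].
have h : J x k <= J pi k by exact: J_homo.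
by apply: (ler_wpM2r K0); rewrite ler_expR.
Qed.

(** The intervals of radius 2 K / 2^n around a n are nested; the limit is the supremum of their left
    end points. *)
Lemma geo_limit (a : nat -> R) K : (forall n, `|a n.+1 - a n| <= K / 2 ^+ n) ->
  exists l, forall n, `|a n - l| <= 2 * K / 2 ^+ n.
Proof.
move=> aK.
pose b n := a n - 2 * K / 2 ^+ n; pose c n := a n + 2 * K / 2 ^+ n.
have half n : K / 2 ^+ n.+1 = K / 2 ^+ n / 2.
  by rewrite exprSr invfM mulrA.
have bS n : b n <= b n.+1.
  have := aK n; rewrite ler_norml => /andP[+ _].
  rewrite /b -!mulrA !half; lra.
have cS n : c n.+1 <= c n.
  have := aK n; rewrite ler_norml => /andP[_].
  rewrite /c -!mulrA !half; lra.
have bm m n : (m <= n)%N -> b m <= b n by move: m n; apply/nondecreasing_seqP.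
have cm m n : (m <= n)%N -> c n <= c m by move: m n; apply/nonincreasing_seqP.
have K0 n : 0 <= 2 * K / 2 ^+ n.
  have := le_trans (normr_ge0 _) (aK n); rewrite -mulrA; lra.
have bc m n : b m <= c n.
  have := bm _ _ (leq_maxl m n); have := cm _ _ (leq_maxr m n).
  have := K0 (maxn m n); rewrite /b /c; lra.
pose S := [set x | exists n, x = b n].
have hS : has_sup S.
  by split; [exists (b 0), 0 | exists (c 0) => x [n ->]].
exists (sup S) => n.
have h1 : b n <= sup S by apply: ub_le_sup; [case: hS | exists n].
have h2 : sup S <= c n by apply: ge_sup; [exists (b 0), 0 | move=> x [m ->]].
by move: h1 h2; rewrite /b /c => *; rewrite ler_distl; apply/andP; split; lra.
Qed.

Lemma exp2_arch (B e : R) : 0 < e -> exists n, B / 2 ^+ n < e.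
Proof.
move=> e0; have B0 : 0 <= `|B| / e by rewrite divr_ge0// ltW.
exists (Num.trunc (`|B| / e)).+1.
rewrite ltr_pdivrMr ?exprn_gt0// (le_lt_trans (ler_norm _))//.
rewrite -ltr_pdivrMl// mulrC.
apply: (lt_trans (truncnS_gt _)).
rewrite -natrX ltr_nat; exact: ltn_expl.
Qed.

(** Picard iteration measured with the weight w = exp(2 int L). In this weight the iteration
    contracts by 1/2 on all of [0, pi] at once, so no gluing of short intervals is needed although L
    is only integrable. *)
Lemma picard (F : R -> R -> R) (L : R -> R) th0 :
  (forall th, Cont th -> Itg (fun t => F t (th t))) ->
  Itg L -> (forall t, 0 <= t <= pi -> 0 <= L t) ->
  (forall t a b, 0 <= t <= pi -> `|F t a - F t b| <= L t * `|a - b|) ->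
  exists th, th 0 = th0 /\ abs_cont th (fun t => F t (th t)).
Proof.
move=> IF IL L0 FL.
pose T (th : R -> R) x := th0 + J x (fun t => F t (th t)).
have CT th : Cont th -> Cont (T th).
  by move=> cth; apply: ContD; [exact: Cont_cst | apply: J_Cont; exact: IF].
pose th n := iter n T (fun=> th0).
have Cth n : Cont (th n) by elim: n => [|n IH]; [exact: Cont_cst | exact: CT].
pose w x := expR (2 * J x L).
have AL := AC_J IL.
have Aw : abs_cont w (fun t => w t * (2 * L t)) by apply: AC_expR; exact: ACZ.
have Bw := AC_Bm Aw.
have w1 x : 0 <= x <= pi -> 1 <= w x.
  move=> /andP[x0 xpi]; rewrite -expR0 ler_expR mulr_ge0//.
  apply: J_ge0; first by rewrite x0.
  by move=> t /andP[t0 tx]; apply: L0; rewrite t0 (le_trans tx).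
have [C C0 HC] : exists2 C, 0 <= C & forall x, 0 <= x <= pi -> `|th 1 x - th 0 x| <= C.
  have [_ [M HM]] := Cont_Bm (ContD (Cth 1) (ContN (Cth 0))).
  exists M; last by move=> x xI; exact: HM.
  exact: (le_trans (normr_ge0 _) (HM 0 (in0pi_0 R))).
(* Since w' = 2 L w, integrating L against K w gains the factor 1/2; this is the contraction. *)
have Jw (K : R) x : 0 <= x <= pi -> J x (fun t => L t * (K * w t)) = K / 2 * (w x - 1).
  move=> xI.
  have [Iw wE] := Aw.
  have -> : w x - 1 = J x (fun t => w t * (2 * L t)).
    by rewrite (wE x xI) /w J0 mulr0 expR0; ring.
  rewrite -JZ//; apply: J_eq; first by case/andP: xI.
  by move=> t _; field.
have step (a b : R -> R) K : Cont a -> Cont b ->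
    (forall x, 0 <= x <= pi -> `|a x - b x| <= K * w x) -> 0 <= K ->
    forall x, 0 <= x <= pi -> `|T a x - T b x| <= K / 2 * w x.
  move=> ca cb ab K0 x xI.
  have -> : T a x - T b x = J x (fun t => F t (a t) - F t (b t)).
    by rewrite /T JB//; [ring | exact: IF | exact: IF].
  apply: (@le_trans _ _ (J x (fun t => L t * (K * w t)))); last first.
    by rewrite Jw// ler_wpM2l ?divr_ge0// gerBl.
  apply: J_abs => //.
  - by apply: ItgB; exact: IF.
  - by apply: ItgM => //; apply: BmM => //; exact: Bm_cst.
  move=> t /andP[t0 tx].
  have tI : 0 <= t <= pi by rewrite t0 (le_trans tx)// (andP xI).2.
  by apply: (le_trans (FL _ _ _ tI)); rewrite ler_wpM2l ?L0// ab.
have geo n x : 0 <= x <= pi -> `|th n.+1 x - th n x| <= C / 2 ^+ n * w x.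
  elim: n x => [|n IH] x xI.
    by rewrite expr0 divr1 (le_trans (HC x xI))// ler_peMr// w1.
  have -> : C / 2 ^+ n.+1 = C / 2 ^+ n / 2 by rewrite exprSr invfM mulrA.
  by apply: (step (th n.+1) (th n)); rewrite ?divr_ge0 ?exprn_ge0.
have /boolp.choice[u uP] : forall x, exists l, 0 <= x <= pi ->
    forall n, `|th n x - l| <= 2 * (C * w x) / 2 ^+ n.
  move=> x; have [xI|xI] := pselect (0 <= x <= pi); last by exists 0.
  have h n : `|th n.+1 x - th n x| <= C * w x / 2 ^+ n by rewrite mulrAC; exact: geo.
  by have [l Hl] := geo_limit (a := th^~ x) h; exists l.
pose B := 2 * C * w pi.
have uB x n : 0 <= x <= pi -> `|th n x - u x| <= B / 2 ^+ n.
  move=> xI; apply: (le_trans (uP x xI n)).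
  have CC : 0 <= 2 * C by rewrite mulr_ge0.
  have wx : w x <= w pi.
    rewrite ler_expR; apply: (ler_wpM2l (ler0n R 2)).
    by move/andP: xI => [x0 xpi]; exact: J_homo.
  have n2 : 0 <= (2 ^+ n)^-1 :> R by rewrite invr_ge0 exprn_ge0.
  by apply: (ler_wpM2r n2); rewrite /B mulrA; exact: ler_wpM2l.
have B0 : 0 <= B by rewrite !mulr_ge0// expR_ge0.
have cu : Cont u.
  apply/ContP => x xI e e0.
  have e30 : 0 < e / 3 by rewrite divr_gt0.
  have [n Hn] := exp2_arch B e30.
  have [d d0 Hd] := (ContP _).1 (Cth n) x xI (e / 3) e30.
  exists d => // y yI xy.
  have := Hd y yI xy; have := uB x n xI; have := uB y n yI.
  by rewrite !ler_distl !ltr_distl => /andP[? ?] /andP[? ?] /andP[? ?]; apply/andP; split; lra.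
have uE x : 0 <= x <= pi -> u x = th0 + J x (fun t => F t (u t)).
  move=> xI; apply/eqP; rewrite -subr_eq0 -normr_le0.
  apply/ler_addgt0Pl => e e0; rewrite addr0.
  have [n Hn] := exp2_arch (B + B * J pi L) e0.
  have h1 : `|J x (fun t => F t (th n t) - F t (u t))| <= J x (fun t => B / 2 ^+ n * L t).
    apply: J_abs => //; [by apply: ItgB; exact: IF | exact: ItgZ |].
    move=> t /andP[t0 tx].
    have tI : 0 <= t <= pi by rewrite t0 (le_trans tx)// (andP xI).2.
    apply: (le_trans (FL _ _ _ tI)).
    by rewrite mulrC ler_wpM2r ?L0// uB.
  have h2 := uB x n.+1 xI.
  have h3 : B / 2 ^+ n.+1 <= B / 2 ^+ n.
    by rewrite ler_wpM2l// lef_pV2 ?posrE ?exprn_gt0// ler_weXn2l// ler1n.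
  have h4 : J x L <= J pi L by move/andP: xI => [x0 xpi]; exact: J_homo.
  rewrite JZ// in h1.
  have h5 : B / 2 ^+ n * J x L <= B / 2 ^+ n * J pi L.
    by rewrite ler_wpM2l// divr_ge0// exprn_ge0.
  apply: le_trans (ltW Hn).
  have -> : u x - (th0 + J x (fun t => F t (u t))) =
      - (th n.+1 x - u x) + J x (fun t => F t (th n t) - F t (u t)).
    by rewrite JB//; [rewrite /th /= -/(th n) /T; ring | exact: IF | exact: IF].
  rewrite (le_trans (ler_normD _ _))// normrN.
  by rewrite mulrDl (mulrAC B); lra.
exists u; split; first by rewrite uE// J0 addr0.
split; first exact: IF.
by move=> x xI; rewrite uE// (uE 0)// J0 addr0.
Qed.

End LinearAndPicard.

(** * The angle on one edge *)

Section PrueferAngle.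
Variable R : realType.
Implicit Types (f g : R -> R) (a b l x y : R).
Notation J := (@Defs.Rint0 R).

Lemma L2_Itg_sqr (s : R -> R) : L2_0pi s -> Itg (fun t => s t ^+ 2).
Proof.
move=> [ms s2]; apply/integrableP; split.
  by apply/measurable_EFinP; exact: measurable_funX.
by under eq_integral do rewrite /= ger0_norm ?sqr_ge0//.
Qed.

Lemma L2_Itg (s : R -> R) : L2_0pi s -> Itg s.
Proof.
move=> s2; apply: (@Itg_le _ s (fun t => 1 + s t ^+ 2)); first by case: s2.
  by apply: ItgD; [apply: Bm_Itg; exact: Bm_cst | exact: L2_Itg_sqr].
move=> x _; rewrite -real_normK ?num_real//; nra.
Qed.

(** Gives the difference quotient of the angle equation a closed form that stays continuous where
    the two angles coincide. *)
Definition sinc x : R := if x == 0 then 1 else sin x / x.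

Lemma sincE x : sin x = sinc x * x.
Proof.
rewrite /sinc; case: eqVneq => [->|x0]; first by rewrite sin0 mulr0.
by rewrite divfK.
Qed.

Lemma sin_mvt d x : `|x| < d -> exists2 xi, sin x = cos xi * x & `|xi| < d.
Proof.
move=> xd; have d0 : 0 < d by exact: le_lt_trans xd.
have x0d : `|x - 0| < d by rewrite subr0.
have o0d : `|(0 : R) - 0| < d by rewrite subr0 normr0.
have [xi] := @MVT_ball R sin cos 0 d 0 x (fun z => is_derive_sin z) o0d x0d.
by rewrite sin0 !subr0 => -> h; exists xi.
Qed.

Lemma sinc_max x : `|sinc x| <= 1.
Proof.
rewrite /sinc; case: eqVneq => [_|x0]; first by rewrite normr1.
have xx1 : `|x| < `|x| + 1 by rewrite ltrDl.
have [xi -> _] := sin_mvt xx1.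
by rewrite mulfK// cos_max.
Qed.

Lemma sin_le_norm x : `|sin x| <= `|x|.
Proof. by rewrite sincE normrM ler_piMl// sinc_max. Qed.

Lemma continuous_sinc : continuous sinc.
Proof.
move=> x; have [->|x0] := eqVneq x 0.
  rewrite /continuous_at {2}/sinc eqxx; apply/cvgrPdist_lt => e e0.
  have := @continuous_cos R 0 => /cvgrPdist_lt /(_ e e0) [d /= d0 H].
  exists d => //= z /=; rewrite sub0r normrN => zd.
  rewrite /sinc; case: eqVneq => [_|z0]; first by rewrite subrr normr0.
  have [xi -> xid] := sin_mvt zd.
  by rewrite mulfK// -(@cos0 R); apply: H; rewrite /= sub0r normrN.
have : (fun z => sin z / z) @ x --> sin x / x.
  by apply: cvgM; [exact: continuous_sin | apply: cvgV => //; exact: cvg_id].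
rewrite /continuous_at /sinc (negbTE x0).
apply: cvg_trans; apply: near_eq_cvg.
have : \forall z \near x, z != 0.
  exists `|x|; first by rewrite /= normr_gt0.
  move=> z /=; apply: contraTneq => ->; by rewrite subr0 ltxx.
by apply: filterS => z /negbTE ->.
Qed.

Variable s : R -> R.
Hypothesis sL2 : L2_0pi s.

Let Is : Itg s. Proof. exact: L2_Itg. Qed.
Let Is2 : Itg (fun t => s t ^+ 2). Proof. exact: L2_Itg_sqr. Qed.

(* Right-hand side of theta' = (cos theta + s sin theta)^2 + l sin^2 theta. *)
Definition pF l t a := cos a ^+ 2 + s t * (2 * (sin a * cos a)) + (s t ^+ 2 + l) * sin a ^+ 2.
(* A Lipschitz constant of pF l t. *)
Definition pL l t := s t ^+ 2 + `|l| + 1 + 2 * `|s t|.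

Lemma Itg_cst x : Itg (fun=> x).
Proof. by apply: Bm_Itg; exact: Bm_cst. Qed.

Lemma Cont_sin f : Cont f -> Cont (fun t => sin (f t)).
Proof. by move=> cf; apply: Cont_comp => //; exact: continuous_sin. Qed.

Lemma Cont_cos f : Cont f -> Cont (fun t => cos (f t)).
Proof. by move=> cf; apply: Cont_comp => //; exact: continuous_cos. Qed.

Lemma pL_Itg l : Itg (pL l).
Proof.
apply: ItgD; last by apply: ItgZ; exact: Itg_abs.
by apply: ItgD; [apply: ItgD => //|]; exact: Itg_cst.
Qed.

Lemma pL_ge0 l t : 0 <= pL l t.
Proof. by rewrite /pL !addr_ge0 ?sqr_ge0// mulr_ge0. Qed.

Lemma pF_Itg l th : Cont th -> Itg (fun t => pF l t (th t)).
Proof.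
move=> cth.
have Bs := Cont_Bm (Cont_sin cth); have Bc := Cont_Bm (Cont_cos cth).
apply: ItgD; first apply: ItgD.
- by apply: Bm_Itg; exact: BmX.
- by apply: ItgM => //; apply: BmM; [exact: Bm_cst | exact: BmM].
- by apply: ItgM; [apply: ItgD => //; exact: Itg_cst | exact: BmX].
Qed.

(** The difference quotient of [pF l t]. As pF = 1 + (s^2 + l - 1) sin^2 + 2 s sin cos, it comes
    from sin^2 a - sin^2 b = sin(a - b) sin(a + b) and sin a cos a - sin b cos b = sin(a - b) cos(a
    + b). *)
Definition pc l t a b := sinc (a - b) *
  ((s t ^+ 2 + l - 1) * sin (a + b) + s t * (2 * cos (a + b))).

Lemma pF_diff l t a b : pF l t a - pF l t b = pc l t a b * (a - b).
Proof.
rewrite /pc mulrAC -sincE sinB sinD cosD /pF !cos2sin2.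
have ha := cos2Dsin2 a; have hb := cos2Dsin2 b.
have -> : (sin a * cos b - cos a * sin b) * ((s t ^+ 2 + l - 1) * (sin a * cos b + cos a * sin b) +
   s t * (2 * (cos a * cos b - sin a * sin b))) =
   (s t ^+ 2 + l - 1) * (sin a ^+ 2 * cos b ^+ 2 - cos a ^+ 2 * sin b ^+ 2)
   + s t * 2 * (sin a * cos a * (cos b ^+ 2 + sin b ^+ 2) - sin b * cos b * (cos a ^+ 2 + sin a ^+ 2)).
  by ring.
by rewrite ha hb !cos2sin2; ring.
Qed.

Lemma pc_max l t a b : `|pc l t a b| <= pL l t.
Proof.
rewrite /pc normrM; apply: (@le_trans _ _ (1 * `|(s t ^+ 2 + l - 1) * sin (a + b) + s t * (2 * cos (a + b))|)).
  by rewrite ler_wpM2r// sinc_max.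
rewrite mul1r (le_trans (ler_normD _ _))// /pL lerD//.
  rewrite normrM (le_trans (ler_wpM2l _ (sin_max _)))// mulr1.
  rewrite (le_trans (ler_normB _ _))// normr1 lerD2r (le_trans (ler_normD _ _))//.
  by rewrite ger0_norm ?sqr_ge0.
rewrite !normrM mulrC (ger0_norm (ler0n R 2)) -mulrA ler_wpM2l//.
by rewrite ler_piMl// cos_max.
Qed.

Lemma pc_Itg l f g : Cont f -> Cont g -> Itg (fun t => pc l t (f t) (g t)).
Proof.
move=> cf cg.
have cB : Cont (fun t => f t - g t) by apply: ContD => //; exact: ContN.
have cD : Cont (fun t => f t + g t) by exact: ContD.
apply: ItgMr; first by apply: Cont_Bm; apply: Cont_comp cB _; exact: continuous_sinc.
apply: ItgD; apply: ItgM => //.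
- by apply: ItgB; [apply: ItgD => //|]; exact: Itg_cst.
- by apply: Cont_Bm; exact: Cont_sin.
- by apply: BmM; [exact: Bm_cst | apply: Cont_Bm; exact: Cont_cos].
Qed.

Definition pruefer l (th : R -> R) := abs_cont th (fun t => pF l t (th t)).

Lemma pruefer_exists th0 : exists th : R -> R -> R,
  forall l, th l 0 = th0 /\ pruefer l (th l).
Proof.
suff /boolp.choice[th H] : forall l, exists th, th 0 = th0 /\ pruefer l th by exists th.
move=> l; apply: (@picard R (pF l) (pL l)).
- exact: pF_Itg.
- exact: pL_Itg.
- by move=> *; exact: pL_ge0.
- by move=> t a b _; rewrite pF_diff normrM ler_wpM2r// pc_max.
Qed.

(** The difference f - th solves a linear equation whose coefficient is the difference quotient and
    whose inhomogeneity is the defect f' - pF l t f. The sign of the defect thus orders f and th,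
    and the bound on c makes the comparison quantitative. *)
Lemma pruefer_compare l th f f' : pruefer l th -> abs_cont f f' ->
  exists2 c, Itg c /\ (forall t, `|c t| <= pL l t) &
  forall x, 0 <= x <= pi -> f x - th x =
    expR (J x c) * (f 0 - th 0 + J x (fun t => expR (- J t c) * (f' t - pF l t (f t)))).
Proof.
move=> Ath Af.
have cth := AC_Cont Ath; have cf := AC_Cont Af.
have Ic := pc_Itg l cf cth.
exists (fun t => pc l t (f t) (th t)); first by split => // t; exact: pc_max.
move=> x xI; apply: (@linear_ode R _ _ _ _ (ACB Af Ath) Ic) => //.
  by apply: ItgB; [case: Af | exact: pF_Itg].
by move=> t _; rewrite -pF_diff; ring.
Qed.

Lemma Cont_expRN c : Itg c -> Cont (fun t => expR (- J t c)).
Proof.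
move=> Ic; apply: Cont_comp (@continuous_expR R); apply: ContN; exact: J_Cont.
Qed.

Lemma pruefer_ge l th f f' : pruefer l th -> abs_cont f f' -> th 0 <= f 0 ->
  (forall t, 0 <= t <= pi -> pF l t (f t) <= f' t) -> th pi <= f pi.
Proof.
move=> Ath Af h0 hF; have [c [Ic _] H] := pruefer_compare Ath Af.
rewrite -subr_ge0 H// mulr_ge0 ?expR_ge0// addr_ge0 ?subr_ge0//.
apply: J_ge0 => // t tI; rewrite mulr_ge0 ?expR_ge0// subr_ge0; exact: hF.
Qed.

(** Comparison with the zero function, a strict subsolution since [pF l t 0] = 1. *)
Lemma pruefer_gt0 l th : pruefer l th -> 0 <= th 0 -> 0 < th pi.
Proof.
move=> Ath h0; have [c [Ic _] H] := pruefer_compare Ath (AC_cst (0 : R)).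
have := H pi (in0pi_pi R); rewrite sub0r => /(congr1 -%R); rewrite opprK => ->.
rewrite -mulrN mulr_gt0 ?expR_gt0// opprD sub0r opprK ltr_wpDl// -JN//; last first.
  apply: ItgMr; first by apply: Cont_Bm; exact: Cont_expRN.
  by apply: ItgB; [exact: Itg_cst | apply: pF_Itg; exact: Cont_cst].
have E t : - (expR (- J t c) * (0 - pF l t 0)) = expR (- J t c).
  by rewrite /pF cos0 sin0; ring.
rewrite (@J_eq R _ (fun t => expR (- J t c)))//.
apply: (@J_gt0 R _ 0) => //; first exact: Cont_expRN.
exact: expR_gt0.
Qed.

Lemma pF_lambda l l' t a : pF l' t a - pF l t a = (l' - l) * sin a ^+ 2.
Proof. by rewrite /pF; ring. Qed.

(** If sin th vanished identically, the equation would read th' = 1, and at x = pi / 2 the cosine of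
    th 0 would vanish together with its sine. This yields strict monotonicity in lambda and
    non-trivial solutions. *)
Lemma pruefer_not_const l th : pruefer l th ->
  exists2 x, 0 <= x <= pi & sin (th x) != 0.
Proof.
move=> Ath; apply/not_exists2P => H.
have S0 x : 0 <= x <= pi -> sin (th x) = 0.
  by move=> xI; have [//|/negP] := H x; rewrite negbK => /eqP.
have E x : 0 <= x <= pi -> th x = th 0 + x.
  move=> xI; have [_ ->//] := Ath; congr (_ + _).
  move/andP: (xI) => [x0 xpi].
  rewrite (@J_eq R _ (fun=> 1))//; first by rewrite J_cst ?mul1r.
  by move=> t tI; rewrite /pF S0// cos2sin2 S0//; ring.
have pi2 : 0 <= pi / 2 :> R by rewrite divr_ge0// pi_ge0.
have pi2I : 0 <= (pi / 2 : R) <= pi by have := pi_ge0 R; lra.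
have := S0 _ pi2I; rewrite E// sinDpihalf => c0.
have := cos2Dsin2 (th 0); rewrite c0 S0// expr0n addr0 => /eqP.
by rewrite eq_sym oner_eq0.
Qed.

(** The defect of th' in the equation for l is (l' - l) sin^2 th', which is nonnegative and not
    identically zero. *)
Lemma pruefer_incr l l' th th' : pruefer l th -> pruefer l' th' -> th 0 = th' 0 ->
  l < l' -> th pi < th' pi.
Proof.
move=> Ath Ath' h0 ll'; have [c [Ic _] H] := pruefer_compare Ath Ath'.
have cth' := AC_Cont Ath'.
rewrite -subr_gt0 H// h0 subrr add0r mulr_gt0 ?expR_gt0//.
rewrite (@J_eq R _ (fun t => expR (- J t c) * ((l' - l) * sin (th' t) ^+ 2)))//; last first.
  by move=> t _; rewrite pF_lambda.
have [x xI sx] := pruefer_not_const Ath'.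
apply: (@J_gt0 R _ x) => //.
- apply: ContM; first exact: Cont_expRN.
  by apply: ContM; [exact: Cont_cst | apply: ContM; exact: Cont_sin].
- by move=> t _; rewrite mulr_ge0 ?expR_ge0// mulr_ge0 ?sqr_ge0// subr_ge0 ltW.
- by rewrite mulr_gt0 ?expR_gt0// mulr_gt0 ?subr_gt0// lt_def sqr_ge0 expf_neq0.
Qed.

(** th' is inserted into the equation for l, so the coefficient is bounded by [pL l], which does not
    involve l'; hence C serves all l'. One factor E comes from each of the two exponentials and pi
    from the length of the interval. *)
Lemma pruefer_lipschitz l : exists C, forall th l' th', pruefer l th -> pruefer l' th' ->
  th 0 = th' 0 -> `|th' pi - th pi| <= C * `|l' - l|.
Proof.
pose E := expR (J pi (pL l)).
exists (E * (E * pi)) => th l' th' Ath Ath' h0.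
have [c [Ic cL] H] := pruefer_compare Ath Ath'.
have cth' := AC_Cont Ath'.
rewrite H// h0 subrr add0r normrM.
have bnd x : 0 <= x <= pi -> `|J x c| <= J pi (pL l).
  move=> xI; apply: (@le_trans _ _ (J x (pL l))).
    by apply: J_abs => //; exact: pL_Itg.
  move/andP: xI => [x0 xpi]; apply: J_homo => //; first exact: pL_Itg.
  by move=> *; exact: pL_ge0.
rewrite (ger0_norm (expR_ge0 _)) -mulrA ler_pM ?expR_ge0//.
  by rewrite ler_expR (le_trans (ler_norm _))// bnd.
rewrite mulrAC -(@J_cst R _ pi (pi_ge0 R)); apply: J_abs => //.
- apply: ItgMr; first by apply: Cont_Bm; exact: Cont_expRN.
  by apply: ItgB; apply: pF_Itg.
- exact: Itg_cst.
move=> t tI; rewrite pF_lambda normrM (ger0_norm (expR_ge0 _)) ler_pM ?expR_ge0//.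
  by rewrite ler_expR (le_trans (ler_norm _))// normrN bnd.
rewrite normrM ler_piMr// normrX exprn_ile1//; exact: sin_max.
Qed.

(* theta = pi/2 - atan X with X' = c - 2 s^2 is a supersolution: cot theta = X and
   (X + s)^2 <= 2 X^2 + 2 s^2. *)
Lemma pruefer_low : exists l, forall th, pruefer l th -> th 0 <= pi / 2 -> th pi <= pi / 4.
Proof.
pose B := 2 * J pi (fun t => s t ^+ 2).
have B0 : 0 <= B by rewrite mulr_ge0//; apply: J_ge0 => // t _; exact: sqr_ge0.
(* Chosen so that [X pi] = 1, which makes the supersolution end at pi / 4. *)
pose c := (B + 1) / pi.
have c0 : 0 <= c by rewrite divr_ge0 ?pi_ge0// addr_ge0.
have cpi : c * pi = B + 1 by rewrite /c divfK// gt_eqF// pi_gt0.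
pose X x := c * x - 2 * J x (fun t => s t ^+ 2).
have AX : abs_cont X (fun t => c * 1 - 2 * s t ^+ 2).
  by apply: ACB; [exact: ACZ (AC_id R) | apply: ACZ; exact: AC_J].
have AXs : abs_cont (fun x => pi / 2 - atan (X x))
    (fun t => 0 - (1 + X t ^+ 2)^-1 * (c * 1 - 2 * s t ^+ 2)).
  apply: ACB; first exact: AC_cst.
  apply: (@AC_comp R atan (fun x => (1 + x ^+ 2)^-1)) AX => //.
  exact: continuous_oneDsqrV.
(* B + 1 bounds |X| on [0, pi], so 2 (B + 1)^2 absorbs the term 2 X^2. *)
exists (- (c + 2 * (B + 1) ^+ 2)) => th Ath h0.
have -> : pi / 4 = pi / 2 - atan (X pi).
  rewrite /X cpi -/B (_ : B + 1 - B = 1); last by ring.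
  by rewrite atan1; field.
apply: pruefer_ge Ath AXs _ _ => /=.
  by rewrite /X J0 !mulr0 subr0 atan0 subr0.
move=> t tI.
have XB : X t ^+ 2 <= (B + 1) ^+ 2.
  have J1 : J t (fun t => s t ^+ 2) <= J pi (fun t => s t ^+ 2).
    by move/andP: tI => [t0 tpi]; apply: J_homo => // *; exact: sqr_ge0.
  have J2 : 0 <= J t (fun t => s t ^+ 2) by apply: J_ge0 => // *; exact: sqr_ge0.
  have h1 : c * t <= B + 1 by rewrite -cpi ler_wpM2l//; case/andP: tI.
  have h2 : 0 <= c * t by rewrite mulr_ge0//; case/andP: tI.
  rewrite -[leLHS]real_normK ?num_real// lerXn2r ?nnegrE ?addr_ge0//.
  by rewrite ler_norml /X; apply/andP; split; move: J1 J2 h1 h2; rewrite /B; lra.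
set Y := X t in XB *.
have Y1 : 0 < 1 + Y ^+ 2 by rewrite ltr_pwDl// sqr_ge0.
pose q := Num.sqrt (1 + Y ^+ 2).
have q2 : q ^+ 2 = 1 + Y ^+ 2 by rewrite sqr_sqrtr// ltW.
have q0 : q != 0 by rewrite gt_eqF// sqrtr_gt0.
have sE : sin (pi / 2 - atan Y) = q^-1 by rewrite -opprB sinN sinBpihalf opprK cos_atan.
have cE : cos (pi / 2 - atan Y) = Y / q.
  rewrite -cosN opprB cosBpihalf.
  have ca0 : cos (atan Y) != 0 by rewrite cos_atan invr_neq0.
  by rewrite -[LHS](divfK ca0) -/(tan _) atanK cos_atan.
rewrite /pF sE cE.
have -> : (Y / q) ^+ 2 + s t * (2 * (q^-1 * (Y / q))) +
    (s t ^+ 2 + - (c + 2 * (B + 1) ^+ 2)) * q^-1 ^+ 2 =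
    (q ^+ 2)^-1 * ((Y + s t) ^+ 2 - (c + 2 * (B + 1) ^+ 2)) by field.
rewrite q2 sub0r -mulrN ler_pM2l ?invr_gt0//.
have := sqr_ge0 (Y - s t); nra.
Qed.

End PrueferAngle.

(** * Solutions of the system on one edge and their polar representation *)

Section EdgeSolutions.
Variable R : realType.
Implicit Types (f g u v w r y z : R -> R) (a b l x c : R).
Notation J := (@Defs.Rint0 R).
Variable s : R -> R.
Hypothesis sL2 : L2_0pi s.

Let Is : Itg s. Proof. exact: L2_Itg. Qed.
Let Is2 : Itg (fun t => s t ^+ 2). Proof. exact: L2_Itg_sqr. Qed.

Definition rhs_y u w t := s t * u t + w t.
Definition rhs_z u w h t := - s t * w t - s t ^+ 2 * u t - h t.

Lemma edge_solP a b u v w r : edge_sol s a b u v w r <->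
  [/\ abs_cont u (rhs_y u w), abs_cont v (rhs_y v r),
      abs_cont w (rhs_z u w (fun t => a * u t - b * v t)) &
      abs_cont r (rhs_z v r (fun t => a * v t + b * u t))].
Proof.
split=> [[/Cont_Bm Bu [/Cont_Bm Bv [/Cont_Bm Bw [/Cont_Bm Br E]]]]|[Au Av Aw Ar]].
  have BZ c f : Bm f -> Bm (fun t => c * f t) by move=> Bf; apply: BmM => //; exact: Bm_cst.
  have Iz f g h : Bm f -> Bm g -> Bm h -> Itg (rhs_z f g h).
    move=> Bf Bg Bh; apply: ItgB; last exact: Bm_Itg.
    by apply: ItgB; apply: ItgM => //; exact: ItgN.
  have Iy f g : Bm f -> Bm g -> Itg (rhs_y f g).
    by move=> Bf Bg; apply: ItgD; [exact: ItgM | exact: Bm_Itg].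
  split; split; try (by move=> x /E[]).
  - exact: Iy.
  - exact: Iy.
  - by apply: Iz => //; apply: BmD; [|apply: BmN]; exact: BZ.
  - by apply: Iz => //; apply: BmD; exact: BZ.
do 4 (split; first by apply: AC_Cont; eassumption).
by move=> x xI; split; [case: Au | case: Av | case: Aw | case: Ar] => _; apply.
Qed.

(* The imaginary part of the Lagrange bracket of y and its conjugate. *)
Lemma edge_bracket a b u v w r : edge_sol s a b u v w r ->
  v pi * w pi - u pi * r pi = v 0 * w 0 - u 0 * r 0 +
    b * J pi (fun t => u t ^+ 2 + v t ^+ 2).
Proof.
move=> /edge_solP[Au Av Aw Ar].
have [_ ->//] := ACB (ACM Av Aw) (ACM Au Ar); congr (_ + _).
have Bu := AC_Bm Au; have Bv := AC_Bm Av.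
rewrite -JZ//; first by apply: J_eq => // t _; rewrite /rhs_y /rhs_z; ring.
by apply: Bm_Itg; apply: BmD; exact: BmX.
Qed.

Definition lin_sol l u w := abs_cont u (rhs_y u w) /\ abs_cont w (rhs_z u w (fun t => l * u t)).

Lemma edge_sol_real l u v w r :
  edge_sol s l 0 u v w r <-> lin_sol l u w /\ lin_sol l v r.
Proof.
split=> [/edge_solP[Au Av Aw Ar]|[[Au Aw] [Av Ar]]].
  split; split => //.
    by apply: AC_eq Aw => // x _; rewrite /rhs_z mul0r subr0.
  by apply: AC_eq Ar => // x _; rewrite /rhs_z mul0r addr0.
apply/edge_solP; split => //.
  by apply: AC_eq Aw => // x _; rewrite /rhs_z mul0r subr0.
by apply: AC_eq Ar => // x _; rewrite /rhs_z mul0r addr0.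
Qed.

Lemma lin_sol_lin l c u w y z : lin_sol l u w -> lin_sol l y z ->
  lin_sol l (fun x => u x + c * y x) (fun x => w x + c * z x).
Proof.
move=> [Au Aw] [Ay Az]; split.
  by apply: AC_eq (ACD Au (ACZ c Ay)) => // x _; rewrite /rhs_y; ring.
by apply: AC_eq (ACD Aw (ACZ c Az)) => // x _; rewrite /rhs_z; ring.
Qed.

Lemma lin_solZ l c y z : lin_sol l y z ->
  lin_sol l (fun x => c * y x) (fun x => c * z x).
Proof.
move=> [Ay Az]; split.
  by apply: AC_eq (ACZ c Ay) => // x _; rewrite /rhs_y; ring.
by apply: AC_eq (ACZ c Az) => // x _; rewrite /rhs_z; ring.
Qed.

(** N = u^2 + w^2 satisfies N' <= k N with k integrable and N(0) = 0. The factor k arises from |u^2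
    - w^2| <= N and 2 |u w| <= N; its integrability uses that s is square integrable. *)
Lemma lin_sol_eq0 l u w : lin_sol l u w -> u 0 = 0 -> w 0 = 0 ->
  forall x, 0 <= x <= pi -> u x = 0 /\ w x = 0.
Proof.
move=> [Au Aw] u0 w0 x xI.
have AN := ACD (AC_sqr Au) (AC_sqr Aw).
pose N' t := 2 * u t * rhs_y u w t + 2 * w t * rhs_z u w (fun t => l * u t) t.
pose N t := u t ^+ 2 + w t ^+ 2.
have BN : Bm N by exact: AC_Bm AN.
pose k t := 2 * `|s t| + (1 + s t ^+ 2 + `|l|).
have Ik : Itg k.
  apply: ItgD; first by apply: ItgZ; exact: Itg_abs.
  by apply: ItgD; [apply: ItgD => //|]; exact: Itg_cst.
have Ikn : Itg (fun t => k t * N t) by exact: ItgM.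
have Ig : Itg (fun t => N' t - k t * N t) by apply: ItgB => //; case: AN.
have E := linear_ode AN Ik Ig (fun t _ => _) xI.
suff : N x <= 0.
  move=> N0; have : N x == 0 by rewrite eq_le N0 addr_ge0 ?sqr_ge0.
  by rewrite paddr_eq0 ?sqr_ge0// !sqrf_eq0 => /andP[/eqP -> /eqP ->].
rewrite /N E; last by move=> t; rewrite /N /N'; ring.
rewrite u0 w0 expr0n addr0 add0r mulr_ge0_le0 ?expR_ge0//.
rewrite -oppr_ge0 -JN//; last by apply: ItgMr Ig; apply: Cont_Bm; exact: Cont_expRN.
apply: J_ge0 => // t _; rewrite -mulrN mulr_ge0 ?expR_ge0// opprB subr_ge0.
rewrite /N' /k /N /rhs_y /rhs_z.
have -> : 2 * u t * (s t * u t + w t) + 2 * w t * (- s t * w t - s t ^+ 2 * u t - l * u t) =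
  2 * (s t * (u t ^+ 2 - w t ^+ 2)) + (1 - s t ^+ 2 - l) * (2 * (u t * w t)) by ring.
rewrite [leRHS]mulrDl lerD//.
  rewrite -mulrA ler_wpM2l// (le_trans (ler_norm _))// normrM ler_wpM2l//.
  rewrite ler_norml; apply/andP; split; have := sqr_ge0 (u t); have := sqr_ge0 (w t); lra.
rewrite (le_trans (ler_norm _))// normrM ler_pM//.
  rewrite (le_trans (ler_normB _ _))// lerD2r (le_trans (ler_normB _ _))//.
  by rewrite normr1 ger0_norm ?sqr_ge0.
rewrite ler_norml; apply/andP; split.
  have := sqr_ge0 (u t + w t); lra.
have := sqr_ge0 (u t - w t); lra.
Qed.

Lemma lin_sol_uniq l c u w y z : lin_sol l u w -> lin_sol l y z ->
  u 0 = c * y 0 -> w 0 = c * z 0 ->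
  forall x, 0 <= x <= pi -> u x = c * y x /\ w x = c * z x.
Proof.
move=> Luw Lyz u0 w0 x xI.
have [||h1 h2] := lin_sol_eq0 (lin_sol_lin (- c) Luw Lyz) _ _ xI.
- by rewrite u0; ring.
- by rewrite w0; ring.
by split; [move: h1 | move: h2]; lra.
Qed.

Definition prad l (th : R -> R) x := expR (J x (fun t =>
  s t * (sin (th t) ^+ 2 - cos (th t) ^+ 2) + (1 - s t ^+ 2 - l) * (sin (th t) * cos (th t)))).

Lemma pruefer_lin_sol l th : pruefer s l th ->
  lin_sol l (fun x => prad l th x * sin (th x)) (fun x => prad l th x * cos (th x)).
Proof.
move=> Ath; have cth := AC_Cont Ath.
have Bs := Cont_Bm (Cont_sin cth); have Bc := Cont_Bm (Cont_cos cth).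
have IG : Itg (fun t => s t * (sin (th t) ^+ 2 - cos (th t) ^+ 2) +
    (1 - s t ^+ 2 - l) * (sin (th t) * cos (th t))).
  apply: ItgD; apply: ItgM => //.
  - by apply: BmD; [|apply: BmN]; exact: BmX.
  - by apply: ItgB; [apply: ItgB => //|]; exact: Itg_cst.
  - exact: BmM.
have AE := AC_expR (AC_J IG).
have As := AC_sin Ath; have Ac := AC_cos Ath.
split.
  apply: AC_eq (ACM AE As) => // x _; rewrite /rhs_y /prad.
  set r := expR _; rewrite /pF.
  have h := cos2Dsin2 (th x).
  have -> : s x * (r * sin (th x)) + r * cos (th x) =
    s x * (r * sin (th x)) * (cos (th x) ^+ 2 + sin (th x) ^+ 2) +
    r * cos (th x) * (cos (th x) ^+ 2 + sin (th x) ^+ 2) by rewrite h !mulr1.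
  ring.
apply: AC_eq (ACM AE Ac) => // x _; rewrite /rhs_z /prad.
set r := expR _; rewrite /pF.
have h := cos2Dsin2 (th x).
have -> : - s x * (r * cos (th x)) - s x ^+ 2 * (r * sin (th x)) - l * (r * sin (th x)) =
  (- s x * (r * cos (th x)) - s x ^+ 2 * (r * sin (th x)) - l * (r * sin (th x))) *
  (cos (th x) ^+ 2 + sin (th x) ^+ 2) by rewrite h mulr1.
ring.
Qed.

Lemma prad0 l th : prad l th 0 = 1.
Proof. by rewrite /prad J0 expR0. Qed.

End EdgeSolutions.

(** The boundary terms of the Lagrange identity vanish: at 0 because y or y^[1] does, at the inner
    vertex after summation over the edges, because the common value of y factors out of the sum of
    the y^[1]. What remains is b times the squared norm of Y. *)
Lemma no_complex_eigenvalue (R : realType) (m p : nat) (sigma : 'I_m -> R -> R)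
    (a b : R) (Y : qstate R m) :
  (forall j, L2_0pi (sigma j)) -> is_solL p sigma a b Y -> b != 0 -> qzero Y.
Proof.
move=> sL2 [Ed match1 [Sw Ss] bN bD] b0.
pose n2 j t := qu Y j t ^+ 2 + qv Y j t ^+ 2.
have cn2 j : Cont (n2 j).
  have /edge_solP := Ed j => /(_ (sL2 j)) [/AC_Cont cu /AC_Cont cv _ _].
  by apply: ContD; apply: ContM.
have n20 j t : 0 <= n2 j t by rewrite addr_ge0 ?sqr_ge0.
have br j : qv Y j pi * qw Y j pi - qu Y j pi * qs Y j pi = b * Defs.Rint0 pi (n2 j).
  rewrite (edge_bracket (sL2 j) (Ed j)) (_ : _ - _ = 0) ?add0r//.
  case: (ltnP j p) => [/bN[-> ->]|/bD[-> ->]]; by rewrite ?mulr0 ?mul0r subr0.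
move=> j x xI.
have : \sum_i (qv Y i pi * qw Y i pi - qu Y i pi * qs Y i pi) = 0.
  rewrite (eq_bigr (fun i => qv Y j pi * qw Y i pi - qu Y j pi * qs Y i pi)).
    by rewrite big_split /= sumrN -!mulr_sumr Sw Ss !mulr0 subr0.
  by move=> i _; have [-> ->] := match1 i j.
under eq_bigr do rewrite br.
rewrite -mulr_sumr => /eqP; rewrite mulf_eq0 (negbTE b0) /= => /eqP S0.
have J0 i : 0 <= Defs.Rint0 pi (n2 i) by apply: J_ge0.
have := cn2 j => /J_eq0 /(_ (fun t _ => n20 j t)).
have Jj : Defs.Rint0 pi (n2 j) = 0 by apply: (psumr_eq0P _ S0).
move=> /(_ Jj x xI) /eqP; rewrite paddr_eq0 ?sqr_ge0// !sqrf_eq0.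
by move=> /andP[/eqP -> /eqP ->].
Qed.

(** * Angle asymptotics *)

Section ModifiedAngle.
Variable R : realType.
Implicit Types (a l x k : R).
Notation J := (@Defs.Rint0 R).

(** For tan b = k tan a the addition formula gives tan(b - a) = (k - 1) sin a cos a / [hden k a].
    The denominator is positive for k > 0, so the increment b - a is one global arctangent without
    choice of branches. *)
Definition hden k a := cos a ^+ 2 + k * sin a ^+ 2.
(* The continuous branch of arctan (k tan a) that fixes the multiples of pi / 2. *)
Definition hmod k a := a + atan ((k - 1) * (sin a * cos a) / hden k a).

Lemma hden_gt0 k a : 0 < k -> 0 < hden k a.
Proof.
move=> k0; rewrite /hden cos2sin2.
have s1 : sin a ^+ 2 <= 1 by rewrite -(cos2Dsin2 a) lerDr sqr_ge0.
have s0 := sqr_ge0 (sin a).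
have [->|s_neq0] := eqVneq (sin a ^+ 2) 0; first by rewrite mulr0 subr0 addr0.
have : 0 < k * sin a ^+ 2 by rewrite mulr_gt0// lt_def s_neq0.
lra.
Qed.

Lemma hmod_sqr k a : 0 < k ->
  1 + ((k - 1) * (sin a * cos a) / hden k a) ^+ 2 = hden (k ^+ 2) a / hden k a ^+ 2.
Proof.
move=> k0; have q1 : hden k a != 0 by rewrite gt_eqF// hden_gt0.
apply: (mulIf (expf_neq0 2 q1)); rewrite divfK ?expf_neq0//.
rewrite mulrDl mul1r -exprMn divfK// /hden.
have -> : (cos a ^+ 2 + k * sin a ^+ 2) ^+ 2 + ((k - 1) * (sin a * cos a)) ^+ 2 =
  (cos a ^+ 2 + sin a ^+ 2) * (cos a ^+ 2 + k ^+ 2 * sin a ^+ 2) by ring.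
by rewrite cos2Dsin2 mul1r.
Qed.

(** Stretching y by k turns (y, y^[1]) into (k y, y^[1]); the modified angle is the polar angle of
    the stretched vector, whose squared length is [hden (k ^+ 2) a] on the unit circle. *)
Lemma hmod_sincos k a : 0 < k ->
  sin (hmod k a) = k * sin a / Num.sqrt (hden (k ^+ 2) a) /\
  cos (hmod k a) = cos a / Num.sqrt (hden (k ^+ 2) a).
Proof.
move=> k0.
have q0 := hden_gt0 a k0; have n0 := hden_gt0 a (exprn_gt0 2 k0).
set X := (k - 1) * (sin a * cos a) / hden k a.
have q1 : hden k a != 0 by rewrite gt_eqF.
have X2 := hmod_sqr a k0; rewrite -/X in X2.
have N1 : Num.sqrt (hden (k ^+ 2) a) != 0 by rewrite gt_eqF// sqrtr_gt0.
have cb : cos (atan X) = hden k a / Num.sqrt (hden (k ^+ 2) a).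
  rewrite cos_atan X2 sqrtrM ?ltW// sqrtrV ?ltW ?exprn_gt0// sqrtr_sqr gtr0_norm//.
  by rewrite invfM invrK mulrC.
have sb : sin (atan X) = (k - 1) * (sin a * cos a) / Num.sqrt (hden (k ^+ 2) a).
  have c0 : cos (atan X) != 0 by rewrite cb mulf_neq0 ?invr_neq0.
  rewrite -[LHS](divfK c0) -/(tan _) atanK cb /X; field.
  by rewrite N1 q1.
rewrite /hmod -/X sinD cosD cb sb; move: N1; set N := Num.sqrt _ => N1.
have h := cos2Dsin2 a; split.
  have -> : k * sin a / N = k * sin a * (cos a ^+ 2 + sin a ^+ 2) / N by rewrite h mulr1.
  by rewrite /hden; field.
have -> : cos a / N = cos a * (cos a ^+ 2 + sin a ^+ 2) / N by rewrite h mulr1.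
by rewrite /hden; field.
Qed.

Lemma is_derive_hmod k a : 0 < k -> is_derive a 1 (hmod k) (k / hden (k ^+ 2) a).
Proof.
move=> k0.
have q0 := hden_gt0 a k0; have n0 := hden_gt0 a (exprn_gt0 2 k0).
have q1 : hden k a != 0 by rewrite gt_eqF.
have n1 : hden (k ^+ 2) a != 0 by rewrite gt_eqF.
have dq : is_derive a 1 (hden k) (2 * (k - 1) * (sin a * cos a)).
  by rewrite /hden; apply: is_derive_eq; rewrite /GRing.scale /=; ring.
have dsc : is_derive a 1 (fun a => (k - 1) * (sin a * cos a)) ((k - 1) * (cos a ^+ 2 - sin a ^+ 2)).
  by apply: is_derive_eq; rewrite /GRing.scale /=; ring.
have dV := is_deriveV q1 dq.
have dX : is_derive a 1 (fun a => (k - 1) * (sin a * cos a) / hden k a)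
    ((k - 1) * (cos a ^+ 2 - sin a ^+ 2) / hden k a -
     (k - 1) * (sin a * cos a) * (2 * (k - 1) * (sin a * cos a)) / hden k a ^+ 2).
  apply: is_derive_eq; rewrite /GRing.scale /=; field; exact: q1.
pose X b := (k - 1) * (sin b * cos b) / hden k b.
have dA : is_derive a 1 (atan \o X) _ := is_derive1_comp (is_derive1_atan (X a)) dX.
have dh := is_deriveD (is_derive_id a 1) dA.
apply: is_derive_eq dh _; rewrite /X.
rewrite hmod_sqr//.
have -> : (k - 1) * (sin a * cos a) * (2 * (k - 1) * (sin a * cos a)) =
  2 * (k - 1) ^+ 2 * (sin a ^+ 2 * cos a ^+ 2) by ring.
move: q1 n1; rewrite /hden cos2sin2 => q1 n1; field.
by rewrite exprMn q1 n1.
Qed.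

Lemma continuous_hmod' k : 0 < k -> continuous (fun a => k / hden (k ^+ 2) a).
Proof.
move=> k0 a; apply: cvgM; first exact: cvg_cst.
apply: cvgV; first by rewrite gt_eqF// hden_gt0// exprn_gt0.
rewrite /hden; apply: cvgD; first by apply: cvgM; exact: continuous_cos.
by apply: cvgM; [exact: cvg_cst | apply: cvgM; exact: continuous_sin].
Qed.

Lemma hmod_fix k a : sin a * cos a = 0 -> hmod k a = a.
Proof. by move=> h; rewrite /hmod h mulr0 mul0r atan0 addr0. Qed.

Lemma hmod_lt k a b : 0 < k -> a < b -> hmod k a < hmod k b.
Proof.
move=> k0 ab; have := @MVT_ball R (hmod k) _ a (b - a + 1) a b (fun x => is_derive_hmod x k0).
rewrite subrr normr0 ger0_norm ?subr_ge0 ?ltW// ltrDl ltr01 => /(_ _ isT)[]; first lra.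
move=> xi E _; rewrite -subr_gt0 E mulr_gt0 ?subr_gt0//.
by rewrite divr_gt0// hden_gt0// exprn_gt0.
Qed.

Lemma sin_npi (n : nat) : sin (n%:R * pi : R) = 0.
Proof.
rewrite mulr_natl; elim: n => [|n IH]; first by rewrite mulr0n sin0.
by rewrite mulrS addrC sinDpi IH oppr0.
Qed.

(** [Num.trunc] is the floor on nonnegative numbers, and end angles are positive. *)
Definition npi (x : R) : nat := Num.trunc (x / pi).

Lemma npiP x n : 0 <= x -> (npi x == n) = (n%:R * pi <= x < n.+1%:R * pi).
Proof.
move=> x0; have p0 := pi_gt0 R.
by rewrite /npi truncn_eq ?divr_ge0 ?pi_ge0// ler_pdivlMr// ltr_pdivrMr.
Qed.

(** An increasing map that fixes every multiple of pi preserves the intervals between them. *)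
Lemma hmod_npi k x : 0 < k -> 0 <= x -> 0 <= hmod k x /\ npi (hmod k x) = npi x.
Proof.
move=> k0 x0.
have fixn (n : nat) : hmod k (n%:R * pi) = n%:R * pi by rewrite hmod_fix// sin_npi mul0r.
have le a b : a <= b -> hmod k a <= hmod k b.
  by rewrite le_eqVlt => /orP[/eqP ->//|/(hmod_lt k0)/ltW].
have h0 : 0 <= hmod k x by have := le _ _ x0; rewrite -(mul0r pi) (fixn 0%N).
split => //; apply/eqP; rewrite npiP//.
have : npi x == npi x by [].
rewrite npiP// => /andP[a b].
by rewrite -{1}fixn (le _ _ a)/= -fixn hmod_lt.
Qed.

(** The positive factor k is the same for all edges, so poles and the sign of the sum of cotangents
    may be computed with modified angles. *)
Lemma hmod_cot k x : 0 < k -> ((sin (hmod k x) == 0) = (sin x == 0)) /\ cos x / sin x = k * (cos (hmod k x) / sin (hmod k x)).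
Proof.
move=> k0; have [-> ->] := hmod_sincos x k0.
have N1 : Num.sqrt (hden (k ^+ 2) x) != 0.
  by rewrite gt_eqF// sqrtr_gt0 hden_gt0// exprn_gt0.
split; first by rewrite mulf_eq0 invr_eq0 (negbTE N1) orbF mulf_eq0 (gt_eqF k0).
have [->|s0] := eqVneq (sin x) 0; first by rewrite mulr0 mul0r !invr0 !mulr0.
by field; rewrite s0 N1 (gt_eqF k0).
Qed.

(** For lambda = k^2 the dominant terms combine into the constant speed k. The rest is linear in s
    with an oscillating factor, or carries 1 / k. *)
Lemma pruefer_hmod (s th : R -> R) k : 0 < k -> pruefer s (k ^+ 2) th ->
  abs_cont (fun x => hmod k (th x)) (fun x => k + (s x * (2 * (sin (hmod k (th x)) * cos (hmod k (th x))))
     + s x ^+ 2 / k * sin (hmod k (th x)) ^+ 2)).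
Proof.
move=> k0 Ath.
apply: AC_eq (AC_comp (fun x => is_derive_hmod x k0) (continuous_hmod' k0) Ath) => // x _.
have [-> ->] := hmod_sincos (th x) k0.
have n0 := hden_gt0 (th x) (exprn_gt0 2 k0).
set N := Num.sqrt _.
have N1 : N != 0 by rewrite gt_eqF// sqrtr_gt0.
have N2 : N ^+ 2 = hden (k ^+ 2) (th x) by rewrite sqr_sqrtr// ltW.
rewrite -N2.
have -> : pF s (k ^+ 2) x (th x) = N ^+ 2 + s x * (2 * (sin (th x) * cos (th x))) +
    s x ^+ 2 * sin (th x) ^+ 2 by rewrite N2 /hden /pF; ring.
by field; rewrite N1 (gt_eqF k0).
Qed.

End ModifiedAngle.

(** * Square summable sequences *)

Section SquareSummable.
Variable R : realType.
Implicit Types (d e : nat -> R).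

Definition sqs d := summable_nonneg (fun n => d n ^+ 2).

(** The first n0 terms only enlarge the bound; the asymptotic estimates hold for large n only. *)
Lemma summable_le (f g : nat -> R) n0 : (forall n, (n0 <= n)%N -> f n <= g n) ->
  (forall n, 0 <= g n) -> summable_nonneg g -> summable_nonneg f.
Proof.
move=> fg g0 [M HM]; exists (\sum_(n < n0) `|f n| + M) => N.
suff : \sum_(n < N) f n <= \sum_(n < minn N n0) `|f n| + \sum_(n < N) g n.
  move=> /le_trans; apply; rewrite lerD//.
  rewrite (big_ord_widen n0 (fun n => `|f n|)) ?geq_minr//.
  by rewrite big_mkcond; apply: ler_sum => i _; case: ifP.
elim: N => [|N IH]; first by rewrite min0n !big_ord0 addr0.
rewrite !big_ord_recr /=; have [h|h] := ltnP N n0.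
  rewrite (minn_idPl h) big_ord_recr /=; move: IH; rewrite (minn_idPl (ltnW h)).
  have := g0 N; have := ler_norm (f N); lra.
move: IH; rewrite (minn_idPr h) (minn_idPr (leqW h)); have := fg N h; lra.
Qed.

Lemma sqs_le d e : (forall n, `|d n| <= `|e n|) -> sqs e -> sqs d.
Proof.
move=> de; apply: (@summable_le _ _ 0%N) => n; last exact: sqr_ge0.
by move=> _; rewrite -[leLHS]real_normK ?num_real// -[leRHS]real_normK ?num_real// lerXn2r ?nnegrE.
Qed.

Lemma sqsZ (c : R) d : sqs d -> sqs (fun n => c * d n).
Proof.
move=> [M HM]; exists (c ^+ 2 * M) => N.
under eq_bigr do rewrite exprMn.
by rewrite -mulr_sumr ler_wpM2l// sqr_ge0.
Qed.

Lemma sqsD d e : sqs d -> sqs e -> sqs (fun n => d n + e n).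
Proof.
move=> [M HM] [M' HM']; exists (2 * M + 2 * M') => N.
apply: (@le_trans _ _ (\sum_(n < N) (2 * d n ^+ 2 + 2 * e n ^+ 2))).
  apply: ler_sum => n _; rewrite -subr_ge0.
  have -> : 2 * d n ^+ 2 + 2 * e n ^+ 2 - (d n + e n) ^+ 2 = (d n - e n) ^+ 2 by ring.
  exact: sqr_ge0.
rewrite big_split /= -!mulr_sumr; have := HM N; have := HM' N; lra.
Qed.

Lemma sqs0 : sqs (fun=> 0).
Proof. by exists 0 => N; rewrite big1// => i _; rewrite expr0n. Qed.

Lemma sqs_sum (I : Type) (r : seq I) (d : I -> nat -> R) : (forall i, sqs (d i)) ->
  sqs (fun n => \sum_(i <- r) d i n).
Proof.
move=> sd; elim: r => [|i r IH].
  by apply: sqs_le sqs0 => n; rewrite big_nil normr0.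
by apply: sqs_le (sqsD (sd i) IH) => n; rewrite big_cons.
Qed.

Lemma sqs_harmonic : sqs (fun n => n.+1%:R^-1).
Proof.
exists 2 => -[|N]; first by rewrite big_ord0.
(* The sharper bound makes the induction work: 1 / (x + 1)^2 <= 1 / x - 1 / (x + 1). *)
suff : \sum_(n < N.+1) (n.+1%:R^-1 : R) ^+ 2 <= 2 - N.+1%:R^-1.
  by move=> /le_trans; apply; rewrite gerBl invr_ge0.
elim: N => [|N IH]; first by rewrite big_ord1 invr1; lra.
rewrite big_ord_recr /=.
apply: (le_trans (lerD IH (lexx _))).
have n1 : 0 < N.+1%:R :> R by rewrite ltr0n.
have -> : N.+2%:R = N.+1%:R + 1 :> R by rewrite -addn1 natrD.
move: n1; set x : R := N.+1%:R => n1.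
have x1 : 0 < x + 1 by lra.
rewrite -subr_ge0.
have -> : 2 - (x + 1)^-1 - (2 - x^-1 + (x + 1)^-1 ^+ 2) = (x * (x + 1) ^+ 2)^-1.
  by field; lra.
by rewrite invr_ge0 mulr_ge0 ?sqr_ge0// ltW.
Qed.

Lemma sqs_small d (eta : R) : sqs d -> 0 < eta -> exists N, forall n, (N <= n)%N -> `|d n| < eta.
Proof.
move=> [M HM] eta0; apply/not_existsP => H.
have {H} H N : exists2 n, (N <= n)%N & eta <= `|d n|.
  apply: contra_notP (H N) => /forall2NP h n Nn.
  by have [/negP//|/negP] := h n; rewrite -ltNge.
have grow k : exists N, k%:R * eta ^+ 2 <= \sum_(n < N) d n ^+ 2.
  elim: k => [|k [N IH]]; first by exists 0%N; rewrite mul0r big_ord0.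
  have [n Nn En] := H N; exists n.+1.
  rewrite big_ord_recr /= -[k.+1]addn1 natrD mulrDl mul1r lerD//.
    apply: (le_trans IH).
    rewrite (big_ord_widen n (fun n => d n ^+ 2) Nn) big_mkcond.
    by apply: ler_sum => i _; case: ifP => // _; exact: sqr_ge0.
  rewrite -[leRHS]real_normK ?num_real// lerXn2r ?nnegrE//; exact: ltW.
have e2 : 0 < eta ^+ 2 by rewrite exprn_gt0.
have [N] := grow (Num.trunc (`|M| / eta ^+ 2)).+1.
apply/negP; rewrite -ltNge (le_lt_trans (HM N))// (le_lt_trans (ler_norm _))//.
by rewrite -ltr_pdivrMr// truncnS_gt.
Qed.

End SquareSummable.

(** * Bessel's inequality, uniform in the upper limit of integration *)

Section Bessel.
Variable R : realType.
Implicit Types (f g : R -> R) (x c : R).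
Notation J := (@Defs.Rint0 R).

Lemma Itg_sum (F : nat -> R -> R) N : (forall i, Itg (F i)) ->
  Itg (fun t => \sum_(i < N) F i t).
Proof.
move=> IF; elim: N => [|N IH].
  by apply: Itg_eq (Itg_cst 0) => t _; rewrite big_ord0.
by apply: Itg_eq (ItgD IH (IF N)) => t _; rewrite big_ord_recr.
Qed.

Lemma J_sum (F : nat -> R -> R) N x : 0 <= x <= pi -> (forall i, Itg (F i)) ->
  J x (fun t => \sum_(i < N) F i t) = \sum_(i < N) J x (F i).
Proof.
move=> xI IF; have [x0 xpi] := andP xI; elim: N => [|N IH].
  rewrite big_ord0 (@J_eq _ _ (fun=> 0))//; first by rewrite J_cst// mul0r.
  by move=> t _; rewrite big_ord0.
rewrite big_ord_recr /= -IH -JD//; last exact: Itg_sum.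
by apply: J_eq => // t _; rewrite big_ord_recr.
Qed.

(** The nonnegative quadratic polynomial in u is evaluated at u = X / (P + 1). The added 1 spares
    the case P = 0 and costs only a constant. *)
Lemma cauchy_schwarz f g : Itg (fun t => f t ^+ 2) -> Itg (fun t => f t * g t) ->
  Itg (fun t => g t ^+ 2) ->
  J pi (fun t => f t * g t) ^+ 2 <= (J pi (fun t => f t ^+ 2) + 1) * J pi (fun t => g t ^+ 2).
Proof.
move=> If Ifg Ig.
set P := J pi (fun t => f t ^+ 2); set X := J pi _; set Y := J pi _.
have P0 : 0 <= P by apply: J_ge0 => // t _; exact: sqr_ge0.
have H u : 0 <= u ^+ 2 * P - 2 * u * X + Y.
  have -> : u ^+ 2 * P - 2 * u * X + Y = J pi (fun t => (u * f t - g t) ^+ 2).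
    rewrite -!JZ// -JB//; try exact: ItgZ.
    rewrite -JD//; last by apply: ItgB; exact: ItgZ.
    by apply: J_eq => // t _; ring.
  by apply: J_ge0 => // t _; exact: sqr_ge0.
have P1 : 0 < P + 1 by lra.
have := H (X / (P + 1)).
have -> : (X / (P + 1)) ^+ 2 * P - 2 * (X / (P + 1)) * X + Y =
   (P + 1)^-1 * ((P + 1) * Y - X ^+ 2) - (X / (P + 1)) ^+ 2 by field; lra.
move=> h; have := sqr_ge0 (X / (P + 1)) => h'.
have : 0 <= (P + 1)^-1 * ((P + 1) * Y - X ^+ 2) by lra.
by rewrite pmulr_rge0 ?invr_gt0// subr_ge0.
Qed.

(** Bessel's inequality for f cut off at x. The square of f - T is integrated over [0, x] only,
    while orthogonality on [0, pi] enters after enlarging the integral of T^2 to the whole interval.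
    Hence the bound does not depend on x. *)
Lemma bessel (f : R -> R) (e : nat -> R -> R) N x :
  Itg f -> Itg (fun t => f t ^+ 2) -> (forall i, Cont (e i)) ->
  (forall i t, `|e i t| <= 1) ->
  (forall i j, i != j -> J pi (fun t => e i t * e j t) = 0) -> 0 <= x <= pi ->
  \sum_(i < N) J x (fun t => f t * e i t) ^+ 2 <= pi * J pi (fun t => f t ^+ 2).
Proof.
move=> If If2 ce e1 orth xI; have [x0 xpi] := andP xI.
have p0 := pi_gt0 R.
have pn : (pi : R) != 0 by rewrite gt_eqF.
pose a i := J x (fun t => f t * e i t).
(* pi bounds the integral of every e_i^2, because |e_i| <= 1. *)
pose T t := \sum_(i < N) a i / pi * e i t.
have Ie i : Itg (fun t => a i / pi * e i t).
  by apply: ItgZ; apply: Bm_Itg; exact: Cont_Bm.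
have IT : Itg T by exact: (@Itg_sum (fun i t => a i / pi * e i t)).
have cT : Cont T.
  rewrite /T; elim: (N) => [|n IH].
    by apply: (@Cont_eq R (fun=> 0)); [move=> t _; rewrite big_ord0 | exact: Cont_cst].
  apply: (@Cont_eq _ (fun t => (\sum_(i < n) a i / pi * e i t) + a n / pi * e n t)).
    by move=> t _; rewrite big_ord_recr.
  by apply: ContD => //; apply: ContM => //; exact: Cont_cst.
have BT := Cont_Bm cT.
have IT2 : Itg (fun t => T t ^+ 2) by apply: Bm_Itg; exact: BmX.
have IfT : Itg (fun t => f t * T t) by exact: ItgM.
have Ife i : Itg (fun t => f t * e i t) by apply: ItgM => //; exact: Cont_Bm.
have h1 : 0 <= J x (fun t => (f t - T t) ^+ 2) by apply: J_ge0 => // t _; exact: sqr_ge0.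
have E1 : J x (fun t => (f t - T t) ^+ 2) =
    J x (fun t => f t ^+ 2) - 2 * J x (fun t => f t * T t) + J x (fun t => T t ^+ 2).
  rewrite -JZ// -JB//; last exact: ItgZ.
  rewrite -JD//; last by apply: ItgB => //; exact: ItgZ.
  by apply: J_eq => // t _; ring.
have E2 : J x (fun t => f t * T t) = \sum_(i < N) a i ^+ 2 / pi.
  transitivity (J x (fun t => \sum_(i < N) a i / pi * (f t * e i t))).
    by apply: J_eq => // t _; rewrite mulr_sumr; apply: eq_bigr => i _; ring.
  rewrite (J_sum _ _ (F := fun i t => a i / pi * (f t * e i t)))//; last first.
    by move=> i; exact: ItgZ.
  by apply: eq_bigr => i _; rewrite JZ// -/(a i); ring.
have Iee i j : Itg (fun t => e i t * e j t).
  by apply: Bm_Itg; apply: BmM; exact: Cont_Bm.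
have E3 : J pi (fun t => T t ^+ 2) <= \sum_(i < N) a i ^+ 2 / pi.
  have -> : J pi (fun t => T t ^+ 2) =
      J pi (fun t => \sum_(i < N) a i / pi * (T t * e i t)).
    apply: J_eq => // t _; rewrite expr2 {1}/T mulr_suml; apply: eq_bigr => i _; ring.
  have ITe i : Itg (fun t => T t * e i t) by apply: ItgM => //; exact: Cont_Bm.
  rewrite (J_sum _ _ (F := fun i t => a i / pi * (T t * e i t)))//; last first.
    by move=> i; exact: ItgZ.
  apply: ler_sum => i _; rewrite JZ//.
  have -> : J pi (fun t => T t * e i t) =
      J pi (fun t => \sum_(j < N) a j / pi * (e j t * e i t)).
    by apply: J_eq => // t _; rewrite /T mulr_suml; apply: eq_bigr => j _; ring.
  rewrite (J_sum _ _ (F := fun j t => a j / pi * (e j t * e i t)))//; last first.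
    by move=> j; exact: ItgZ.
  rewrite (bigD1 i)//= big1 ?addr0; last first.
    by move=> j ji; rewrite JZ// orth ?mulr0.
  rewrite JZ// mulrA.
  have -> : a i ^+ 2 / pi = a i / pi * (a i / pi) * pi.
    by rewrite -[RHS]mulrA divfK// expr2 mulrAC.
  apply: ler_wpM2l; first by rewrite -expr2 sqr_ge0.
  apply: (@le_trans _ _ (J pi (fun=> 1))); last by rewrite J_cst ?mul1r// pi_ge0.
  apply: J_le => //; first exact: Itg_cst.
  move=> t _; rewrite (le_trans (ler_norm _))// normrM -[leRHS]mulr1 ler_pM//.
have h2 : J x (fun t => T t ^+ 2) <= J pi (fun t => T t ^+ 2).
  by apply: J_homo => // *; exact: sqr_ge0.
have h3 : J x (fun t => f t ^+ 2) <= J pi (fun t => f t ^+ 2).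
  by apply: J_homo => // *; exact: sqr_ge0.
have : (\sum_(i < N) a i ^+ 2) / pi <= J pi (fun t => f t ^+ 2).
  rewrite mulr_suml; move: h1 E3; rewrite E1 E2; set S := \sum_(i < N) _ => h1 E3.
  by have := le_trans h2 E3; move: h1 h3; lra.
by rewrite ler_pdivrMr// mulrC.
Qed.

Lemma J_cos_eq0 c : c != 0 -> sin (c * pi) = 0 -> J pi (fun t => cos (c * t)) = 0.
Proof.
move=> c0 s0.
have A := ACZ c^-1 (AC_sin (ACZ c (AC_id R))).
have [_ /(_ pi (in0pi_pi R))] := A; rewrite s0 !mulr0 sin0 mulr0 add0r => ->.
by apply: J_eq => // t _; field.
Qed.

(** c is 1 or -1, which treats the sum and the difference of two frequencies together. *)
Lemma J_cos_nat (c : R) i j : (i%:R * 2 + j%:R * 2 * c : R) != 0 -> c ^+ 2 = 1 ->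
  J pi (fun t => cos ((i%:R * 2 + j%:R * 2 * c) * t)) = 0.
Proof.
move=> h c1; apply: J_cos_eq0 => //.
have s2 k : sin (k%:R * 2 * pi : R) = 0 by rewrite -natrM sin_npi.
move/eqP: c1; rewrite sqrf_eq1 => /orP[] /eqP ->.
  by rewrite mulr1 mulrDl sinD !s2 mul0r mulr0 addr0.
by rewrite mulrN1 mulrDl mulNr sinD sinN cosN !s2 oppr0 mul0r mulr0 addr0.
Qed.

Lemma orth_sincos i j : i != j ->
  J pi (fun t => sin (2 * i%:R * t) * sin (2 * j%:R * t)) = 0 /\
  J pi (fun t => cos (2 * i%:R * t) * cos (2 * j%:R * t)) = 0.
Proof.
move=> ij.
have Ic c : Itg (fun t : R => cos (c * t)).
  apply: Bm_Itg; apply: Cont_Bm; apply: Cont_cos; apply: AC_Cont; exact: ACZ (AC_id R).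
have dm : (i%:R * 2 + j%:R * 2 * (-1) : R) != 0.
  rewrite mulrN1 subr_eq0; apply: contraNneq ij => /(mulIf (_ : (2 : R) != 0)) h.
  by rewrite -(eqr_nat R) h.
have dp : (i%:R * 2 + j%:R * 2 * 1 : R) != 0.
  rewrite mulr1 -mulrDl -natrD mulf_eq0 !pnatr_eq0 orbF addn_eq0.
  by apply: contraNN ij => /andP[/eqP -> /eqP ->].
have N1 : (-1 : R) ^+ 2 = 1 by rewrite sqrrN expr1n.
have Jm := J_cos_nat dm N1.
have Jp := J_cos_nat dp (expr1n _ 2).
have I1 := Ic (i%:R * 2 + j%:R * 2 * (-1)).
have I2 := Ic (i%:R * 2 + j%:R * 2 * 1).
have Em (t : R) : (i%:R * 2 + j%:R * 2 * -1) * t = 2 * i%:R * t - 2 * j%:R * t by ring.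
have Ep (t : R) : (i%:R * 2 + j%:R * 2 * 1) * t = 2 * i%:R * t + 2 * j%:R * t by ring.
split.
  transitivity (J pi (fun t => 2^-1 * cos ((i%:R * 2 + j%:R * 2 * (-1)) * t) -
      2^-1 * cos ((i%:R * 2 + j%:R * 2 * 1) * t))).
    apply: J_eq => // t _; rewrite Em Ep cosB cosD; by field.
  rewrite JB//; [|exact: ItgZ|exact: ItgZ].
  by rewrite !JZ// Jm ?Jp// !mulr0 subr0.
transitivity (J pi (fun t => 2^-1 * cos ((i%:R * 2 + j%:R * 2 * (-1)) * t) +
    2^-1 * cos ((i%:R * 2 + j%:R * 2 * 1) * t))).
  apply: J_eq => // t _; rewrite Em Ep cosB cosD; by field.
rewrite JD//; [|exact: ItgZ|exact: ItgZ].
by rewrite !JZ// Jm ?Jp// !mulr0 addr0.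
Qed.

End Bessel.

(** * Deviation of the modified angle from uniform rotation *)

Section AngleAsymptotics.
Variable R : realType.
Implicit Types (f g : R -> R) (x c : R).
Notation J := (@Defs.Rint0 R).

(** Integration by parts moves the slowly varying factor phi away from f. The bound depends on phi
    only through |phi| <= 1 and |phi'| <= 2, hence is uniform over |rho - n| <= 1. *)
Lemma J_mul_bound f (phi phi' : R -> R) x : Itg f -> abs_cont phi phi' ->
  (forall t, `|phi t| <= 1) -> (forall t, `|phi' t| <= 2) -> 0 <= x <= pi ->
  `|J x (fun t => f t * phi t)| <= `|J x f| + 2 * J pi (fun t => `|J t f|).
Proof.
move=> If Ap p1 p2 xI; have [x0 xpi] := andP xI.
have AA := AC_J If; have BA := AC_Bm AA.
have [_ /(_ x xI)] := ACM AA Ap.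
have [Ip' _] := Ap.
have IAp : Itg (fun t => J t f * phi' t) by exact: ItgMr.
have Ifp : Itg (fun t => f t * phi t) by apply: ItgM => //; exact: AC_Bm Ap.
rewrite J0 mul0r add0r JD// => E.
have -> : J x (fun t => f t * phi t) = J x f * phi x - J x (fun t => J t f * phi' t) by rewrite E; ring.
rewrite (le_trans (ler_normB _ _))// lerD//; first by rewrite normrM ler_piMr.
have IA : Itg (fun t => `|J t f|) by apply: Bm_Itg; exact: Bm_abs.
apply: (@le_trans _ _ (J x (fun t => 2 * `|J t f|))).
  apply: J_abs => //; first exact: ItgZ.
  by move=> t _; rewrite normrM mulrC ler_wpM2r.
rewrite JZ// ler_wpM2l//; apply: J_homo => //.
Qed.

Variable s : R -> R.
Hypothesis sL2 : L2_0pi s.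

Let Is : Itg s. Proof. exact: L2_Itg. Qed.
Let Is2 : Itg (fun t => s t ^+ 2). Proof. exact: L2_Itg_sqr. Qed.
Let V := J pi (fun t => s t ^+ 2).

Let V0 : 0 <= V. Proof. by apply: J_ge0 => // t _; exact: sqr_ge0. Qed.

Lemma Cont_lin (c : R) : Cont (fun t => c * t).
Proof. exact: AC_Cont (ACZ c (AC_id R)). Qed.

Section Family.
Variable e : nat -> R -> R.
Hypothesis ce : forall i, Cont (e i).
Hypothesis e1 : forall i t, `|e i t| <= 1.
Hypothesis orth : forall i j, i != j -> J pi (fun t => e i t * e j t) = 0.

Let a n x := J x (fun t => s t * e n t).

Let Ise n : Itg (fun t => s t * e n t).
Proof. by apply: ItgM => //; exact: Cont_Bm. Qed.

Let Ca n : Cont (a n). Proof. exact: J_Cont. Qed.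

Lemma sqs_fourier x : 0 <= x <= pi -> sqs (fun n => a n x).
Proof. by move=> xI; exists (pi * V) => N; exact: bessel. Qed.

(** Cauchy-Schwarz for each n, then the sum over n is taken under the integral, where Bessel's
    inequality applies at every upper limit t. *)
Lemma sqs_fourier_int f : Itg f -> Itg (fun t => f t ^+ 2) ->
  sqs (fun n => J pi (fun t => f t * `|a n t|)).
Proof.
move=> If If2.
exists ((J pi (fun t => f t ^+ 2) + 1) * (pi * V * pi)) => N.
have Ia2 n : Itg (fun t => `|a n t| ^+ 2).
  by apply: Bm_Itg; apply: BmX; apply: Bm_abs; exact: Cont_Bm.
apply: (@le_trans _ _ (\sum_(n < N) (J pi (fun t => f t ^+ 2) + 1) * J pi (fun t => `|a n t| ^+ 2))).
  apply: ler_sum => n _; apply: cauchy_schwarz => //.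
  by apply: ItgM => //; apply: Bm_abs; exact: Cont_Bm.
rewrite -mulr_sumr ler_wpM2l//.
  by rewrite addr_ge0//; apply: J_ge0 => // t _; exact: sqr_ge0.
rewrite -(J_sum _ _ (F := fun n t => `|a n t| ^+ 2))//.
rewrite -(@J_cst R _ pi (pi_ge0 R)); apply: J_le => //.
- exact: (Itg_sum (F := fun n t => `|a n t| ^+ 2)).
- exact: Itg_cst.
move=> t tI; rewrite (eq_bigr (fun n : 'I_N => a n t ^+ 2)); first exact: bessel.
by move=> n _; rewrite real_normK// num_real.
Qed.

End Family.

Let es (n : nat) (t : R) := sin (2 * n%:R * t).
Let ec (n : nat) (t : R) := cos (2 * n%:R * t).
Let a n x := J x (fun t => s t * es n t).
Let b n x := J x (fun t => s t * ec n t).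

Let ces n : Cont (es n). Proof. by apply: Cont_sin; exact: Cont_lin. Qed.
Let cec n : Cont (ec n). Proof. by apply: Cont_cos; exact: Cont_lin. Qed.
Let es1 n t : `|es n t| <= 1. Proof. exact: sin_max. Qed.
Let ec1 n t : `|ec n t| <= 1. Proof. exact: cos_max. Qed.
Let es_orth i j : i != j -> J pi (fun t => es i t * es j t) = 0.
Proof. by case/(orth_sincos R). Qed.
Let ec_orth i j : i != j -> J pi (fun t => ec i t * ec j t) = 0.
Proof. by case/(orth_sincos R). Qed.
Let Ca n : Cont (a n).
Proof. by apply: J_Cont; apply: ItgM => //; exact: Cont_Bm. Qed.
Let Cb n : Cont (b n).
Proof. by apply: J_Cont; apply: ItgM => //; exact: Cont_Bm. Qed.

(** [K n] holds the parts independent of x: the integrals left by integration by parts, and 3 V / (n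
    + 1), which bounds the integral of s^2 / rho. [F n x] bounds the forcing up to x for all rho
    within distance 1 of n >= 2, and [d n] is what Gronwall's inequality with kernel 2 |s| makes of
    it at pi. *)
Let K n := 2 * J pi (fun t => `|a n t|) + 2 * J pi (fun t => `|b n t|) + 3 * V * n.+1%:R^-1.
Let F n x := `|a n x| + `|b n x| + K n.
Let E := expR (J pi (fun t => 2 * `|s t|)).
Let d n := F n pi + E * J pi (fun t => 2 * `|s t| * F n t).

Let K0 n : 0 <= K n.
Proof.
by rewrite !addr_ge0 ?mulr_ge0 ?invr_ge0//; apply: J_ge0.
Qed.

Let F0 n x : 0 <= F n x.
Proof. by rewrite /F addr_ge0 ?K0// addr_ge0. Qed.

Let BF n : Bm (F n).
Proof.
apply: BmD; last exact: Bm_cst.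
by apply: BmD; apply: Bm_abs; exact: Cont_Bm.
Qed.

Lemma normr_piMl (y x : R) : `|x| <= 1 -> `|x * y| <= `|y|.
Proof. by move=> x1; rewrite normrM ler_piMl. Qed.

Lemma normrN_sin_le (x : R) : `|- sin x| <= 1.
Proof. by rewrite normrN sin_max. Qed.

(** The phase is split as 2 n t + w(t) with |w'| <= 2, so that integer frequencies, to which
    Bessel's inequality applies, carry the oscillation. *)
Lemma forcing_bound n (rho th0 : R) x : `|rho - n%:R| <= 1 -> 0 <= x <= pi ->
  `|J x (fun t => s t * sin (2 * th0 + 2 * rho * t))| <= F n x - 3 * V * n.+1%:R^-1.
Proof.
move=> rn xI; have [x0 xpi] := andP xI.
pose w t := 2 * th0 + 2 * (rho - n%:R) * t.
have Aw : abs_cont w (fun t => 0 + 2 * (rho - n%:R) * 1).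
  by apply: ACD; [exact: AC_cst | exact: ACZ (AC_id R)].
have w2 : `|0 + 2 * (rho - n%:R) * 1| <= 2.
  by rewrite add0r mulr1 normrM ger0_norm// ler_piMr.
have Ia : Itg (fun t => s t * es n t) by apply: ItgM => //; exact: Cont_Bm.
have Ib : Itg (fun t => s t * ec n t) by apply: ItgM => //; exact: Cont_Bm.
have h1 := J_mul_bound Ia (AC_cos Aw) (fun t => cos_max _) _ xI.
have h2 := J_mul_bound Ib (AC_sin Aw) (fun t => sin_max _) _ xI.
have cw := AC_Cont Aw.
rewrite (@J_eq _ _ (fun t => s t * es n t * cos (w t) + s t * ec n t * sin (w t)))//; last first.
  move=> t _; have -> : 2 * th0 + 2 * rho * t = 2 * n%:R * t + w t by rewrite /w; ring.
  by rewrite sinD /es /ec; ring.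
rewrite JD//; first last.
- by apply: ItgM => //; apply: Cont_Bm; exact: Cont_sin.
- by apply: ItgM => //; apply: Cont_Bm; exact: Cont_cos.
rewrite (le_trans (ler_normD _ _))//.
have k1 := h1 (fun t => le_trans (normr_piMl _ (normrN_sin_le (w t))) w2).
have k2 := h2 (fun t => le_trans (normr_piMl _ (cos_max (w t))) w2).
apply: (le_trans (lerD k1 k2)).
rewrite /F /K -/(a n x) -/(b n x); move: `|a n x| `|b n x| (J pi _) (J pi _) (3 * V * _).
by move=> A B P Q X; rewrite le_eqVlt; apply/orP; left; apply/eqP; ring.
Qed.

(** The deviation D starts at 0, because [hmod] fixes multiples of pi / 2. In the term of D' linear
    in s the angle is replaced by the unperturbed th 0 + rho t, giving [g0]. The error is at most 2
    |s| |D|, by sin h cos h - sin b cos b = cos(h + b) sin(h - b), and Gronwall's inequality absorbs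
    it. *)
Lemma angle_dev n (rho : R) th : (2 <= n)%N -> `|rho - n%:R| <= 1 ->
  pruefer s (rho ^+ 2) th -> sin (th 0) * cos (th 0) = 0 ->
  `|hmod rho (th pi) - th 0 - rho * pi| <= d n.
Proof.
move=> n2 rn Ath h0.
have n2' : 2 <= n%:R :> R by rewrite ler_nat.
(* From rho >= n - 1 and n >= 2. *)
have rho1 : n.+1%:R / 3 <= rho.
  by move: rn; rewrite -(natr1 n) ler_norml => /andP[]; lra.
have rho0 : 0 < rho by apply: lt_le_trans rho1; rewrite divr_gt0.
have rV : rho^-1 <= 3 * n.+1%:R^-1.
  rewrite -[leRHS]invrK lef_pV2 ?posrE ?invr_gt0 ?mulr_gt0 ?invr_gt0//.
  by rewrite invfM invrK mulrC.
have Ah := pruefer_hmod rho0 Ath.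
pose h x := hmod rho (th x).
pose D x := h x - th 0 - rho * x.
pose g t := s t * (2 * (sin (h t) * cos (h t))) + s t ^+ 2 / rho * sin (h t) ^+ 2.
have AD : abs_cont D g.
  apply: AC_eq (ACB (ACB Ah (AC_cst (th 0))) (ACZ rho (AC_id R))) => // t _.
  by rewrite /g /h; ring.
have D0 : D 0 = 0 by rewrite /D /h hmod_fix//; ring.
have Ch := AC_Cont Ah; have CD := AC_Cont AD.
have Bsh : Bm (fun t => sin (h t)) by apply: Cont_Bm; exact: Cont_sin.
have Bch : Bm (fun t => cos (h t)) by apply: Cont_Bm; exact: Cont_cos.
pose g0 t := s t * sin (2 * th 0 + 2 * rho * t).
have Ig0 : Itg g0.
  apply: ItgM => //; apply: Cont_Bm; apply: Cont_sin.
  by apply: ContD; [exact: Cont_cst | exact: Cont_lin].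
have Bu : Bm (fun t => `|D t|) by apply: Bm_abs; exact: Cont_Bm.
have Iu : Itg (fun t => 2 * `|s t| * `|D t|).
  by apply: ItgM => //; apply: ItgZ; exact: Itg_abs.
have Iv : Itg (fun t => rho^-1 * s t ^+ 2) by exact: ItgZ.
have uF x : 0 <= x <= pi -> `|D x| <= F n x + J x (fun t => 2 * `|s t| * `|D t|).
  move=> xI; have [x0 xpi] := andP xI.
  have [Ig gE] := AD.
  have -> : D x = J x g0 + J x (fun t => g t - g0 t) by rewrite gE// D0 add0r JB//; ring.
  rewrite (le_trans (ler_normD _ _))//.
  have h1 : `|J x g0| <= F n x - 3 * V * n.+1%:R^-1 := forcing_bound (th 0) rn xI.
  have h2 : `|J x (fun t => g t - g0 t)| <= J x (fun t => 2 * `|s t| * `|D t| + rho^-1 * s t ^+ 2).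
    apply: J_abs => //; [exact: ItgB | exact: ItgD |].
    move=> t _; rewrite /g /g0.
    pose bb := th 0 + rho * t.
    have -> : 2 * th 0 + 2 * rho * t = bb + bb by rewrite /bb; ring.
    rewrite sinD.
    have -> : s t * (2 * (sin (h t) * cos (h t))) + s t ^+ 2 / rho * sin (h t) ^+ 2 -
      s t * (sin bb * cos bb + cos bb * sin bb) =
      s t * (2 * (sin (h t) * cos (h t) - sin bb * cos bb)) + rho^-1 * s t ^+ 2 * sin (h t) ^+ 2.
      by ring.
    rewrite (le_trans (ler_normD _ _))// lerD//.
      rewrite normrM normrM (ger0_norm (ler0n R 2)) mulrCA -mulrA ler_wpM2l// ler_wpM2l//.
      have hb : D t = h t - bb by rewrite /D /bb; ring.
      have -> : sin (h t) * cos (h t) - sin bb * cos bb = cos (h t + bb) * sin (h t - bb).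
        rewrite cosD sinB.
        have -> : (cos (h t) * cos bb - sin (h t) * sin bb) * (sin (h t) * cos bb - cos (h t) * sin bb) =
          sin (h t) * cos (h t) * (cos bb ^+ 2 + sin bb ^+ 2) -
          sin bb * cos bb * (cos (h t) ^+ 2 + sin (h t) ^+ 2) by ring.
        by rewrite !cos2Dsin2 !mulr1.
      by rewrite -hb normrM (le_trans _ (sin_le_norm (D t)))// ler_piMl// cos_max.
    rewrite normrM ger0_norm; last by rewrite mulr_ge0 ?sqr_ge0// invr_ge0 ltW.
    rewrite ler_piMr//; first by rewrite mulr_ge0 ?sqr_ge0// invr_ge0 ltW.
    by rewrite normrX exprn_ile1//; exact: sin_max.
  rewrite (JD xI Iu Iv) (JZ _ xI Is2) in h2.
  have h3 : rho^-1 * J x (fun t => s t ^+ 2) <= 3 * V * n.+1%:R^-1.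
    rewrite mulrAC ler_pM ?invr_ge0 ?(ltW rho0)//.
      by apply: J_ge0 => // t _; exact: sqr_ge0.
    by apply: J_homo => // *; exact: sqr_ge0.
  apply: (le_trans (lerD h1 (le_trans h2 (lerD (lexx _) h3)))).
  by rewrite le_eqVlt; apply/orP; left; apply/eqP; ring.
have Ik : Itg (fun t => 2 * `|s t|) by apply: ItgZ; exact: Itg_abs.
have := gronwall Bu (BF n) Ik _ _ uF (in0pi_pi R).
rewrite -/E /d => H; apply: H => t _; rewrite ?mulr_ge0//.
Qed.

Lemma sqs_dev : sqs d.
Proof.
have Ias : Itg (fun t => `|s t|) by exact: Itg_abs.
have Ias2 : Itg (fun t => `|s t| ^+ 2).
  by apply: Itg_eq Is2 => t _; rewrite real_normK// num_real.
have I1 : Itg (fun=> 1 : R) by exact: Itg_cst.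
have I12 : Itg (fun=> 1 ^+ 2 : R) by exact: Itg_cst.
have Aa n : Itg (fun t => `|a n t|) by apply: Bm_Itg; apply: Bm_abs; exact: Cont_Bm.
have Ab n : Itg (fun t => `|b n t|) by apply: Bm_Itg; apply: Bm_abs; exact: Cont_Bm.
have Jsa n : Itg (fun t => `|s t| * `|a n t|) by apply: ItgM => //; apply: Bm_abs; exact: Cont_Bm.
have Jsb n : Itg (fun t => `|s t| * `|b n t|) by apply: ItgM => //; apply: Bm_abs; exact: Cont_Bm.
have sK : sqs K.
  apply: sqsD; first apply: sqsD; first apply: sqsZ.
  - apply: sqs_le (sqs_fourier_int ces es1 es_orth I1 I12) => n.
    rewrite le_eqVlt; apply/orP; left; apply/eqP; congr (`|_|).
    by apply: J_eq => // t _; rewrite mul1r.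
  - apply: sqsZ; apply: sqs_le (sqs_fourier_int cec ec1 ec_orth I1 I12) => n.
    rewrite le_eqVlt; apply/orP; left; apply/eqP; congr (`|_|).
    by apply: J_eq => // t _; rewrite mul1r.
  - by apply: sqsZ; exact: sqs_harmonic.
have sF x : 0 <= x <= pi -> sqs (fun n => F n x).
  move=> xI; apply: sqsD => //; apply: sqsD.
    by apply: sqs_le (sqs_fourier ces es1 es_orth xI) => n; rewrite normr_id.
  by apply: sqs_le (sqs_fourier cec ec1 ec_orth xI) => n; rewrite normr_id.
apply: sqsD; first exact: sF.
apply: sqsZ.
have s1 := sqs_fourier_int ces es1 es_orth Ias Ias2.
have s2 := sqs_fourier_int cec ec1 ec_orth Ias Ias2.
apply: sqs_le (sqsZ 2 (sqsD (sqsD s1 s2) (sqsZ (J pi (fun t => `|s t|)) sK))) => n.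
rewrite le_eqVlt; apply/orP; left; apply/eqP; congr (`|_|).
rewrite (@J_eq _ _ (fun t => 2 * (`|s t| * `|a n t| + `|s t| * `|b n t| + K n * `|s t|)))//; last first.
  by move=> t _; rewrite /F; ring.
have I2 := ItgD (Jsa n) (Jsb n); have I3 := ItgZ (K n) Ias.
have p0 := in0pi_pi R.
by rewrite (JZ 2 p0 (ItgD I2 I3)) (JD p0 I2 I3) (JD p0 (Jsa n) (Jsb n)) (JZ (K n) p0 Ias) (mulrC (K n)).
Qed.

Lemma angle_asymptotics : exists d : nat -> R, sqs d /\
  forall n (rho : R) th, (2 <= n)%N -> `|rho - n%:R| <= 1 ->
    pruefer s (rho ^+ 2) th -> sin (th 0) * cos (th 0) = 0 ->
    `|hmod rho (th pi) - th 0 - rho * pi| <= d n.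
Proof. by exists d; split; [exact: sqs_dev | exact: angle_dev]. Qed.

End AngleAsymptotics.

(** * Counting eigenvalues *)

Section Cotangent.
Variable R : realType.
Implicit Types (x y t u B : R).

(** At a multiple of pi the value is 0 by the convention for division; such angles add nothing to
    the sum and are tracked separately as poles. *)
Definition cot x : R := cos x / sin x.

Lemma sinDnpi (n : nat) y : sin (n%:R * pi + y) = (-1) ^+ n * sin y.
Proof. by rewrite mulr_natl addrC (alternatingn (@sinDpi R)). Qed.

Lemma cosDnpi (n : nat) y : cos (n%:R * pi + y) = (-1) ^+ n * cos y.
Proof. by rewrite mulr_natl addrC (alternatingn (@cosDpi R)). Qed.

Lemma cotDnpi (n : nat) y : cot (n%:R * pi + y) = cot y.
Proof. by rewrite /cot sinDnpi cosDnpi -mulf_div divff ?mul1r// signr_eq0. Qed.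

Lemma sinDnpi_eq0 (n : nat) y : (sin (n%:R * pi + y) == 0) = (sin y == 0).
Proof. by rewrite sinDnpi mulf_eq0 signr_eq0. Qed.

Lemma cotN y : cot (- y) = - cot y.
Proof. by rewrite /cot sinN cosN invrN mulrN. Qed.

Lemma cot_lt x y : 0 < x -> x < y -> y < pi -> cot y < cot x.
Proof.
move=> x0 xy ypi.
have sx : 0 < sin x by rewrite sin_gt0_pi// x0 (lt_trans xy).
have sy : 0 < sin y by rewrite sin_gt0_pi// ypi (lt_trans x0).
rewrite -subr_gt0.
have -> : cot x - cot y = sin (y - x) / (sin x * sin y).
  by rewrite /cot sinB; field; rewrite !gt_eqF.
by rewrite divr_gt0 ?mulr_gt0// sin_gt0_pi// subr_gt0 xy; lra.
Qed.

Lemma cot_atan B : cot (pi / 2 - atan B) = B.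
Proof.
rewrite /cot -opprB cosN sinN cosBpihalf sinBpihalf opprK.
exact: (atanK B).
Qed.

Lemma npi_split t : 0 <= t ->
  exists y, [/\ 0 <= y, y < pi & t = (npi t)%:R * pi + y].
Proof.
move=> t0; have : npi t == npi t by [].
rewrite npiP// => /andP[h1 h2].
exists (t - (npi t)%:R * pi); split; [lra | | ring].
by move: h2; rewrite -natr1 mulrDl mul1r; lra.
Qed.

Lemma npi_nat (n : nat) y : 0 <= y -> y < pi -> npi (n%:R * pi + y) = n.
Proof.
move=> y0 ypi; have n0 : 0 <= n%:R * pi :> R by rewrite mulr_ge0// pi_ge0.
apply/eqP; rewrite npiP; last exact: addr_ge0.
by rewrite -natr1 mulrDl mul1r; apply/andP; split; lra.
Qed.

Lemma sin_eq0_itv y : 0 <= y -> y < pi -> (sin y == 0) = (y == 0).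
Proof.
move=> y0 ypi; have [->|yn] := eqVneq y 0; first by rewrite sin0 eqxx.
by rewrite gt_eqF// sin_gt0_pi// ypi lt_def yn y0.
Qed.

Lemma npi_lt t u : 0 <= t -> t < u -> npi t = npi u -> sin t != 0 ->
  sin u != 0 /\ cot u < cot t.
Proof.
move=> t0 tu; have u0 : 0 <= u by exact: le_trans (ltW tu).
have [y [y0 ypi tE]] := npi_split t0; have [z [z0 zpi uE]] := npi_split u0.
move: tE uE; move: (npi u) => n tE uE E; rewrite E in tE.
move: tu; rewrite tE uE ltrD2l => yz.
rewrite !sinDnpi_eq0 !cotDnpi sin_eq0_itv// => yn.
have y0' : 0 < y by rewrite lt_def yn y0.
by rewrite sin_eq0_itv// gt_eqF ?(lt_trans y0')//; split => //; exact: cot_lt.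
Qed.

Lemma npi_mono t u : 0 <= t -> t <= u -> (npi t <= npi u)%N.
Proof.
by move=> t0 tu; apply: le_truncn; rewrite ler_pM2r// invr_gt0 pi_gt0.
Qed.

Lemma npi_near t : 0 <= t -> sin t != 0 -> exists2 d, 0 < d & forall u, `|u - t| < d ->
  npi u = npi t /\ sin u != 0.
Proof.
move=> t0; have [y [y0 ypi tE]] := npi_split t0.
rewrite tE sinDnpi_eq0 sin_eq0_itv// => yn; rewrite npi_nat//.
have y0' : 0 < y by rewrite lt_def yn y0.
exists (Num.min y (pi - y)); first by rewrite lt_min y0' subr_gt0.
move=> u; set n := npi t; pose v := u - n%:R * pi.
have uE : u = n%:R * pi + v by rewrite /v; ring.
rewrite uE (_ : _ + v - _ = v - y); last by ring.
rewrite lt_min !ltr_norml => /andP[/andP[h1 h2] /andP[h3 h4]].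
have v0 : 0 < v by lra.
rewrite npi_nat ?(ltW v0)//; last by lra.
by split => //; rewrite sinDnpi_eq0 sin_eq0_itv ?(ltW v0)//; [rewrite gt_eqF | lra].
Qed.

Lemma cot_near t e : sin t != 0 -> 0 < e -> exists2 d, 0 < d & forall u, `|u - t| < d ->
  `|cot u - cot t| < e.
Proof.
move=> s0 e0.
have : cot @ t --> cot t.
  by apply: cvgM; [exact: continuous_cos | apply: cvgV => //; exact: continuous_sin].
move=> /cvgrPdist_lt /(_ e e0) [d /= d0 H]; exists d => // u ut.
by rewrite distrC; apply: H; rewrite /= distrC.
Qed.

Lemma pole_right t B : 0 <= t -> sin t = 0 -> exists2 d, 0 < d & forall u, t < u -> u < t + d ->
  [/\ npi u = npi t, sin u != 0 & B <= cot u].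
Proof.
move=> t0 /eqP; have [y [y0 ypi tE]] := npi_split t0.
rewrite tE sinDnpi_eq0 sin_eq0_itv// => /eqP {y0 ypi tE}->.
rewrite npi_nat ?pi_gt0// addr0; set n := npi t.
have a1 := atan_gtNpi2 B; have a2 := atan_ltpi2 B.
(* The point of (0, pi) at which cot takes the value B. *)
exists (pi / 2 - atan B); first by lra.
move=> u; pose v := u - n%:R * pi.
have uE : u = n%:R * pi + v by rewrite /v; ring.
rewrite uE => h1 h2.
have v0 : 0 < v by lra.
have vp : v < pi / 2 - atan B by lra.
have vpi : v < pi by lra.
rewrite npi_nat ?(ltW v0)// sinDnpi_eq0 sin_eq0_itv ?(ltW v0)// gt_eqF// cotDnpi.
split => //; rewrite -{1}(cot_atan B); apply: ltW; apply: cot_lt => //; lra.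
Qed.

(** Left of a multiple of pi the floor is smaller by one, in contrast to [pole_right]; t > 0
    excludes the multiple 0, below which [npi] does not drop. *)
Lemma pole_left t B : 0 < t -> sin t = 0 -> exists2 d, 0 < d & forall u, u < t -> t - d < u ->
  [/\ (npi u).+1 = npi t, sin u != 0 & cot u <= - B].
Proof.
move=> t0' /eqP; have t0 := ltW t0'; have [y [y0 ypi tE]] := npi_split t0.
rewrite tE sinDnpi_eq0 sin_eq0_itv// => /eqP yE; move: tE; rewrite yE {y0 ypi y yE} addr0.
case: (npi t) => [|n] tE; first by rewrite tE mul0r ltxx in t0'.
have := @npi_nat n.+1 0 (lexx _) (pi_gt0 R); rewrite addr0 => ->.
have a1 := atan_gtNpi2 B; have a2 := atan_ltpi2 B.
exists (pi / 2 - atan B); first by lra.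
move=> u h1 h2.
pose v := u - n%:R * pi.
have uE : u = n%:R * pi + v by rewrite /v; ring.
move: h1 h2; rewrite uE -natr1 mulrDl mul1r => h1 h2.
have v0 : 0 < v by lra.
have vpi : v < pi by lra.
rewrite npi_nat ?(ltW v0)// sinDnpi_eq0 sin_eq0_itv ?(ltW v0)// gt_eqF// cotDnpi.
split => //.
have -> : cot v = - cot (pi - v).
  by rewrite -cotN opprB -(cotDnpi 1 (v - pi)) mul1r; congr cot; ring.
rewrite lerN2 -{1}(cot_atan B); apply: ltW; apply: cot_lt; lra.
Qed.

End Cotangent.

(** * The counting function: monotonicity, right continuity and jumps *)

Section Counting.
Variables (R : realType) (m : nat) (T : 'I_m -> R -> R).
Hypothesis m_gt0 : (0 < m)%N.
Hypothesis Tinc : forall j l l', l < l' -> T j l < T j l'.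
Hypothesis Tcont : forall j, continuous (T j).
Hypothesis Tpos : forall j l, 0 < T j l.
Implicit Types (l a x : R).

Definition poles l := [set j | sin (T j l) == 0]%SET.
Definition cotsum l := \sum_j cot (T j l).
Definition npoles l := (\sum_j npi (T j l))%N.
(* The number of eigenvalues <= l; mult l is its jump at l. *)
Definition Ecount l := (npoles l + ((poles l == finset.set0) && (cotsum l <= 0)%R))%N.
Definition mult l := if poles l == finset.set0 then nat_of_bool (cotsum l == 0) else #|poles l|.-1.

Let Tge0 j l : 0 <= T j l. Proof. exact: ltW. Qed.

Let Tle j l l' : l <= l' -> T j l <= T j l'.
Proof. by rewrite le_eqVlt => /orP[/eqP ->//|/(Tinc j)/ltW]. Qed.

Lemma npoles_mono l l' : l <= l' -> (npoles l <= npoles l')%N.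
Proof. by move=> ll'; apply: leq_sum => j _; apply: npi_mono => //; exact: Tle. Qed.

Lemma no_pole j l : poles l = finset.set0 -> sin (T j l) != 0.
Proof. by move=> P0; have := congr1 (fun A : {set _} => j \in A) P0; rewrite !inE => ->. Qed.

Lemma poles_eq0 l : (forall j, sin (T j l) != 0) -> poles l = finset.set0.
Proof. by move=> H; apply/setP => j; rewrite !inE; exact/negbTE. Qed.

(** Each floor is monotone in lambda, so equality of the sums forces equality edge by edge. No angle
    reaches a multiple of pi on the way, and every cotangent decreases. *)
Lemma same_npoles l l' : l < l' -> npoles l = npoles l' -> poles l = finset.set0 ->
  poles l' = finset.set0 /\ cotsum l' < cotsum l.
Proof.
move=> ll' E P0.
have Ej j : npi (T j l) = npi (T j l').
  apply/eqP; move: E => /eqP; rewrite eq_sym /npoles => E.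
  have := leqif_sum (fun i (_ : true) => leqif_eq (npi_mono (Tge0 i l) (ltW (Tinc i ll')))).
  move=> [_ ]; rewrite eq_sym E => /esym/forallP /(_ j) /=; exact.
have H j := npi_lt (Tge0 j l) (Tinc j ll') (Ej j) (no_pole j P0).
split; first by apply: poles_eq0 => j; case: (H j).
apply: ltr_sum; last by move=> j _; case: (H j).
by apply/hasP; exists (Ordinal m_gt0); rewrite ?mem_index_enum.
Qed.

(** While the floors stay the same, the sum of cotangents decreases and the indicator can only
    switch on. If the indicator switches off, a floor has risen, which compensates for it. *)
Lemma Ecount_mono l l' : l <= l' -> (Ecount l <= Ecount l')%N.
Proof.
rewrite le_eqVlt => /orP[/eqP ->//|ll'].
have := npoles_mono (ltW ll'); rewrite leq_eqVlt => /orP[/eqP E|lt].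
  rewrite /Ecount E leq_add2l; case: eqVneq => //= P0.
  have [P0' ltM] := same_npoles ll' E P0.
  rewrite P0' eqxx /=; case: (leP (cotsum l) 0) => //= M0.
  by rewrite (ltW (lt_le_trans ltM M0)).
rewrite /Ecount; apply: (@leq_trans (npoles l).+1); last by rewrite (leq_trans lt)// leq_addr.
by rewrite -addn1 leq_add2l leq_b1.
Qed.

Let nearT j a d : 0 < d -> \forall x \near a, `|T j x - T j a| < d.
Proof.
move=> d0; have /cvgrPdist_lt /(_ d d0) := @Tcont j a.
by apply: filterS => x; rewrite distrC.
Qed.

(* Each pole contributes at least K to |cot|, the other terms move by less than 1,
   and K exceeds the total of the latter. *)
Let K a := \sum_j (`|cot (T j a)| + 1) + 1.

Let K_ge0 a : 0 <= K a.
Proof. by rewrite /K addr_ge0// sumr_ge0// => i _; rewrite addr_ge0. Qed.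

Let K_sum (c : 'I_m -> R) a j0 : (forall j, - (`|cot (T j a)| + 1) <= c j) -> K a <= c j0 ->
  0 < \sum_j c j.
Proof.
move=> cl c0.
have -> : \sum_j c j = c j0 + \sum_(j | j != j0) c j by rewrite (bigD1 j0).
have h : - \sum_(j | j != j0) (`|cot (T j a)| + 1) <= \sum_(j | j != j0) c j.
  by rewrite -sumrN; apply: ler_sum => j _.
have KE : K a = `|cot (T j0 a)| + 1 + \sum_(j | j != j0) (`|cot (T j a)| + 1) + 1.
  by rewrite /K (bigD1 j0).
have := normr_ge0 (cot (T j0 a)); move: c0 h; rewrite KE.
lra.
Qed.

(** Angles increase and the floor is right-continuous. Just beyond a pole its cotangent exceeds
    [K a] and outweighs all other terms. *)
Lemma near_right a : \forall x \near a^'+, npoles x = npoles a /\ poles x = finset.set0 /\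
  (poles a != finset.set0 -> 0 < cotsum x).
Proof.
have H j : \forall x \near a^'+, [/\ npi (T j x) = npi (T j a), sin (T j x) != 0,
    - (`|cot (T j a)| + 1) <= cot (T j x) & (sin (T j a) = 0 -> K a <= cot (T j x))].
  have [s0|s0] := eqVneq (sin (T j a)) 0.
    have [d d0 Hd] := pole_right (K a) (Tge0 j a) s0.
    near=> x.
    have ax : a < x by near: x; exact: nbhs_right_gt.
    have xd : `|T j x - T j a| < d by near: x; apply: cvg_within; exact: nearT.
    have [||? ? ?] := Hd (T j x); first exact: Tinc.
      by move: xd; rewrite ltr_norml => /andP[_]; lra.
    split => //; rewrite (le_trans _ (_ : K a <= _))//.
    by rewrite (@le_trans _ _ 0) ?K_ge0// oppr_le0 addr_ge0.
  have [d d0 Hd] := npi_near (Tge0 j a) s0.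
  have [e e0 He] := cot_near s0 (ltr01 : 0 < 1 :> R).
  near=> x.
  have xd : `|T j x - T j a| < d by near: x; apply: cvg_within; exact: nearT.
  have xe : `|T j x - T j a| < e by near: x; apply: cvg_within; exact: nearT.
  have [? ?] := Hd _ xd; split => //; last by move=> s1; rewrite s1 eqxx in s0.
  have := He _ xe; have := ler_norm (- cot (T j a)); rewrite normrN ltr_norml => ? /andP[]; lra.
have HH := filter_forall (at_right_proper_filter a) H.
near=> x.
have {}H : forall j, [/\ npi (T j x) = npi (T j a), sin (T j x) != 0,
    - (`|cot (T j a)| + 1) <= cot (T j x) & (sin (T j a) = 0 -> K a <= cot (T j x))].
  by near: x; exact: HH.
split; first by apply: eq_bigr => j _; case: (H j).
split; first by apply: poles_eq0 => j; case: (H j).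
move=> /set0Pn[j0]; rewrite inE => /eqP s0.
apply: (@K_sum _ a j0); first by move=> j; case: (H j).
by case: (H j0) => _ _ _; apply.
Unshelve. all: by end_near. Qed.

Lemma near_left a : \forall x \near a^'-, (npoles x + #|poles a|)%N = npoles a /\
  poles x = finset.set0 /\ (poles a != finset.set0 -> cotsum x < 0).
Proof.
have H j : \forall x \near a^'-, [/\ (npi (T j x) + (sin (T j a) == 0%R))%N = npi (T j a),
    sin (T j x) != 0,
    - (`|cot (T j a)| + 1) <= - cot (T j x) & (sin (T j a) = 0 -> K a <= - cot (T j x))].
  have [s0|s0] := eqVneq (sin (T j a)) 0.
    have [d d0 Hd] := pole_left (K a) (Tpos j a) s0.
    near=> x.
    have ax : x < a by near: x; exact: nbhs_left_lt.
    have xd : `|T j x - T j a| < d by near: x; apply: cvg_within; exact: nearT.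
    have [||? ? ?] := Hd (T j x); first exact: Tinc.
      by move: xd; rewrite ltr_norml => /andP[+ _]; lra.
    have KK : K a <= - cot (T j x) by rewrite lerNr.
    split => //; first by rewrite addn1.
    rewrite (le_trans _ KK)//.
    by rewrite (@le_trans _ _ 0) ?K_ge0// oppr_le0 addr_ge0.
  have [d d0 Hd] := npi_near (Tge0 j a) s0.
  have [e e0 He] := cot_near s0 (ltr01 : 0 < 1 :> R).
  near=> x.
  have xd : `|T j x - T j a| < d by near: x; apply: cvg_within; exact: nearT.
  have xe : `|T j x - T j a| < e by near: x; apply: cvg_within; exact: nearT.
  have [? ?] := Hd _ xd; split => //; [by rewrite addn0 | | by move=> s1; rewrite s1 eqxx in s0].
  have := He _ xe; have := ler_norm (cot (T j a)); rewrite ltr_norml => ? /andP[]; lra.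
have HH := filter_forall (at_left_proper_filter a) H.
near=> x.
have {}H : forall j, [/\ (npi (T j x) + (sin (T j a) == 0%R))%N = npi (T j a), sin (T j x) != 0,
    - (`|cot (T j a)| + 1) <= - cot (T j x) & (sin (T j a) = 0 -> K a <= - cot (T j x))].
  by near: x; exact: HH.
split.
  rewrite -sum1_card /npoles [X in (_ + X)%N]big_mkcond -big_split; apply: eq_bigr => j _ /=.
  by case: (H j) => <- _ _ _; rewrite inE; case: (_ == _).
split; first by apply: poles_eq0 => j; case: (H j).
move=> /set0Pn[j0]; rewrite inE => /eqP s0.
rewrite -oppr_gt0 -sumrN; apply: (@K_sum _ a j0); first by move=> j; case: (H j).
by case: (H j0) => _ _ _; apply.
Unshelve. all: by end_near. Qed.

Lemma cotsum_near a e : poles a = finset.set0 -> 0 < e ->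
  \forall x \near a, `|cotsum x - cotsum a| < e.
Proof.
move=> P0 e0.
have : cotsum @ a --> cotsum a.
  apply: cvg_big => [|j _]; first exact: add_continuous.
  apply: (@cvg_comp _ _ _ (T j) (@cot R) _ (nbhs (T j a))); first exact: Tcont.
  apply: cvgM; [exact: continuous_cos | apply: cvgV; [exact: no_pole | exact: continuous_sin]].
by move=> /cvgrPdist_lt /(_ e e0); apply: filterS => x; rewrite distrC.
Qed.

Let cotsum_sign a : \forall x \near a, poles a = finset.set0 -> cotsum a != 0 ->
  `|cotsum x - cotsum a| < `|cotsum a|.
Proof.
have [P0|P0] := eqVneq (poles a) finset.set0; last first.
  by apply: filterE => x P0'; rewrite P0' eqxx in P0.
have [M0|M0] := eqVneq (cotsum a) 0; first by apply: filterE => x _.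
have M0' : 0 < `|cotsum a| by rewrite normr_gt0.
have := cotsum_near P0 M0'.
by apply: filterS => x h _ _.
Qed.

Lemma Ecount_right a : \forall x \near a^'+, Ecount x = Ecount a.
Proof.
near=> x.
have [E [Px H]] : npoles x = npoles a /\ poles x = finset.set0 /\
  (poles a != finset.set0 -> 0 < cotsum x) by near: x; exact: near_right.
have ax : a < x by near: x; exact: nbhs_right_gt.
have HM : poles a = finset.set0 -> cotsum a != 0 -> `|cotsum x - cotsum a| < `|cotsum a|.
  by near: x; apply: cvg_within; exact: cotsum_sign.
rewrite /Ecount E Px eqxx /=; congr addn; congr nat_of_bool.
have [P0|P0] := eqVneq (poles a) finset.set0; last by rewrite leNgt H.
rewrite /=; have [M0|M0] := leP (cotsum a) 0.
  have [_ ltM] := same_npoles ax (esym E) P0.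
  by rewrite (ltW (lt_le_trans ltM M0)).
have := HM P0; rewrite gt_eqF// (gtr0_norm M0) => /(_ isT).
by rewrite ltr_norml => /andP[h _]; apply/negbTE; rewrite -ltNge; lra.
Unshelve. all: by end_near. Qed.

(** At d > 0 poles the floors gain d in total, while the indicator goes from on (the sum tends to
    minus infinity) to off: the jump is d - 1. Away from poles the jump is the indicator switching
    on at a zero of the sum. *)
Lemma Ecount_left a : \forall x \near a^'-, (Ecount x + mult a)%N = Ecount a.
Proof.
near=> x.
have [E [Px H]] : (npoles x + #|poles a|)%N = npoles a /\
  poles x = finset.set0 /\ (poles a != finset.set0 -> cotsum x < 0) by near: x; exact: near_left.
have ax : x < a by near: x; exact: nbhs_left_lt.
have HM : poles a = finset.set0 -> cotsum a != 0 -> `|cotsum x - cotsum a| < `|cotsum a|.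
  by near: x; apply: cvg_within; exact: cotsum_sign.
rewrite /Ecount /mult -E Px eqxx /=.
have [P0|P0] := eqVneq (poles a) finset.set0; last first.
  rewrite (ltW (H P0)) /= addn0 -addnA add1n prednK// card_gt0//.
rewrite /= P0 cards0 addn0 in E *; rewrite -addnA; congr addn.
have [_ ltM] := same_npoles ax E Px.
have [M0|M0|M0] := ltgtP (cotsum a) 0.
- have := HM P0; rewrite lt_eqF// (ltr0_norm M0) => /(_ isT).
  rewrite ltr_norml => /andP[_ h]; rewrite addn0 (_ : cotsum x <= 0)//.
  lra.
- by rewrite addn0 leNgt (lt_trans M0 ltM).
- by rewrite leNgt -M0 ltM.
Unshelve. all: by end_near. Qed.

End Counting.

(** * Enumeration of the jumps of an integer-valued step function *)

Section Enumeration.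
Variables (R : realType) (E mu : R -> nat).
Hypothesis Emono : forall x y, x <= y -> (E x <= E y)%N.
Hypothesis Eright : forall a, \forall x \near a^'+, E x = E a.
Hypothesis Eleft : forall a, \forall x \near a^'-, (E x + mu a)%N = E a.
Hypothesis Elow : exists l, E l = 0%N.
Hypothesis Eunb : forall q, exists l, (q < E l)%N.

(** Generalised inverse of the counting function: the eigenvalue of index q, counted from 0. Right
    continuity of E makes the infimum attained. *)
Definition level (q : nat) : R := inf [set x | (q < E x)%N].

Lemma level_le q x : (level q <= x) = (q < E x)%N.
Proof.
have [l0 El0] := Elow; have [l1 El1] := Eunb q.
pose S := [set x | (q < E x)%N].
have lbS : lbound S l0.
  move=> y /= qy; rewrite leNgt; apply/negP => /ltW /Emono.
  by rewrite El0 => Ey; have := leq_trans qy Ey; rewrite ltn0.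
have hS : has_inf S by split; [exists l1 | exists l0].
apply/idP/idP => [|qx]; last by apply: ge_inf => //; case: hS.
move=> lx; apply: leq_trans (Emono lx).
have := Eright (level q).
rewrite near_withinE => -[d /= d0 Hd].
have [y qy yd] := inf_adherent d0 hS.
have : level q <= y by apply: ge_inf => //; case: hS.
rewrite le_eqVlt => /orP[/eqP -> //|ly].
rewrite -(Hd y)//= distrC ger0_norm ?subr_ge0 ?(ltW ly)//.
by rewrite ltrBlDl.
Qed.

(** The indices attached to a are those with E(a-) <= q < E(a), where E(a-) = E a - mu a; hence a
    occurs exactly mu a times. *)
Lemma level_eq q a : (level q == a) = (E a <= q + mu a)%N && (q < E a)%N.
Proof.
rewrite eq_le level_le andbC; congr andb.
have := Eleft a; rewrite near_withinE => -[d /= d0 Hd].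
have near x : a - d < x -> x < a -> (E x + mu a)%N = E a.
  move=> dx xa; apply: Hd => //=; rewrite ger0_norm ?subr_ge0 ?(ltW xa)//; lra.
pose x0 := a - d / 2.
have x0E : (E x0 + mu a)%N = E a by apply: near; rewrite /x0; lra.
rewrite -x0E leq_add2r leqNgt -level_le -ltNge.
apply/idP/idP => [h|h]; first by apply: lt_le_trans h; rewrite /x0; lra.
rewrite leNgt; apply/negP => la.
have dl : a - d < level q by apply: lt_trans h; rewrite /x0; lra.
have := near _ dl la; rewrite -x0E => /eqP; rewrite eqn_add2r => /eqP El.
by have := level_le q (level q); rewrite lexx El -level_le leNgt h.
Qed.

Lemma mult_le a : (mu a <= E a)%N.
Proof.
have := Eleft a; rewrite near_withinE => -[d /= d0 Hd].
rewrite -(Hd (a - d / 2)) ?leq_addl//=; last by lra.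
by rewrite opprB addrC subrK ger0_norm; lra.
Qed.

End Enumeration.

(** * Linear algebra of the matching conditions at a fixed real lambda *)

Section MatchingBasis.
Variables (R : realType) (m : nat) (r t : 'I_m -> R).
Hypothesis m_gt0 : (0 < m)%N.
Hypothesis r_gt0 : forall j, 0 < r j.
Implicit Types (c : 'I_m -> R) (j : 'I_m).

Let eta j := r j * sin (t j).
Let zeta j := r j * cos (t j).

(* The functions c j * y_j, with y_j(pi) = r j sin (t j) and y_j^[1](pi) = r j cos (t j),
   satisfy the matching conditions. *)
Definition matched c := (forall i j, c i * eta i = c j * eta j) /\ \sum_j c j * zeta j = 0.

Definition angle_poles := [set j | sin (t j) == 0]%SET.
Definition angle_mult := if angle_poles == finset.set0
  then nat_of_bool (\sum_j cot (t j) == 0) else #|angle_poles|.-1.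

(** Without poles the common vertex value determines c, and the derivative condition says that this
    value times the sum of cotangents is 0. With a pole j0 the common value is 0, so c lives on the
    poles and is subject to a single linear equation. Only the vectors [B i] with i below the
    multiplicity matter. *)
Lemma matching_basis : exists B : nat -> 'I_m -> R,
  [/\ forall i, (i < angle_mult)%N -> matched (B i),
      forall c, matched c -> exists al : nat -> R, forall j,
        c j = \sum_(i < angle_mult) al i * B i j &
      forall al : nat -> R, (forall j, \sum_(i < angle_mult) al i * B i j = 0) ->
        forall i, (i < angle_mult)%N -> al i = 0].
Proof.
rewrite /angle_mult; case: ifPn => [/eqP P0|/set0Pn[j0 j0P]].
  have s0 j : sin (t j) != 0.
    by have := congr1 (fun A : {set _} => j \in A) P0; rewrite !inE => ->.
  have e0 j : eta j != 0 by rewrite mulf_neq0// gt_eqF.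
  have cE j : cot (t j) = (eta j)^-1 * zeta j.
    by rewrite /cot /eta /zeta; field; rewrite s0 gt_eqF.
  pose j1 := Ordinal m_gt0.
  have uni c : matched c -> forall j, c j = c j1 * eta j1 * (eta j)^-1.
    by move=> [h _] j; rewrite (h j1 j) mulfK.
  (* The coefficients for which every edge has the value 1 at the inner vertex. *)
  exists (fun _ j => (eta j)^-1).
  case: eqVneq => [M0|M0]; split => //.
  - move=> i _; split; first by move=> i' j; rewrite !mulVf.
    by rewrite -[RHS]M0; apply: eq_bigr => j _; rewrite cE.
  - by move=> c /uni h; exists (fun=> c j1 * eta j1) => j; rewrite big_ord1 h.
  - move=> al H [|//] _; have := H j1; rewrite big_ord1 => /eqP.
    by rewrite mulf_eq0 invr_eq0 (negbTE (e0 j1)) orbF => /eqP.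
  - move=> c hc; exists (fun=> 0) => j; rewrite big_ord0 (uni c hc j).
    case: (hc) => _; under eq_bigr do rewrite (uni c hc) -mulrA -cE.
    rewrite -mulr_sumr => /eqP; rewrite mulf_eq0 (negbTE M0) orbF => /eqP ->.
    by rewrite mul0r.
have z0 j : j \in angle_poles -> zeta j != 0.
  rewrite inE => /eqP s0; rewrite mulf_neq0 ?(gt_eqF (r_gt0 j))//.
  by apply/eqP => c0; have := cos2Dsin2 (t j); rewrite c0 s0 expr0n addr0 => /eqP; rewrite eq_sym oner_eq0.
have eta0 j : j \in angle_poles -> eta j = 0 by rewrite inE /eta => /eqP ->; rewrite mulr0.
have etan0 j : j \notin angle_poles -> eta j != 0.
  by rewrite inE /eta => sj; rewrite mulf_neq0// gt_eqF.
pose sq := enum (angle_poles :\ j0).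
have g_size : #|angle_poles|.-1 = size sq by rewrite -cardE (cardsD1 j0) j0P.
have usq : uniq sq by exact: enum_uniq.
have memsq j : (j \in sq) = (j != j0) && (j \in angle_poles) by rewrite mem_enum !inE.
rewrite g_size.
pose e i := nth j0 sq i.
have eP i : (i < size sq)%N -> e i != j0 /\ e i \in angle_poles.
  by move=> /(mem_nth j0); rewrite memsq => /andP.
have sumsq (F : 'I_m -> R) : \sum_(i < size sq) F (e i) = \sum_(j in angle_poles :\ j0) F j.
  by rewrite -[RHS]big_enum /= -/sq (big_nth j0) big_mkord.
(* Supported on one further pole and on j0, with quasi-derivatives 1 and -1 at the inner vertex. *)
exists (fun i j => (j == e i)%:R / zeta (e i) - (j == j0)%:R / zeta j0); split.
- move=> i /eP[ej0 eP0]; split.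
    have h j : ((j == e i)%:R / zeta (e i) - (j == j0)%:R / zeta j0) * eta j = 0.
      have [jP|jP] := boolP (j \in angle_poles); first by rewrite eta0 ?mulr0.
      have -> : (j == e i) = false by apply/negbTE; apply: contraNneq jP => ->.
      have -> : (j == j0) = false by apply/negbTE; apply: contraNneq jP => ->.
      by rewrite !mul0r subr0 mul0r.
    by move=> j j'; rewrite !h.
  have one k : k \in angle_poles -> \sum_j (j == k)%:R / zeta k * zeta j = 1.
    move=> kP; rewrite (bigD1 k)//= eqxx big1 ?addr0; first by rewrite mul1r mulVf ?z0.
    by move=> j /negbTE ->; rewrite !mul0r.
  under eq_bigr do rewrite mulrBl.
  by rewrite big_split /= sumrN !one// subrr.
- move=> c [ceta czeta].
  have c0 j : j \notin angle_poles -> c j = 0.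
    move=> jP; have := ceta j j0; rewrite (eta0 j0)// mulr0 => /eqP.
    by rewrite mulf_eq0 (negbTE (etan0 _ jP)) orbF => /eqP.
  exists (fun i => c (e i) * zeta (e i)) => j.
  rewrite (sumsq (fun k => c k * zeta k * ((j == k)%:R / zeta k - (j == j0)%:R / zeta j0))).
  have [->|jj0] := eqVneq j j0.
    rewrite (eq_bigr (fun k => c k * zeta k * (- (zeta j0)^-1))); last first.
      by move=> k; rewrite !inE => /andP[/negbTE kj0 _]; rewrite eq_sym kj0 mul0r mul1r sub0r.
    rewrite -mulr_suml.
    have := czeta; rewrite (bigID (mem angle_poles)) /= [X in _ + X]big1; last first.
      by move=> k /c0 ->; rewrite mul0r.
    rewrite addr0 (big_setD1 j0)//= => /eqP; rewrite addr_eq0 => /eqP h.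
    by rewrite mulrN -mulNr -h mulfK ?z0.
  under eq_bigr do rewrite mul0r subr0.
  have [jP|jP] := boolP (j \in angle_poles); last first.
    rewrite c0// big1// => k; rewrite !inE => /andP[_ kP].
    have -> : (j == k) = false by apply/negbTE; apply: contraNneq jP => ->; rewrite inE.
    by rewrite mul0r mulr0.
  rewrite (bigD1 j) /=; last by rewrite in_setD1 jj0.
  rewrite eqxx big1 ?addr0; first by rewrite mul1r mulfK ?z0.
  by move=> k /andP[_ /negbTE kj]; rewrite eq_sym kj mul0r mulr0.
- move=> al H i isq; have [ej0 eP0] := eP i isq.
  have := H (e i); rewrite (bigD1 (Ordinal isq))//= eqxx (negbTE ej0) big1 ?addr0.
    by rewrite mul0r subr0 mul1r => /eqP; rewrite mulf_eq0 invr_eq0 (negbTE (z0 _ eP0)) orbF => /eqP.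
  move=> k ki; rewrite /e nth_uniq// eq_sym.
  have -> : (val k == i) = false by apply/negbTE; apply: contraNneq ki => h; apply/eqP/val_inj.
  by rewrite !mul0r subr0 mulr0.
Qed.

End MatchingBasis.

(** * Passage between double indices and consecutive indices *)

Section Reindexing.
Variable (V : nmodType).

(** An injection of ['I_m] into itself is a permutation, so every block of m consecutive indices is
    met exactly once. *)
Lemma sum_rows (m N : nat) (rk : 'I_m -> 'I_m) (H : nat -> V) : injective rk ->
  \sum_(n < N) \sum_(k < m) H (n * m + rk k)%N = \sum_(q < N * m) H q.
Proof.
move=> rkI; elim: N => [|N IH]; first by rewrite !big_ord0.
rewrite big_ord_recr /= IH -!(big_mkord xpredT) mulSn addnC.
rewrite (big_cat_nat _ (leq_addr m (N * m))) //=; congr (_ + _).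
have -> : \sum_(N * m <= i < N * m + m) H i = \sum_(0 <= i < m) H (i + N * m)%N.
  by rewrite -{1}[(N * m)%N]add0n big_addn addKn.
rewrite big_mkord.
rewrite [RHS](reindex_inj rkI) /=.
by apply: eq_bigr => k _; rewrite addnC.
Qed.

Lemma sum_window (b g M : nat) (H : nat -> V) : (b + g <= M)%N ->
  \sum_(q < M | (b <= q)%N && (q < b + g)%N) H q = \sum_(i < g) H (b + i)%N.
Proof.
move=> bgM; rewrite -(big_mkord (fun q => (b <= q)%N && (q < b + g)%N)).
rewrite (big_cat_nat _ (leq_trans (leq_addr g b) bgM))//= big_nat_cond big1; last first.
  by move=> q /andP[/andP[_ h] /andP[]]; rewrite leqNgt h.
rewrite add0r (big_cat_nat (leq_addr g b) bgM)//= [X in _ + X]big_nat_cond [X in _ + X]big1; last first.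
  by move=> q /andP[/andP[h _] /andP[_]]; rewrite ltnNge h.
rewrite addr0 -{1}[b]add0n big_addn addKn big_mkord.
apply: eq_big => [i|i _]; last by rewrite addnC.
by rewrite leq_addl addnC ltn_add2l ltn_ord.
Qed.

End Reindexing.

(** * The counting function slightly above and below an expected position *)

Section CountingAsymptotics.
Variables (R : realType) (m p : nat) (T : 'I_m -> R -> R).
Hypothesis p_gt0 : (0 < p)%N.
Hypothesis p_lt : (p < m)%N.
Hypothesis Tpos : forall j l, 0 < T j l.

(** All remainders lie strictly inside (0, pi), so there are no poles; [hmod] preserves the floors,
    and the sum of cotangents is rho times that of the remainders. *)
Lemma Ecount_at (rho : R) (A : 'I_m -> nat) (y : 'I_m -> R) : 0 < rho ->
  (forall j, hmod rho (T j (rho ^+ 2)) = (A j)%:R * pi + y j) ->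
  (forall j, 0 < y j < pi) ->
  Ecount T (rho ^+ 2) = (\sum_j A j + (\sum_j cot (y j) <= 0)%R)%N.
Proof.
move=> r0 hE yI.
have h j := hmod_npi r0 (ltW (Tpos j (rho ^+ 2))).
have s0 j : sin (T j (rho ^+ 2)) != 0.
  have [<- _] := hmod_cot (T j (rho ^+ 2)) r0.
  have /andP[y0 ypi] := yI j.
  by rewrite hE sinDnpi_eq0 sin_eq0_itv ?(ltW y0)// gt_eqF.
rewrite /Ecount (poles_eq0 s0) eqxx /=; congr addn.
  apply: eq_bigr => j _; have [_ <-] := h j; have /andP[y0 ypi] := yI j.
  by rewrite hE npi_nat// ltW.
congr nat_of_bool.
have -> : cotsum T (rho ^+ 2) = rho * \sum_j cot (y j).
  rewrite mulr_sumr; apply: eq_bigr => j _.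
  have [_ E] := hmod_cot (T j (rho ^+ 2)) r0.
  by rewrite -(cotDnpi (A j) (y j)) -hE /cot E.
by rewrite pmulr_rle0.
Qed.

Definition sel (V : Type) (a b : V) (j : 'I_m) := if (j < p)%N then a else b.

Lemma sum_sel (V : nmodType) (a b : V) : \sum_j sel a b j = a *+ p + b *+ (m - p).
Proof.
rewrite -(big_mkord xpredT (fun j => if (j < p)%N then a else b)).
rewrite (big_cat_nat (leq0n p) (ltnW p_lt)) /=; congr (_ + _).
  rewrite -[X in _ *+ X]subn0 -sumr_const_nat; apply: eq_big_nat => j /andP[_ ->] //.
rewrite -sumr_const_nat; apply: eq_big_nat => j /andP[pj _].
by rewrite ltnNge pj.
Qed.

Lemma sum_sel_nat (a b : nat) : (\sum_j sel a b j = p * a + (m - p) * b)%N.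
Proof.
rewrite -(big_mkord xpredT (fun j => if (j < p)%N then a else b)).
rewrite (big_cat_nat (leq0n p) (ltnW p_lt)) /=; congr addn.
  rewrite -[X in (X * _)%N]subn0 -sum_nat_const_nat; apply: eq_big_nat => j /andP[_ ->] //.
rewrite -sum_nat_const_nat; apply: eq_big_nat => j /andP[pj _].
by rewrite ltnNge pj.
Qed.

Variables (N : nat) (e : R).
Hypothesis e_gt0 : 0 < e.
Hypothesis dev : forall rho j, 0 < rho -> `|rho - N%:R| <= 1 ->
  `|hmod rho (T j (rho ^+ 2)) - sel (pi / 2) 0 j - rho * pi| <= e.

(** Shifting rho by e moves the expected angle by e pi, more than the possible deviation e; this
    decides on which side of the expected value the true angle lies. *)
Let e_lt : e < e * pi.
Proof. by rewrite ltr_pMr// (lt_le_trans _ (pi_ge2 R))// ltr1n. Qed.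

(* c is the expected position: there the Neumann (resp. Dirichlet) angles are
   A pi + bN (resp. B pi + bD). *)
Variables (c : R) (A B : nat) (bN bD : R).
Hypothesis cN : pi / 2 + c * pi = A%:R * pi + bN.
Hypothesis cD : c * pi = B%:R * pi + bD.

Let b := sel bN bD.
Let AB := sel A B.

Let ab j : sel (pi / 2) 0 j + c * pi = (AB j)%:R * pi + b j.
Proof. by rewrite /b /AB /sel; case: ifP => _; rewrite ?add0r. Qed.

Lemma Ecount_above : 0 < c + e -> `|c + e - N%:R| <= 1 ->
  0 <= bN -> bN + 2 * (e * pi) < pi -> 0 <= bD -> bD + 2 * (e * pi) < pi ->
  exists2 y, forall j, b j < y j < pi &
    Ecount T ((c + e) ^+ 2) = (p * A + (m - p) * B + (\sum_j cot (y j) <= 0)%R)%N.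
Proof.
move=> r0 rN bN0 bN1 bD0 bD1.
pose y j := hmod (c + e) (T j ((c + e) ^+ 2)) - (AB j)%:R * pi.
have yI j : b j < y j < pi.
  have := dev j r0 rN; rewrite (mulrDl c e pi) ler_norml => /andP[h1 h2].
  have := ab j; have : 0 <= b j /\ b j + 2 * (e * pi) < pi by rewrite /b /sel; case: ifP.
  have := e_lt; move: h1 h2; rewrite /y; move: (hmod _ _) (sel (pi / 2) 0 j) (c * pi) (e * pi).
  by move=> H s0 X E h1 h2 h3 [h4 h5] h6; apply/andP; split; lra.
exists y => //; rewrite (Ecount_at r0 (A := AB) (y := y)) ?sum_sel_nat//.
  by move=> j; rewrite /y; ring.
move=> j; have /andP[h1 ->] := yI j; rewrite andbT (le_lt_trans _ h1)//.
by rewrite /b /sel; case: ifP.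
Qed.

Lemma Ecount_below : 0 < c - e -> `|c - e - N%:R| <= 1 ->
  bN <= pi -> 2 * (e * pi) < bN -> bD <= pi -> 2 * (e * pi) < bD ->
  exists2 y, forall j, 0 < y j < b j &
    Ecount T ((c - e) ^+ 2) = (p * A + (m - p) * B + (\sum_j cot (y j) <= 0)%R)%N.
Proof.
move=> r0 rN bN0 bN1 bD0 bD1.
pose y j := hmod (c - e) (T j ((c - e) ^+ 2)) - (AB j)%:R * pi.
have yI j : 0 < y j < b j.
  have := dev j r0 rN; rewrite (mulrBl pi c e) ler_norml => /andP[h1 h2].
  have := ab j; have : b j <= pi /\ 2 * (e * pi) < b j by rewrite /b /sel; case: ifP.
  have := e_lt; move: h1 h2; rewrite /y; move: (hmod _ _) (sel (pi / 2) 0 j) (c * pi) (e * pi).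
  by move=> H s0 X E h1 h2 h3 [h4 h5] h6; apply/andP; split; lra.
exists y => //; rewrite (Ecount_at r0 (A := AB) (y := y)) ?sum_sel_nat//.
  by move=> j; rewrite /y; ring.
move=> j; have /andP[-> h1] := yI j; rewrite /= (lt_le_trans h1)//.
by rewrite /b /sel; case: ifP.
Qed.

Let m_gt0 : (0 < m)%N. Proof. exact: leq_ltn_trans p_lt. Qed.

Let sum_cot_lt (u v : 'I_m -> R) : (forall j, 0 < u j < v j /\ v j < pi) ->
  \sum_j cot (v j) < \sum_j cot (u j).
Proof.
move=> uv; apply: ltr_sum; first by apply/hasP; exists (Ordinal m_gt0); rewrite ?mem_index_enum.
by move=> j _; have [/andP[? ?] ?] := uv j; exact: cot_lt.
Qed.

Hypothesis balance : cot bN *+ p + cot bD *+ (m - p) = 0.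

Let sum_cot_b : \sum_j cot (b j) = 0.
Proof.
rewrite -[RHS]balance -(sum_sel (cot bN) (cot bD)); apply: eq_bigr => j _.
by rewrite /b /sel; case: ifP.
Qed.

(** At b the cotangents sum to 0 and the true remainders lie strictly to the right, so the sum is
    negative. Together with [Ecount_below_balanced] the window around c contains exactly one
    eigenvalue. *)
Lemma Ecount_above_balanced : 0 < c + e -> `|c + e - N%:R| <= 1 ->
  0 < bN -> bN + 2 * (e * pi) < pi -> 0 < bD -> bD + 2 * (e * pi) < pi ->
  Ecount T ((c + e) ^+ 2) = (p * A + (m - p) * B + 1)%N.
Proof.
move=> r0 rN bN0 bN1 bD0 bD1.
have [y yI ->] := Ecount_above r0 rN (ltW bN0) bN1 (ltW bD0) bD1.
rewrite (_ : (\sum_j _ <= 0)%R)// ltW// -[ltRHS]sum_cot_b.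
apply: sum_cot_lt => j; have /andP[-> ->] := yI j; split => //.
by rewrite andbT /b /sel; case: ifP.
Qed.

Lemma Ecount_below_balanced : 0 < c - e -> `|c - e - N%:R| <= 1 ->
  bN < pi -> 2 * (e * pi) < bN -> bD < pi -> 2 * (e * pi) < bD ->
  Ecount T ((c - e) ^+ 2) = (p * A + (m - p) * B)%N.
Proof.
move=> r0 rN bN0 bN1 bD0 bD1.
have [y yI ->] := Ecount_below r0 rN (ltW bN0) bN1 (ltW bD0) bD1.
rewrite (_ : (\sum_j _ <= 0)%R = false) ?addn0//; apply/negbTE; rewrite -ltNge -[ltLHS]sum_cot_b.
apply: sum_cot_lt => j; have /andP[-> ->] := yI j; split => //.
by rewrite /b /sel; case: ifP.
Qed.

End CountingAsymptotics.

(** * The angle alpha as a zero of the limiting sum of cotangents *)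

Section Alpha.
Variables (R : realType) (m p : nat).
Hypothesis p_gt0 : (0 < p)%N.
Hypothesis p_lt : (p < m)%N.
Let alpha : R := acos (Num.sqrt (p%:R / m%:R)).

Let m0 : 0 < m%:R :> R. Proof. by rewrite ltr0n (leq_ltn_trans _ p_lt). Qed.
Let p0 : 0 < p%:R :> R. Proof. by rewrite ltr0n. Qed.
Let q0 : 0 < Num.sqrt (p%:R / m%:R) :> R.
Proof. by rewrite sqrtr_gt0 divr_gt0. Qed.
Let q1 : Num.sqrt (p%:R / m%:R) < 1 :> R.
Proof.
rewrite -[ltRHS]sqrtr1 ltr_sqrt// ltr_pdivrMr// mul1r ltr_nat//.
Qed.
Let cosa : cos alpha = Num.sqrt (p%:R / m%:R).
Proof. by rewrite acosK// in_itv /= (ltW q1) andbT; have := q0; lra. Qed.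

Lemma alpha_gt0 : 0 < alpha.
Proof. by apply: acos_gt0; rewrite q1 andbT; have := q0; lra. Qed.

Lemma alpha_lt : alpha < pi / 2.
Proof.
have api : alpha <= pi by apply: acos_lepi; rewrite (ltW q1) andbT; have := q0; lra.
have p2 := pi_gt0 R.
have A1 : alpha \in `[0, pi] by rewrite in_itv /= api ltW// alpha_gt0.
have A2 : pi / 2 \in `[0, pi : R] by rewrite in_itv /=; apply/andP; split; lra.
by rewrite -(ltr_cos A1 A2) cos_pihalf cosa.
Qed.

Let bal : p%:R * sin alpha ^+ 2 = (m - p)%:R * cos alpha ^+ 2.
Proof.
rewrite sin2cos2 cosa sqr_sqrtr ?ltW ?divr_gt0// natrB ?(ltnW p_lt)//.
by field; rewrite gt_eqF.
Qed.

Let sa : sin alpha != 0.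
Proof.
rewrite gt_eqF// sin_gt0_pi// alpha_gt0 (lt_trans alpha_lt)//; have := pi_gt0 R; lra.
Qed.

Let ca : cos alpha != 0. Proof. by rewrite cosa gt_eqF. Qed.

(** At rho pi = n pi + alpha the limiting Neumann and Dirichlet angles are pi / 2 + alpha and alpha
    modulo pi; the identity amounts to p sin^2 alpha = (m - p) cos^2 alpha, that is cos^2 alpha = p
    / m. *)
Lemma balance_left : cot (pi / 2 + alpha) *+ p + cot alpha *+ (m - p) = 0.
Proof.
rewrite /cot [pi / 2 + _]addrC sinDpihalf cosDpihalf -[X in X + _]mulr_natl -[X in _ + X]mulr_natl.
apply: (mulIf (mulf_neq0 sa ca)); rewrite mul0r.
have -> : (p%:R * (- sin alpha / cos alpha) + (m - p)%:R * (cos alpha / sin alpha)) * (sin alpha * cos alpha) =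
  (m - p)%:R * cos alpha ^+ 2 - p%:R * sin alpha ^+ 2 by field; rewrite ca sa.
by rewrite bal subrr.
Qed.

(** Replacing every angle x in [balance_left] by pi - x changes the sign of each cotangent. *)
Lemma balance_right : cot (pi / 2 - alpha) *+ p + cot (pi - alpha) *+ (m - p) = 0.
Proof.
have := balance_left; rewrite -[pi / 2 + alpha]opprK cotN -(cotDnpi 1 (- (pi / 2 + alpha))) mul1r.
have -> : pi - (pi / 2 + alpha) = pi / 2 - alpha by field.
rewrite -{2}[alpha]opprK cotN -(cotDnpi 1 (- alpha)) mul1r !mulNrn -opprD.
by move=> /eqP; rewrite oppr_eq0 => /eqP.
Qed.

End Alpha.

Lemma rho_dist2_le (R : realType) (l c e : R) : 0 <= c - e -> 0 < e ->
  (c - e) ^+ 2 < l -> l <= (c + e) ^+ 2 -> rho_dist2 l c <= e ^+ 2.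
Proof.
move=> c0 e0 h1 h2.
have l0 : 0 <= l by rewrite (le_trans (sqr_ge0 (c - e)))// ltW.
rewrite /rho_dist2 (_ : Num.sqrt (- l) = 0) ?expr0n ?addr0; last by rewrite ler0_sqrtr// oppr_le0.
rewrite -[leLHS]real_normK ?num_real// lerXn2r ?nnegrE// ?(ltW e0)//.
have k1 : c - e <= Num.sqrt l.
  by rewrite -[leLHS]ger0_norm// -sqrtr_sqr ler_sqrt// ltW.
have k2 : Num.sqrt l <= c + e.
  rewrite -[leRHS]ger0_norm; last by lra.
  by rewrite -sqrtr_sqr ler_sqrt// sqr_ge0.
by rewrite ler_norml; apply/andP; split; lra.
Qed.

(** * The spectrum of the graph *)

Section Windows.
Variables (R : realType) (m p : nat) (T : 'I_m -> R -> R).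
Hypothesis p_gt0 : (0 < p)%N.
Hypothesis p_lt : (p < m)%N.
Hypothesis Tpos : forall j l, 0 < T j l.
Variables (alpha kap : R) (n : nat) (e : R).
Hypothesis alphaE : alpha = acos (Num.sqrt (p%:R / m%:R)).
Hypothesis kapE : kap * pi = alpha.
Hypothesis n_gt0 : (0 < n)%N.
Hypothesis e_gt0 : 0 < e.
Hypothesis e_alpha : 2 * (e * pi) < alpha.
Hypothesis e_alpha' : 2 * (e * pi) < pi / 2 - alpha.
Hypothesis dev : forall rho j, 0 < rho -> `|rho - n.+1%:R| <= 1 ->
  `|hmod rho (T j (rho ^+ 2)) - sel p (pi / 2) 0 j - rho * pi| <= e.

(* The eigenvalue of index q (counted from 0) lies in ](c - e)^2, (c + e)^2]. *)
Definition window (c : R) (q : nat) := 0 <= c - e /\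
  (Ecount T ((c - e) ^+ 2) <= q < Ecount T ((c + e) ^+ 2))%N.

Let nS : n.+1%:R = n%:R + 1 :> R. Proof. by rewrite natr1. Qed.
Let kap_gt : 2 * e < kap.
Proof. by rewrite -(ltr_pM2r (pi_gt0 R)) kapE -mulrA. Qed.
Let kap_lt : kap < 2^-1 - 2 * e.
Proof. by rewrite -(ltr_pM2r (pi_gt0 R)) kapE; have := e_alpha'; lra. Qed.
Let epi : 0 < e * pi. Proof. by rewrite mulr_gt0// pi_gt0. Qed.

Let npm : (p * n + (m - p) * n = n * m)%N.
Proof. by rewrite -mulnDl subnKC ?(ltnW p_lt)// mulnC. Qed.
Let npm1 : (p * n.+1 + (m - p) * n = n * m + p)%N.
Proof. by rewrite mulnS -addnA npm addnC. Qed.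
Let npmS : (p * n.+1 + (m - p) * n.+1 = n * m + m)%N.
Proof. by rewrite -mulnDl subnKC ?(ltnW p_lt)// mulnC mulSn addnC. Qed.

Let leqD1 (a : nat) (b : bool) : (a + b <= a.+1)%N.
Proof. by rewrite -addn1 leq_add2l leq_b1. Qed.

(** All limiting angles have passed exactly n multiples of pi after 0, so n m eigenvalues lie below
    and one more is counted above. *)
Lemma window_left : window (n.+1%:R - 1 + kap) (n * m).
Proof.
have n1 : 1 <= n%:R :> R by rewrite ler1n.
have pi0 := pi_gt0 R.
have e0 := e_gt0; have kg := kap_gt; have kl := kap_lt; have ep := epi.
have ea := e_alpha; have ea' := e_alpha'.
rewrite nS; have c0 : n%:R + 1 - 1 + kap = n%:R + kap by ring.
rewrite c0; split; first lra.
have cN : pi / 2 + (n%:R + kap) * pi = n%:R * pi + (pi / 2 + alpha) by rewrite -kapE; ring.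
have cD : (n%:R + kap) * pi = n%:R * pi + alpha by rewrite -kapE; ring.
have bal := balance_left R p_gt0 p_lt; rewrite -alphaE in bal.
have al0 := alpha_gt0 R p_gt0 p_lt; rewrite -alphaE in al0.
rewrite (Ecount_above_balanced p_lt Tpos e_gt0 dev cN cD bal) ?(Ecount_below_balanced p_lt Tpos e_gt0 dev cN cD bal);
  rewrite ?nS ?ler_norml; try lra.
all: try by apply/andP; split; lra.
by rewrite npm leqnn addn1 ltnS leqnn.
Qed.

(** Here the p Neumann angles have already passed (n + 1) pi and the Dirichlet angles have not,
    which puts n m + p eigenvalues below. *)
Lemma window_right : window (n.+1%:R - kap) (n * m + p).
Proof.
have n1 : 1 <= n%:R :> R by rewrite ler1n.
have pi0 := pi_gt0 R.
have e0 := e_gt0; have kg := kap_gt; have kl := kap_lt; have ep := epi.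
have ea := e_alpha; have ea' := e_alpha'.
split; first by rewrite nS; lra.
have cN : pi / 2 + (n.+1%:R - kap) * pi = n.+1%:R * pi + (pi / 2 - alpha) by rewrite -kapE; ring.
have cD : (n.+1%:R - kap) * pi = n%:R * pi + (pi - alpha) by rewrite -kapE nS; ring.
have bal := balance_right R p_gt0 p_lt; rewrite -alphaE in bal.
have al0 := alpha_gt0 R p_gt0 p_lt; rewrite -alphaE in al0.
rewrite (Ecount_above_balanced p_lt Tpos e_gt0 dev cN cD bal) ?(Ecount_below_balanced p_lt Tpos e_gt0 dev cN cD bal);
  rewrite ?nS ?ler_norml; try lra.
all: try by apply/andP; split; lra.
by rewrite npm1 leqnn addn1 ltnS leqnn.
Qed.

(** The p Neumann angles cross (n + 1) pi almost together, so the count passes from at most n m + 1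
    to at least n m + p. The 1 allows for the unknown sign of the sum of cotangents; p - 1 indices
    remain. *)
Lemma window_half r : (0 < r)%N -> (r < p)%N -> window (n.+1%:R - 2^-1) (n * m + r).
Proof.
have n1 : 1 <= n%:R :> R by rewrite ler1n.
have pi0 := pi_gt0 R.
have e0 := e_gt0; have kg := kap_gt; have kl := kap_lt; have ep := epi.
have ea := e_alpha; have ea' := e_alpha'.
move=> r0 rp; split; first by rewrite nS; lra.
(* One Neumann angle in two forms: remainder 0 for counting above c, remainder pi for counting
   below. *)
have cN : pi / 2 + (n.+1%:R - 2^-1) * pi = n.+1%:R * pi + 0 :> R by field.
have cN' : pi / 2 + (n.+1%:R - 2^-1) * pi = n%:R * pi + pi :> R by rewrite nS; field.
have cD : (n.+1%:R - 2^-1) * pi = n%:R * pi + pi / 2 :> R by rewrite nS; field.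
have al0 := alpha_gt0 R p_gt0 p_lt; rewrite -alphaE in al0.
have [||||||y _ ->] := Ecount_above p_lt Tpos e_gt0 dev cN cD;
  try by rewrite ?nS ?ler_norml; try (apply/andP; split); lra.
have [||||||z _ ->] := Ecount_below p_lt Tpos e_gt0 dev cN' cD;
  try by rewrite ?nS ?ler_norml; try (apply/andP; split); lra.
rewrite npm npm1; apply/andP; split.
  by rewrite (leq_trans (leqD1 _ _))// -addn1 leq_add2l.
by apply: leq_trans (leq_addr _ _); rewrite ltn_add2l.
Qed.

(** The Dirichlet angles now cross (n + 1) pi: the count passes from at most n m + p + 1 to at least
    n m + m, leaving m - p - 1 indices. *)
Lemma window_int r : (p < r)%N -> (r < m)%N -> window n.+1%:R (n * m + r).
Proof.
have n1 : 1 <= n%:R :> R by rewrite ler1n.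
have pi0 := pi_gt0 R.
have e0 := e_gt0; have kg := kap_gt; have kl := kap_lt; have ep := epi.
have ea := e_alpha; have ea' := e_alpha'.
move=> pr rm; split; first by rewrite nS; lra.
have cN : pi / 2 + n.+1%:R * pi = n.+1%:R * pi + pi / 2 :> R by ring.
have cD : n.+1%:R * pi = n.+1%:R * pi + 0 :> R by ring.
have cD' : n.+1%:R * pi = n%:R * pi + pi :> R by rewrite nS; ring.
have al0 := alpha_gt0 R p_gt0 p_lt; rewrite -alphaE in al0.
have [||||||y _ ->] := Ecount_above p_lt Tpos e_gt0 dev cN cD;
  try by rewrite ?nS ?ler_norml; try (apply/andP; split); lra.
have [||||||z _ ->] := Ecount_below p_lt Tpos e_gt0 dev cN cD';
  try by rewrite ?nS ?ler_norml; try (apply/andP; split); lra.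
rewrite npmS npm1; apply/andP; split.
  by rewrite (leq_trans (leqD1 _ _))// -addnS leq_add2l.
by apply: leq_trans (leq_addr _ _); rewrite ltn_add2l.
Qed.

End Windows.

(** * Solutions on the graph for a real spectral parameter as coefficient vectors *)

Section GraphSolutions.
Variables (R : realType) (m p : nat) (sigma : 'I_m -> R -> R).
Hypothesis sL2 : forall j, L2_0pi (sigma j).
Variables (a : R) (th : 'I_m -> R -> R).
Hypothesis th_pruefer : forall j, pruefer (sigma j) a (th j).
Hypothesis th_0 : forall j, th j 0 = sel p (pi / 2) 0 j.

Let rad j := prad (sigma j) a (th j).
Definition ysol j x := rad j x * sin (th j x).
Definition zsol j x := rad j x * cos (th j x).

Let yz_sol j : lin_sol (sigma j) a (ysol j) (zsol j).
Proof. exact: pruefer_lin_sol. Qed.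

Let yz0 (j : 'I_m) : ysol j 0 = (j < p)%N%:R /\ zsol j 0 = (p <= j)%N%:R.
Proof.
rewrite /ysol /zsol /rad prad0 th_0 /sel; case: ltnP => _.
  by rewrite sin_pihalf cos_pihalf mulr1 mulr0.
by rewrite sin0 cos0 mulr1 mulr0.
Qed.

Let is_matched := matched (fun j => rad j pi) (fun j => th j pi).

Lemma solution_of_matched c : is_matched c ->
  is_solL p sigma a 0 (QS (fun j x => c j * ysol j x) (fun _ _ => 0)
    (fun j x => c j * zsol j x) (fun _ _ => 0)).
Proof.
move=> [cy cz]; split => /=.
- move=> j; apply/(edge_sol_real (sL2 j)); split; first exact: lin_solZ.
  split; apply: AC_eq (AC_cst 0) => // x _; rewrite /rhs_y /rhs_z; ring.
- by move=> i j; split => //; exact: cy.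
- by split => //; rewrite big1.
- move=> j jp; split => //; have [_ ->] := yz0 j; by rewrite leqNgt jp mulr0.
- move=> j jp; split => //; have [-> _] := yz0 j; by rewrite ltnNge jp mulr0.
Qed.

(** Real and imaginary parts decouple for real lambda, and on each edge the boundary condition
    leaves a line of real solutions, spanned by [ysol]. *)
Lemma matched_of_solution Y : is_solL p sigma a 0 Y -> exists c c' : 'I_m -> R,
  [/\ is_matched c, is_matched c' & forall j x, 0 <= x <= pi ->
    qu Y j x = c j * ysol j x /\ qv Y j x = c' j * ysol j x].
Proof.
move=> [Ed M [Sw Ss] bN bD].
(* The initial value left free by the boundary condition; there [ysol], respectively [zsol], equals
   1. *)
pose coef (u w : 'I_m -> R -> R) (j : 'I_m) := if (j < p)%N then u j 0 else w j 0.
have H u w : (forall j, lin_sol (sigma j) a (u j) (w j)) ->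
    (forall j : 'I_m, (j < p)%N -> w j 0 = 0) -> (forall j : 'I_m, (p <= j)%N -> u j 0 = 0) ->
    forall j x, 0 <= x <= pi -> u j x = coef u w j * ysol j x /\ w j x = coef u w j * zsol j x.
  move=> L w0 u0 j; have [y0 z0] := yz0 j.
  apply: (lin_sol_uniq (sL2 j) (L j) (yz_sol j)); rewrite ?y0 ?z0 /coef; case: ltnP => h.
  - by rewrite mulr1.
  - by rewrite mulr0 u0.
  - by rewrite mulr0 w0.
  - by rewrite mulr1.
have L j := (edge_sol_real (sL2 j) a _ _ _ _).1 (Ed j).
have Hu := H (qu Y) (qw Y) (fun j => (L j).1) (fun j h => (bN j h).1) (fun j h => (bD j h).1).
have Hv := H (qv Y) (qs Y) (fun j => (L j).2) (fun j h => (bN j h).2) (fun j h => (bD j h).2).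
have ppi := in0pi_pi R.
exists (coef (qu Y) (qw Y)), (coef (qv Y) (qs Y)); split.
- split.
    move=> i j; have [h _] := Hu i pi ppi; have [h' _] := Hu j pi ppi.
    by rewrite -/(ysol i pi) -/(ysol j pi) -h -h'; case: (M i j).
  by rewrite -[RHS]Sw; apply: eq_bigr => j _; have [_ ->] := Hu j pi ppi.
- split.
    move=> i j; have [h _] := Hv i pi ppi; have [h' _] := Hv j pi ppi.
    by rewrite -/(ysol i pi) -/(ysol j pi) -h -h'; case: (M i j).
  by rewrite -[RHS]Ss; apply: eq_bigr => j _; have [_ ->] := Hv j pi ppi.
by move=> j x xI; have [-> _] := Hu j x xI; have [-> _] := Hv j x xI.
Qed.

Lemma ysol_neq0 j : exists2 x, 0 <= x <= pi & ysol j x != 0.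
Proof.
have [x xI sx] := pruefer_not_const (th_pruefer j).
by exists x => //; rewrite mulf_neq0// gt_eqF// expR_gt0.
Qed.

End GraphSolutions.

(** * The end angles satisfy the assumptions of the counting argument *)

Section EdgeAngles.
Variables (R : realType) (m p : nat) (sigma : 'I_m -> R -> R).
Hypothesis sL2 : forall j, L2_0pi (sigma j).
Hypothesis m_gt0 : (0 < m)%N.
Variable th : 'I_m -> R -> R -> R.
Hypothesis th_pruefer : forall j l, pruefer (sigma j) l (th j l).
Hypothesis th_0 : forall j l, th j l 0 = sel p (pi / 2) 0 j.

Definition end_angle j l := th j l pi.

Lemma end_angle_incr j l l' : l < l' -> end_angle j l < end_angle j l'.
Proof. by apply: pruefer_incr (th_pruefer j l) (th_pruefer j l') _ => //; rewrite !th_0. Qed.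

Lemma end_angle_cont j : continuous (end_angle j).
Proof.
move=> l; apply/cvgrPdist_lt => e e0.
have [C HC] := pruefer_lipschitz (sL2 j) l.
have C1 : 0 < `|C| + 1 by rewrite ltr_wpDl.
exists (e / (`|C| + 1)) => /=; first by rewrite divr_gt0.
move=> l' /=; rewrite ltr_pdivlMr// distrC => h.
rewrite distrC (le_lt_trans (HC _ l' _ (th_pruefer j l) (th_pruefer j l') _)) ?th_0//.
apply: le_lt_trans h; rewrite mulrC ler_wpM2l// (le_trans (ler_norm C))// lerDl//.
Qed.

Lemma end_angle_gt0 j l : 0 < end_angle j l.
Proof.
apply: pruefer_gt0 (th_pruefer j l) _ => //; rewrite th_0 /sel.
by case: ifP => _ //; rewrite divr_ge0 ?pi_ge0.
Qed.

(** Once all angles lie in (0, pi / 2), every floor is 0 and every cotangent is positive, so both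
    parts of the count vanish. *)
Lemma end_angle_low : exists l, Ecount end_angle l = 0%N.
Proof.
have pi0 := pi_gt0 R.
have H j : exists l, end_angle j l <= pi / 4.
  have [l Hl] := pruefer_low (sL2 j); exists l; apply: Hl (th_pruefer j l) _.
  by rewrite th_0 /sel; case: ifP => // _; lra.
have [l lP] := boolp.choice H.
pose l0 := - \sum_j `|l j|.
have T0 j : 0 < end_angle j l0 < pi / 2.
  rewrite end_angle_gt0 /=; apply: (@le_lt_trans _ _ (pi / 4)); last by lra.
  apply: le_trans (lP j).
  have : l0 <= l j.
    rewrite lerNl (bigD1 j)//= (le_trans (_ : - l j <= `|l j|))//.
      by rewrite -normrN ler_norm.
    by rewrite lerDl sumr_ge0.
  by rewrite le_eqVlt => /orP[/eqP -> //|/(end_angle_incr j)/ltW].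
exists l0; rewrite /Ecount /npoles big1 ?add0n; last first.
  move=> j _; have /andP[h1 h2] := T0 j.
  by rewrite -[end_angle j l0]add0r -(mul0r pi) (@npi_nat R 0) ?(ltW h1)//; lra.
rewrite (_ : (cotsum _ _ <= 0) = false) ?andbF//; apply/negbTE; rewrite -ltNge.
rewrite /cotsum (bigD1 (Ordinal m_gt0))//= ltr_pwDl//; last first.
  apply: sumr_ge0 => j _; have /andP[h1 h2] := T0 j.
  by rewrite divr_ge0// ltW// ?sin_gt0_pihalf ?cos_gt0_pihalf ?h1 ?h2//; apply/andP; split; lra.
have /andP[h1 h2] := T0 (Ordinal m_gt0).
by rewrite divr_gt0// ?sin_gt0_pihalf ?cos_gt0_pihalf ?h1 ?h2//; apply/andP; split; lra.
Qed.

Lemma end_angle_dev : exists2 eps : nat -> R, sqs eps & forall n, 0 < eps n /\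
  ((0 < n)%N -> forall rho j, 0 < rho -> `|rho - n.+1%:R| <= 1 ->
    `|hmod rho (end_angle j (rho ^+ 2)) - sel p (pi / 2) 0 j - rho * pi| <= eps n).
Proof.
have [d dP] := boolp.choice (fun j => angle_asymptotics (sL2 j)).
(* The index is shifted because block n, counted from 0, lies around n + 1. The sum bounds all edges
   at once, and the last term makes the bound strictly positive. *)
exists (fun n => \sum_j `|d j n.+1| + n.+1%:R^-1).
  apply: sqsD; last exact: sqs_harmonic.
  apply: sqs_sum => j; have [[M HM] _] := dP j.
  exists M => N; apply: le_trans (HM N.+1).
  rewrite big_ord_recl /= (eq_bigr (fun i : 'I_N => d j (lift ord0 i) ^+ 2)).
    by rewrite lerDr sqr_ge0.
  by move=> i _; rewrite real_normK ?num_real.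
move=> n; split; first by rewrite ltr_wpDl ?invr_gt0// sumr_ge0.
move=> n0 rho j r0 rn; have [_ H] := dP j.
have := H n.+1 rho (th j (rho ^+ 2)) _ rn (th_pruefer j _).
rewrite th_0 => /(_ n0) h; apply: le_trans (h _) _.
  by rewrite /sel; case: ifP => _; rewrite ?cos_pihalf ?sin0 ?mulr0 ?mul0r.
rewrite (le_trans (ler_norm _))// (bigD1 j)//= -addrA lerDl addr_ge0 ?invr_ge0//.
exact: sumr_ge0.
Qed.

End EdgeAngles.

(** * Order of the eigenvalues inside a block of m *)

Section IndexOrder.
Variables (m p : nat).
Hypothesis p_gt1 : (1 < p)%N.
Hypothesis p_lt : (p < m)%N.

(* The increasing order inside the n-th block of m eigenvalues: k = 0 comes first, then
   I3, then k = 1, then I4. *)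
Definition block_pos (k : nat) : nat :=
  if k == 0%N then 0%N else if k == 1%N then p else if (k <= p)%N then k.-1 else k.

Lemma block_pos_lt (k : 'I_m) : (block_pos k < m)%N.
Proof.
rewrite /block_pos; case: ifP => _; first exact: leq_ltn_trans p_lt.
case: ifP => // _; case: ifP => // _; exact: leq_ltn_trans (leq_pred _) (ltn_ord k).
Qed.

Lemma block_pos_half k : (2 <= k)%N && (k < p.+1)%N -> (0 < block_pos k)%N /\ (block_pos k < p)%N.
Proof. by rewrite /block_pos; case: k => [|[|k]] //= kp; case: ifP; lia. Qed.

Lemma block_pos_int k : (p < k)%N -> block_pos k = k.
Proof. by rewrite /block_pos; case: k => [|[|k]] //= kp; [lia | case: ifP; lia]. Qed.

Definition block_ord (k : 'I_m) : 'I_m := Ordinal (block_pos_lt k).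

Lemma block_ord_inj : injective block_ord.
Proof.
move=> k k' /(congr1 val) /= E; apply: val_inj => /=; move: E.
case: k k' => [k /= _] [k' /= _]; rewrite /block_pos.
case: k => [|[|k]]; case: k' => [|[|k']] //=;
  rewrite ?eqSS ?eqn0Ngt //=; repeat case: ifP => //=; lia.
Qed.

Lemma card_range (b c : nat) : (b <= c)%N -> (c <= m)%N ->
  #|[set k : 'I_m | (b <= k)%N && (k < c)%N]%SET| = (c - b)%N.
Proof.
move=> bc cm; rewrite -sum1_card.
have := @sum_window nat b (c - b) m (fun=> 1%N); rewrite subnKC// => /(_ cm).
have -> : \sum_(i < c - b) 1%N = (c - b)%N by rewrite -[RHS]card_ord -sum1_card.
by move=> <-; apply: eq_bigl => k; rewrite inE.
Qed.

End IndexOrder.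

Theorem theorem1 (R : realType) (m p : nat) (sigma : 'I_m -> R -> R) :
  (4 <= m)%N -> (2 <= p)%N -> (p <= m - 2)%N ->
  (forall j, L2_0pi (sigma j)) ->
  let alpha : R := acos (Num.sqrt (p%:R / m%:R)) in
  (* no non-real eigenvalues *)
  (forall (a b : R) (Y : qstate R m), is_solL p sigma a b Y -> b != 0 -> qzero Y) /\
  exists (lam : nat -> 'I_m -> R) (phi : nat -> 'I_m -> qstate R m)
         (I3 I4 : {set 'I_m}),
    (* phi n k is an eigenfunction for lam n k *)
    (forall n k, is_solL p sigma (lam n k) 0 (phi n k)) /\
    (* for every real a: finitely many indices with lam n k = a, and the
       corresponding phi's form a (complex) basis of the eigenspace of a,
       i.e. the list lam counts every eigenvalue with its multiplicity *)
    (forall a : R, exists N : nat,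
       (forall n k, lam n k = a -> (n < N)%N) /\
       (forall Y : qstate R m, is_solL p sigma a 0 Y ->
          exists c1 c2 : nat -> 'I_m -> R, forall j x, 0 <= x <= pi ->
            qu Y j x = comb_u N lam a phi c1 c2 j x /\
            qv Y j x = comb_v N lam a phi c1 c2 j x) /\
       (forall c1 c2 : nat -> 'I_m -> R,
          (forall j x, 0 <= x <= pi ->
             comb_u N lam a phi c1 c2 j x = 0 /\ comb_v N lam a phi c1 c2 j x = 0) ->
          forall n k, (n < N)%N -> lam n k = a -> c1 n k = 0 /\ c2 n k = 0)) /\
    (* index sets *)
    (I3 :|: I4 = [set k : 'I_m | (2 <= k)%N])%SET /\ (I3 :&: I4 = finset.set0)%SET /\
    #|I3| = (p - 1)%N /\ #|I4| = (m - p - 1)%N /\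
    (* asymptotics rho_{nk} = ... + kappa_n, kappa in l_2 *)
    (forall k : 'I_m, nat_of_ord k = 0%N ->
       summable_nonneg (fun n => rho_dist2 (lam n k) (n.+1%:R - 1 + alpha / pi))) /\
    (forall k : 'I_m, nat_of_ord k = 1%N ->
       summable_nonneg (fun n => rho_dist2 (lam n k) (n.+1%:R - alpha / pi))) /\
    (forall k, k \in I3 ->
       summable_nonneg (fun n => rho_dist2 (lam n k) (n.+1%:R - 2^-1))) /\
    (forall k, k \in I4 ->
       summable_nonneg (fun n => rho_dist2 (lam n k) n.+1%:R)).
Proof.
move=> m4 p2 pm sL2 alpha; split.
  by move=> a b Y; exact: no_complex_eigenvalue.
have p0 : (0 < p)%N by lia.
have p_lt : (p < m)%N by lia.
have m0 : (0 < m)%N by lia.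
have [th thP] := boolp.choice (fun j => pruefer_exists (sL2 j) (sel p (pi / 2) 0 j)).
have thA j l : pruefer (sigma j) l (th j l) by case: (thP j l).
have th0 j l : th j l 0 = sel p (pi / 2) 0 j by case: (thP j l).
pose T := end_angle th.
have Tinc := end_angle_incr sL2 thA th0.
have Tcont := end_angle_cont sL2 thA th0.
have Tpos := end_angle_gt0 sL2 thA th0.
have Emono := Ecount_mono m0 Tinc Tpos.
have Eright := Ecount_right m0 Tinc Tcont Tpos.
have Eleft := Ecount_left m0 Tinc Tcont Tpos.
have Elow := end_angle_low sL2 m0 thA th0.
have [eps eps2 epsP] := end_angle_dev sL2 thA th0.
have al0 : 0 < alpha := alpha_gt0 R p0 p_lt.
have al1 : alpha < pi / 2 := alpha_lt R p0 p_lt.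
have pi0 := pi_gt0 R.
(* eps n < eta says that 2 (eps n) pi is smaller than both alpha and pi / 2 - alpha, as the windows
   require. *)
pose eta := Num.min alpha (pi / 2 - alpha) / (2 * pi).
have eta0 : 0 < eta by rewrite divr_gt0 ?mulr_gt0// lt_min al0 subr_gt0.
have [n0 n0P] := sqs_small eps2 eta0.
have kapE : alpha / pi * pi = alpha by rewrite divfK// gt_eqF.
have small n : (n0 < n)%N -> [/\ 0 < eps n, 2 * (eps n * pi) < alpha &
    2 * (eps n * pi) < pi / 2 - alpha].
  move=> /ltnW /n0P; have [e0 _] := epsP n; rewrite gtr0_norm// /eta => h.
  have : 2 * (eps n * pi) < Num.min alpha (pi / 2 - alpha).
    by move: h; rewrite ltr_pdivlMr ?mulr_gt0// mulrCA.
  by rewrite lt_min => /andP[].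
have pos n : (n0 < n)%N -> (0 < n)%N by case: n.
have dev n n0n := (epsP n).2 (pos n n0n).
(* The windows around n + alpha / pi already show that the count exceeds n m. *)
have Eunb q : exists l, (q < Ecount T l)%N.
  pose n := maxn q n0.+1.
  have n0n : (n0 < n)%N by rewrite leq_max leqnn orbT.
  have [e0 e1 e2] := small n n0n.
  have [_ /andP[_ h]] := window_left p0 p_lt Tpos erefl kapE (pos n n0n) e0 e1 e2 (dev n n0n).
  eexists; apply: leq_ltn_trans h.
  by rewrite (leq_trans (leq_maxl q n0.+1))// leq_pmulr.
pose la := level (Ecount T).
have laE q a : (la q == a) = (Ecount T a <= q + mult T a)%N && (q < Ecount T a)%N.
  exact: level_eq.
have laL q x : (la q <= x) = (q < Ecount T x)%N by exact: level_le.
have mulE a : (mult T a <= Ecount T a)%N by exact: (mult_le Eleft).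
have [B BP] := boolp.choice (fun a => matching_basis (r := fun j => prad (sigma j) a (th j a) pi)
  (fun j => T j a) m0 (fun j => expR_gt0 _)).
pose lam n (k : 'I_m) := la (n * m + block_pos p k)%N.
pose ys a := ysol sigma a (th^~ a); pose zs a := zsol sigma a (th^~ a).
(* The rank of q among the indices that share its eigenvalue; it selects the basis vector, so that
   equal eigenvalues receive independent eigenfunctions. *)
pose idx q := (q - (Ecount T (la q) - mult T (la q)))%N.
pose phi n (k : 'I_m) := let q := (n * m + block_pos p k)%N in
  QS (fun j x => B (la q) (idx q) j * ys (la q) j x) (fun _ _ => 0)
     (fun j x => B (la q) (idx q) j * zs (la q) j x) (fun _ _ => 0).
exists lam, phi, [set k : 'I_m | (2 <= k)%N && (k < p.+1)%N]%SET,
  [set k : 'I_m | (p.+1 <= k)%N && (k < m)%N]%SET.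
have idx_lt q : (idx q < mult T (la q))%N.
  have := eqxx (la q); rewrite laE /idx; have := mulE (la q); lia.
split.
  move=> n k; have [h _ _] := BP (lam n k).
  exact: (solution_of_matched sL2 (thA^~ (lam n k)) (th0^~ (lam n k)) (h _ (idx_lt _))).
split; last first.
  do 4?split.
  - by apply/setP => k; rewrite !inE ltn_ord andbT; have := ltn_ord k; lia.
  - by apply/setP => k; rewrite !inE; lia.
  - by rewrite card_range; lia.
  - by rewrite card_range; lia.
  have asym c r : (forall n, (n0 < n)%N -> window T (eps n) (c n) (n * m + r)) ->
      summable_nonneg (fun n => rho_dist2 (la (n * m + r)%N) (c n)).
    move=> W; apply: (@summable_le _ _ (fun n => eps n ^+ 2) n0.+1) => //.
      move=> n n0n; have [c0 /andP[h1 h2]] := W n n0n.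
      have [e0 _ _] := small n n0n.
      apply: rho_dist2_le => //; last by rewrite laL.
      by rewrite ltNge laL -leqNgt.
    by move=> n; exact: sqr_ge0.
  do 3?split.
  - move=> k k0; rewrite /lam /block_pos k0 /=; apply: asym => n n0n; rewrite addn0.
    have [e0 e1 e2] := small n n0n.
    exact: (window_left p0 p_lt Tpos erefl kapE (pos n n0n) e0 e1 e2 (dev n n0n)).
  - move=> k k0; rewrite /lam /block_pos k0 /=; apply: asym => n n0n.
    have [e0 e1 e2] := small n n0n.
    exact: (window_right p0 p_lt Tpos erefl kapE (pos n n0n) e0 e1 e2 (dev n n0n)).
  - move=> k; rewrite inE => kI; apply: asym => n n0n.
    have [k0 kp] : (0 < block_pos p k)%N /\ (block_pos p k < p)%N by exact: block_pos_half.
    have [e0 e1 e2] := small n n0n.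
    exact: (window_half p0 p_lt Tpos erefl kapE (pos n n0n) e0 e1 e2 (dev n n0n) k0 kp).
  - move=> k; rewrite inE => /andP[kp km]; apply: asym => n n0n.
    have [e0 e1 e2] := small n n0n.
    have -> : block_pos p k = k by exact: block_pos_int.
    exact: (window_int p0 p_lt Tpos erefl kapE (pos n n0n) e0 e1 e2 (dev n n0n) kp km).
(* A crude bound: an index n m + r of the eigenvalue a is less than [Ecount T a], hence so is n. *)
move=> a; pose N := Ecount T a; exists N.
have lam_lt n k : lam n k = a -> (n < N)%N.
  move=> /eqP; rewrite laE => /andP[_]; apply: leq_ltn_trans.
  by rewrite (leq_trans (leq_pmulr n m0))// leq_addr.
split => //.
pose b := (Ecount T a - mult T a)%N.
have bi : injective (block_ord p_lt) by apply: block_ord_inj.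
pose rinv (r : 'I_m) := invF bi r.
(* Decoding of q = n m + [block_pos p k]: n is the quotient by m and k the preimage of the
   remainder. *)
pose qn (q : nat) := (q %/ m)%N; pose qk (q : nat) := rinv (Ordinal (ltn_pmod q m0)).
have qnE n (k : 'I_m) : qn (n * m + block_pos p k)%N = n.
  by rewrite /qn divnMDl// divn_small ?addn0//; exact: block_pos_lt.
have qkE n (k : 'I_m) : qk (n * m + block_pos p k)%N = k.
  rewrite /qk (_ : Ordinal _ = block_ord p_lt k); first exact: invF_f.
  by apply: val_inj; rewrite /= modnMDl modn_small//; exact: block_pos_lt.
have nkE q : (qn q * m + block_pos p (qk q))%N = q.
  have -> : block_pos p (qk q) = (q %% m)%N.
    by have /(congr1 val) := f_invF bi (Ordinal (ltn_pmod q m0)).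
  exact: esym (divn_eq q m).
(* All [phi n k] are real, so the real and imaginary parts of a complex combination involve c1 and
   c2 separately. The double sum is flattened to q < N m, where the condition lam = a singles out
   the [mult T a] consecutive indices starting at b. *)
have comb (c : nat -> 'I_m -> R) j x :
    \sum_(n < N) \sum_(k < m | lam n k == a) c n k * qu (phi n k) j x =
    (\sum_(i < mult T a) c (qn (b + i)%N) (qk (b + i)%N) * B a i j) * ys a j x.
  pose H q := if la q == a then c (qn q) (qk q) * (B (la q) (idx q) j * ys (la q) j x) else 0.
  transitivity (\sum_(n < N) \sum_(k < m) H (n * m + block_ord p_lt k)%N).
    apply: eq_bigr => n _; rewrite big_mkcond; apply: eq_bigr => k _.
    by rewrite /H /= qnE qkE.
  rewrite sum_rows//.
  pose G q := c (qn q) (qk q) * B a (q - b)%N j * ys a j x.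
  transitivity (\sum_(q < N * m | (b <= q)%N && (q < b + mult T a)%N) G q); last first.
    rewrite sum_window; last by rewrite subnK// leq_pmulr.
    by rewrite mulr_suml; apply: eq_bigr => i _; rewrite /G addKn.
  rewrite [RHS]big_mkcond; apply: eq_bigr => q _; rewrite /H.
  have -> : (la q == a) = (b <= q)%N && (q < b + mult T a)%N.
    by rewrite laE /b; have := mulE a; lia.
  case: ifP => // qb.
  have la_a : la q = a.
    by apply/eqP; rewrite laE; move: qb; rewrite /b; have := mulE a; lia.
  by rewrite /idx /G la_a -/b mulrA.
have combu c1 c2 j x : comb_u N lam a phi c1 c2 j x =
    (\sum_(i < mult T a) c1 (qn (b + i)%N) (qk (b + i)%N) * B a i j) * ys a j x.
  rewrite -comb; apply: eq_bigr => n _; apply: eq_bigr => k _.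
  by rewrite /= mulr0 subr0.
have combv c1 c2 j x : comb_v N lam a phi c1 c2 j x =
    (\sum_(i < mult T a) c2 (qn (b + i)%N) (qk (b + i)%N) * B a i j) * ys a j x.
  rewrite -comb; apply: eq_bigr => n _; apply: eq_bigr => k _.
  by rewrite /= mulr0 add0r.
have [_ Bspan Bfree] := BP a.
split.
  move=> Y /(matched_of_solution sL2 (thA^~ a) (th0^~ a)) [c [c' [Mc Mc' YE]]].
  have [al alE] := Bspan c Mc; have [al' alE'] := Bspan c' Mc'.
  (* Only indices b + i enter the sums, so the truncated subtraction is exact there. *)
  exists (fun n k => al (n * m + block_pos p k - b)%N), (fun n k => al' (n * m + block_pos p k - b)%N).
  move=> j x xI; rewrite combu combv; have [-> ->] := YE j x xI; rewrite alE alE'.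
  by split; congr (_ * _); apply: eq_bigr => i _; rewrite nkE addKn.
have free (c : nat -> 'I_m -> R) : (forall j x, 0 <= x <= pi ->
      (\sum_(i < mult T a) c (qn (b + i)%N) (qk (b + i)%N) * B a i j) * ys a j x = 0) ->
    forall n k, lam n k = a -> c n k = 0.
  move=> c0 n k /eqP; rewrite laE => qa.
  have ci : forall i, (i < mult T a)%N -> c (qn (b + i)%N) (qk (b + i)%N) = 0.
    apply: (Bfree (fun i => c (qn (b + i)%N) (qk (b + i)%N))) => j.
    (* At a point where [ysol] does not vanish the relation between functions becomes one between
       the coefficients of edge j. *)
    have [x xI yx] := ysol_neq0 (thA^~ a) j.
    by have := c0 j x xI => /eqP; rewrite mulf_eq0 (negbTE yx) orbF => /eqP.
  have := ci (n * m + block_pos p k - b)%N.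
  rewrite subnKC ?qnE ?qkE; last by move: qa; rewrite /b; lia.
  by apply; move: qa; rewrite /b; have := mulE a; lia.
move=> c1 c2 c0 n k _ lamE; split.
  by apply: free lamE => j x xI; have [+ _] := c0 j x xI; rewrite combu.
by apply: free lamE => j x xI; have [_] := c0 j x xI; rewrite combv.
Qed.
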